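(* Let $g_t(\lambda)$ be the limiting gap density function defined in the context. For $t>2/3$ and $\lambda>0$ it is given by the following expressions. 1. If $2<t$, $$g_t(\lambda)=\begin{cases}\frac t2 & \text{if } 0<\lambda<\frac2t,\\ \frac t4 & \text{if } \lambda=\frac2t,\\ 0 & \text{if } \frac2t<\lambda.\end{cases}$$ 2. If $1<t\le2$, $$g_t(\lambda)=\begin{cases}\frac{t^2}{2}-\frac t2-t\log\left(\frac t2\right) & \text{if } 0<\lambda<1,\\ \frac{t^2}{2}-\frac t2-t\log\left(\frac{\lambda t}{2}\right) & \text{if } 1\le\lambda<\frac2t,\\ \frac{t^2}{4}-\frac t4 & \text{if } \lambda=\frac2t,\\ 0 & \text{if } \frac2t<\lambda.\end{cases}$$ 3. If $2/3<t\le1$, $$g_t(\lambda)=\begin{cases}t^2-t-\frac32t\log(t)+t\log(2) & \text{if } 0<\lambda<1,\\ t^2+t-\frac{2t}{\lambda}-3t\log(\lambda)-\frac{3t}{2}\log(t)+t\log(2) & \text{if } 1\le\lambda<\frac1t,\\ -t^2+t-t\log\left(\frac\lambda2\right)+\frac t2\log(t) & \text{if } \frac1t\le\lambda\le2,\\ -t^2+\frac{2t}{\lambda}+\frac t2\log\left(\frac{\lambda t}{2}\right) & \text{if } 2\le\lambda\le\frac2t,\\ 0 & \text{if } \frac2t<\lambda.\end{cases}$$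
   Context: Fix $t>0$. For a positive integer $J$ (large enough that $tJ^2>J$) let $P_{t,J}=(-tJ^2,0)$ and $O=(0,0)$, and let $\mathcal R_J=\mathbb Z^2\cap([-J,J]\times[0,J])$, a set of $N=N_J=(2J+1)(J+1)$ lattice points. For $P\in\mathcal R_J$ consider the angle $\angle(P P_{t,J} O)$ at the vertex $P_{t,J}$ between the rays from $P_{t,J}$ to $P$ and to $O$. List these $N$ angles, with multiplicity, in nondecreasing order: $0=\alpha_1\le\alpha_2\le\dots\le\alpha_N=\alpha_{\max}$, and put $\Delta_{av}=\alpha_{\max}/N_J$. The density of the gap distribution is, for $\lambda>0$, $$g_t(\lambda)=\lim_{\delta\searrow0}\frac{1}{2\delta}\lim_{J\to\infty}\frac{1}{2J^2}\#\left\{j:\ 1\le j\le N-1,\ \frac{\alpha_{j+1}-\alpha_j}{\Delta_{av}}\in[\lambda-\delta,\lambda+\delta)\right\}.$$ *)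

(* Defs.v *)
From HB Require Import structures.
From mathcomp Require Import all_boot all_order all_algebra.
From mathcomp Require Import all_classical all_reals all_analysis.

Set Implicit Arguments.
Unset Strict Implicit.
Unset Printing Implicit Defensive.

Import Order.TTheory GRing.Theory Num.Theory.
Import numFieldNormedType.Exports.

Local Open Scope classical_set_scope.
Local Open Scope ring_scope.

(* The library norm on the product R * R is the sup norm, hence the explicit
   Euclidean inner product and length. *)
Definition dot2 (R : realType) (u v : R * R) : R := u.1 * v.1 + u.2 * v.2.

Definition enorm2 (R : realType) (u : R * R) : R := Num.sqrt (dot2 u u).

(* Unoriented angle at the vertex V between the rays VA and VB, in [0, pi];
   meaningful when A and B both differ from V. *)
Definition vertex_angle (R : realType) (A V B : R * R) : R :=
  acos (dot2 (A - V) (B - V) / (enorm2 (A - V) * enorm2 (B - V))).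

Definition observer (R : realType) (t : R) (J : nat) : R * R :=
  (- (t * J%:R ^+ 2), 0).

Definition lattice_box (J : nat) : seq (int * int) :=
  [seq (x%:Z - J%:Z, y%:Z) | x <- iota 0 (2 * J).+1, y <- iota 0 J.+1].

Definition box_card (J : nat) : nat := ((2 * J + 1) * (J + 1))%N.

Lemma size_lattice_box (J : nat) : size (lattice_box J) = box_card J.
Proof. by rewrite size_allpairs !size_iota /box_card !addn1. Qed.

Lemma lattice_box_uniq (J : nat) : uniq (lattice_box J).
Proof.
apply: allpairs_uniq; rewrite ?iota_uniq //.
by move=> [a b] [c d] _ _ [] /addIr [->] ->.
Qed.

Lemma mem_lattice_box (J : nat) (p : int * int) :
  (p \in lattice_box J) = (- J%:Z <= p.1 <= J%:Z) && (0 <= p.2 <= J%:Z).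
Proof.
case: p => a b /=; apply/idP/idP => [/allpairsP[[x y] /=]|].
  rewrite -/(iota 0 (2 * J).+1) -/(iota 0 J.+1) !mem_iota.
  rewrite !add0n !ltnS => -[hx hy [-> ->]].
  rewrite lerBrDr addNr lez_nat lerBlDr -PoszD lez_nat addnn -mul2n hx.
  by rewrite !lez_nat hy.
case/andP=> /andP[ha1 ha2] /andP[hb1 hb2].
have h0 : 0 <= a + J%:Z by rewrite -lerBlDr sub0r.
apply/allpairsP; exists (absz (a + J%:Z), absz b) => /=.
rewrite -/(iota 0 (2 * J).+1) -/(iota 0 J.+1) !mem_iota.
rewrite !add0n !ltnS; split.
- by rewrite leq0n mul2n -addnn -lez_nat gez0_abs // PoszD lerD2r.
- by rewrite leq0n -lez_nat gez0_abs.
- by rewrite !gez0_abs // addrK.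
Qed.

Definition point_of (R : realType) (p : int * int) : R * R :=
  (p.1%:~R, p.2%:~R).

Definition sorted_angles (R : realType) (t : R) (J : nat) : seq R :=
  sort <=%R
    [seq vertex_angle (point_of R p) (observer t J) (0, 0) | p <- lattice_box J].

(* alpha_j for 1 <= j <= N; the sequence is indexed from 0. *)
Definition alpha (R : realType) (t : R) (J j : nat) : R :=
  nth 0 (sorted_angles t J) j.-1.

Definition mean_gap (R : realType) (t : R) (J : nat) : R :=
  alpha t J (box_card J) / (box_card J)%:R.

(* #{j : 1 <= j <= N - 1, (alpha_(j+1) - alpha_j) / Delta_av in
        [lam - del, lam + del)} *)
Definition gap_count (R : realType) (t lam del : R) (J : nat) : nat :=
  count (fun j => lam - del <= (alpha t J j.+1 - alpha t J j) / mean_gap t J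
                  < lam + del)
        (index_iota 1 (box_card J)).

Definition gap_freq (R : realType) (t lam del : R) (J : nat) : R :=
  (gap_count t lam del J)%:R / (2 * J%:R ^+ 2).

(* g_t(lam) = g : the inner limit exists for all small del > 0 (lim is a total
   operator, so this is required separately) and the outer limit exists and
   equals g. *)
Definition is_gap_density (R : realType) (t lam g : R) : Prop :=
  (\forall del \near (0 : R)^'+, cvg (gap_freq t lam del @ \oo)) /\
  (2 * del)^-1 * lim (gap_freq t lam del @ \oo) @[del --> (0 : R)^'+] --> g.

(* Main.v *)
Require Import Defs.
From HB Require Import structures.
From mathcomp Require Import all_boot all_order all_algebra.
From mathcomp Require Import all_classical all_reals all_analysis.
From mathcomp Require Import ring lra zify.

Set Implicit Arguments.
Unset Strict Implicit.
Unset Printing Implicit Defensive.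
Import Order.TTheory GRing.Theory Num.Theory.
Import numFieldNormedType.Exports.
Local Open Scope classical_set_scope.
Local Open Scope ring_scope.

(** * Idea of the proof

The point in column i (counted from 0 to 2J) and row y is seen at the angle
atan (y / T), where T = t J^2 + i - J is its horizontal distance from the
observer. Up to a factor tending to 1, one mean gap corresponds to the value
t J / 2 of the determinant y' T - y T' of two points (small_cross_close,
large_cross_far). Up to ties and lower-order errors, a normalized gap of length
at least c is thus a point whose determinant with every other point lies outside
[0, D), where D = c t J / 2.

In row y + k, the first point not seen before (i, y) has determinant
frac (k T / y) * y with it, provided that its column i + floor (k T / y) lies
in the box. The left neighbour in the same row has determinant y, so only the
rows y > D matter, and for t > 2/3 only k = 1, 2, -1, -2 can occur: at most
three rows overlap in any direction. The question becomes how the phases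
T / y are distributed modulo 1, jointly with i / J and y / J.

They are uniformly distributed, because y |-> K / y with K of order J^2 has
a slope - K / y^2 of order 1 and a second derivative of order 1 / J: on a window of
bounded length it is a rotation of the circle up to O(1 / J). The slope varies
with y, and it is close to a rational of small denominator only for a small
proportion of the y (few_near_rational); otherwise Dirichlet's theorem and a
telescoping potential show that the orbit visits every arc about as often as
it should (count_rotation). This yields equidistribution, with bounds uniform
in the column.

Inclusion and exclusion over the neighbouring rows (unhit_indicator) and a
Riemann sum over the rows give the limiting proportion gap_tail t c of the
normalized gaps that are at least c (gaps_ge_asymptotics). With w = 2 y / (t J)
the number of row spacings covered by row y, it is t / 2 times the integral
over c <= w <= 2 / t of

  1 - 2 (c/w) (1 - 1/w)^+ + max (-c/w, 3c/w - 2) (1 - 2/w)^+.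

The integral is elementary, and the density at lam is minus the mean of the
left and right derivatives of gap_tail t at lam (gap_density_of_slopes); this
mean accounts for the halved values at lam = 2 / t. *)

(** * Visits of rotations of the circle to arcs *)

(** A potential for counting visits: for u >= a, the length of the part of
[a, u] that lies in the arcs [a + m, a + m + l], m an integer. *)
Definition arc_len (R : realType) (a l u : R) : R :=
  l * (Num.floor (u - a))%:~R + Num.min (u - a - (Num.floor (u - a))%:~R) l.

Lemma floor_bounds (R : realType) (x : R) :
  (Num.floor x)%:~R <= x < (Num.floor x)%:~R + 1.
Proof. by have := floor_itv x; rewrite intrD. Qed.

Lemma arc_len_mono (R : realType) (a l u v : R) :
  0 <= l <= 1 -> u <= v -> arc_len a l u <= arc_len a l v.
Proof.
move=> hl uv; rewrite /arc_len.
have hu := floor_bounds (u - a); have hv := floor_bounds (v - a).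
have : Num.floor (u - a) <= Num.floor (v - a) by apply: le_floor; lra.
rewrite le_eqVlt => /orP[/eqP -> | hlt].
  by rewrite lerD2l; rewrite !minEle; do 2 case: ifP => ?; lra.
have hlt' : (Num.floor (u - a))%:~R + 1 <= (Num.floor (v - a))%:~R :> R.
  by rewrite -[1]/(1%:~R) -intrD ler_int lezD1.
set m := (Num.floor (u - a))%:~R in hu hlt' *.
set n := (Num.floor (v - a))%:~R in hv hlt' *.
have h1 : Num.min (u - a - m) l <= l by rewrite ge_min lexx orbT.
have h2 : 0 <= Num.min (v - a - n) l by rewrite le_min; lra.
nra.
Qed.

Lemma arc_len_bounds (R : realType) (a l u : R) :
  0 <= l <= 1 -> l * (u - a) <= arc_len a l u <= l * (u - a) + 1.
Proof.
move=> hl; rewrite /arc_len; have := floor_bounds (u - a).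
set m := (Num.floor _)%:~R => hm.
rewrite minEle; case: ifP => ?; nra.
Qed.

(** A point of the arc of length l stays, during a step eta, inside the
enlarged arc of length l + eta, so the potential of the enlarged arc grows by
the whole step. *)
Lemma arc_len_step (R : realType) (a l eta u : R) (m : int) :
  0 <= l -> 0 < eta -> l + eta <= 1 -> a <= u - m%:~R <= a + l ->
  arc_len a (l + eta) (u + eta) - arc_len a (l + eta) u = eta.
Proof.
move=> hl he h1 hu; rewrite /arc_len.
have -> : Num.floor (u - a) = m by apply: floor_def; rewrite intrD; lra.
case: (ltrP (u + eta - a) (m%:~R + 1)) => hlt.
  have -> : Num.floor (u + eta - a) = m by apply: floor_def; rewrite intrD; lra.
  by rewrite !minEle; do 2 case: ifP => ?; lra.
have -> : Num.floor (u + eta - a) = m + 1.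
  by apply: floor_def; rewrite !intrD; lra.
by rewrite intrD !minEle; do 2 case: ifP => ?; lra.
Qed.

Lemma sum_bool_le (R : realType) (m n : nat) (phi : nat -> bool) :
  \sum_(m <= j < n) (phi j)%:R <= (n - m)%:R :> R.
Proof.
apply: (@le_trans _ _ (\sum_(m <= j < n) (1 : R))).
  by apply: ler_sum => i _; case: (phi i).
by rewrite sumr_const_nat.
Qed.

(** Every visit raises the potential of the enlarged arc by eta, while over
n steps that potential grows by at most (l + eta) (n eta) + 1: telescoping
bounds the visits without counting the turns around the circle. *)
Lemma count_progression (R : realType) (a l eta z : R) (n : nat)
    (phi : nat -> bool) :
  0 <= l -> 0 < eta ->
  (forall j, (j < n)%N -> phi j ->
     exists m : int, a <= z + j%:R * eta - m%:~R <= a + l) ->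
  \sum_(0 <= j < n) (phi j)%:R <= n%:R * (l + eta) + 2 / eta :> R.
Proof.
move=> hl he hphi; have e2 : 0 <= 2 / eta by rewrite divr_ge0 // ltW.
(* If l + eta exceeds 1 the bound is at least n. *)
case: (lerP (l + eta) 1) => h1; last first.
  have := @sum_bool_le R 0 n phi; rewrite subn0 => h.
  have : n%:R <= n%:R * (l + eta) :> R by rewrite ler_peMr // ltW.
  lra.
pose L k := arc_len a (l + eta) (z + k%:R * eta).
have hL1 : 0 <= l + eta <= 1 by lra.
have hstep : forall j, (j < n)%N -> eta * (phi j)%:R <= L j.+1 - L j.
  move=> j jn; rewrite /L.
  have -> : z + j.+1%:R * eta = z + j%:R * eta + eta by rewrite -natr1; lra.
  case hj: (phi j).
    have [m hm] := hphi j jn hj.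
    by rewrite (arc_len_step hl he h1 hm) mulr1.
  rewrite mulr0 subr_ge0; apply: arc_len_mono => //; lra.
have : \sum_(0 <= j < n) eta * (phi j)%:R <= L n - L 0.
  rewrite -telescope_sumr // !big_nat; apply: ler_sum => j /andP[_ jn].
  exact: hstep.
rewrite -mulr_sumr => h.
have b0 := arc_len_bounds a (z + 0%:R * eta) hL1.
have bn := arc_len_bounds a (z + n%:R * eta) hL1.
have hS : eta * \sum_(0 <= j < n) (phi j)%:R <= (l + eta) * (n%:R * eta) + 1.
  rewrite /L in h; lra.
have -> : n%:R * (l + eta) + 2 / eta = ((l + eta) * (n%:R * eta) + 2) / eta.
  field; lra.
rewrite ler_pdivlMr // mulrC; lra.
Qed.

(** Pigeonhole on the Q + 1 fractional parts of h b, h <= Q, sorted into Q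
boxes. *)
Lemma dirichlet (R : realType) (b : R) (Q : nat) : (0 < Q)%N ->
  exists (q : nat) (p : int),
    (0 < q <= Q)%N /\ `|q%:R * b - p%:~R| <= Q%:R^-1.
Proof.
move=> Q0; have Q0r : 0 < Q%:R :> R by rewrite ltr0n.
pose fr (h : nat) : R := h%:R * b - (Num.floor (h%:R * b))%:~R.
have hfr h : 0 <= fr h < 1 by have := floor_bounds (h%:R * b); rewrite /fr; lra.
have hlt (h : 'I_Q.+1) : (`|Num.floor (Q%:R * fr h)| < Q)%N.
  have := hfr h => /andP[h0 h1].
  have f0 : 0 <= Num.floor (Q%:R * fr h) by rewrite floor_ge0 mulr_ge0 // ltW.
  rewrite -ltz_nat gez0_abs // floor_lt_int.
  by rewrite -[X in _ < X]mulr1 ltr_pM2l.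
pose g (h : 'I_Q.+1) : 'I_Q := Ordinal (hlt h).
have /injectivePn[h [k hk ghk]] : ~~ injectiveb g.
  apply/negP => /injectiveP hinj.
  by have := leq_card g hinj; rewrite !card_ord ltnn.
wlog hkl : h k hk ghk / (h < k)%N.
  move=> W; case: (ltngtP h k) => H; [exact: (W h k) | | ].
    by apply: (W k h) => //; rewrite eq_sym.
  by move/eqP: hk; case; apply: val_inj.
exists (k - h)%N, (Num.floor (k%:R * b) - Num.floor (h%:R * b)); split.
  by have := ltn_ord k; rewrite ltnS => ?; lia.
have := congr1 val ghk => /= /(congr1 (fun n : nat => n%:Z)).
have f0 (i : 'I_Q.+1) : 0 <= Num.floor (Q%:R * fr i).
  by rewrite floor_ge0 mulr_ge0 //; have := hfr i; lra.
rewrite !gez0_abs // => hfl.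
have b1 := floor_bounds (Q%:R * fr h); have b2 := floor_bounds (Q%:R * fr k).
rewrite hfl in b1.
rewrite natrB ?(ltnW hkl) // intrB.
have -> : (k%:R - h%:R) * b - ((Num.floor (k%:R * b))%:~R -
  (Num.floor (h%:R * b))%:~R) = fr k - fr h by rewrite /fr; lra.
rewrite -[X in _ <= X]div1r ler_pdivlMr // -[X in _ * X](gtr0_norm Q0r).
by rewrite -normrM ler_norml; lra.
Qed.

Lemma sum_nat_blocks (R : realType) (F : nat -> R) (n q : nat) :
  \sum_(0 <= h < n * q) F h =
  \sum_(0 <= r < q) \sum_(0 <= j < n) F (r + j * q)%N.
Proof.
elim: n => [|n IHn].
  rewrite mul0n big_geq // big1 // => r _; by rewrite big_geq.
rewrite [RHS](eq_bigr (fun r => \sum_(0 <= j < n) F (r + j * q)%N + F (r + n * q)%N));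
  last by move=> r _; rewrite big_nat_recr.
rewrite big_split /= -IHn (@big_cat_nat _ _ _ (n * q)%N) //=; last first.
  by rewrite leq_mul2r leqnSn orbT.
congr (_ + _); rewrite -{1}[(n * q)%N]add0n big_addn mulSn addnK.
by apply: eq_bigr.
Qed.

(** Quantitative irrationality: no multiple of b by at most Q comes within eta
of an integer. *)
Definition far_from_rationals (R : realType) (Q : nat) (eta b : R) : Prop :=
  forall (q : nat) (p : int), (0 < q <= Q)%N -> eta <= `|q%:R * b - p%:~R|.

(** By Dirichlet's theorem some q <= Q rotations amount to a single step d with
eta <= |d| <= 1/Q. Along each residue class modulo q the orbit is a progression
of step d, to which count_progression applies; incomplete classes cost at most
q visits. *)
Lemma count_rotation (R : realType) (Q : nat) (eta b a l z : R) (H : nat)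
    (phi : nat -> bool) :
  (0 < Q)%N -> 0 < eta -> far_from_rationals Q eta b -> 0 <= l ->
  (forall h, (h < H)%N -> phi h ->
     exists m : int, a <= z - h%:R * b - m%:~R <= a + l) ->
  \sum_(0 <= h < H) (phi h)%:R
    <= H%:R * (l + Q%:R^-1) + Q%:R * (1 + 2 / eta) :> R.
Proof.
move=> Q0 he hb hl hphi.
have [q [p [/andP[q0 qQ] hqp]]] := dirichlet b Q0.
have hq1 := hb q p; rewrite q0 qQ in hq1; have {}hq1 := hq1 isT.
pose d := q%:R * b - p%:~R; rewrite -/d in hqp hq1.
have d0 : 0 < `|d| by lra.
pose n := (H %/ q)%N.
have Hn : (n * q <= H < n * q + q)%N.
  by rewrite /n leq_trunc_div /= -mulSnr ltn_ceil.
have hr r : (r < q)%N ->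
    \sum_(0 <= j < n) (phi (r + j * q)%N)%:R <= n%:R * (l + `|d|) + 2 / `|d| :> R.
  move=> rq.
  have hz j : z - (r + j * q)%:R * b = z - r%:R * b - j%:R * d - (j%:Z * p)%:~R.
    by rewrite /d natrD natrM intrM -pmulrn; ring.
  have hlt j : (j < n)%N -> (r + j * q < H)%N by nia.
  case: (lerP 0 d) => hd.
    rewrite ger0_norm //; rewrite ger0_norm // in d0.
    apply: (@count_progression _ (- (a + l)) _ _ (- (z - r%:R * b))) => //.
    move=> j jn /(hphi _ (hlt _ jn)) [m]; rewrite hz => hm.
    exists (- (m + j%:Z * p)); rewrite intrN intrD; lra.
  rewrite ltr0_norm //; rewrite ltr0_norm // in d0.
  apply: (@count_progression _ a _ _ (z - r%:R * b)) => //.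
  move=> j jn /(hphi _ (hlt _ jn)) [m]; rewrite hz => hm.
  exists (m + j%:Z * p); rewrite intrD. lra.
have hinv : 2 / `|d| <= 2 / eta by rewrite ler_pM2l // lef_pV2 // posrE.
rewrite (@big_cat_nat _ _ _ (n * q)%N) //=; last by case/andP: Hn.
have h2 : \sum_(n * q <= h < H) (phi h)%:R <= q%:R :> R.
  apply: le_trans (@sum_bool_le R _ _ _) _; rewrite ler_nat; lia.
have h1 : \sum_(0 <= h < n * q) (phi h)%:R
    <= q%:R * (n%:R * (l + Q%:R^-1) + 2 / eta) :> R.
  rewrite sum_nat_blocks.
  apply: (@le_trans _ _ (\sum_(0 <= r < q) (n%:R * (l + Q%:R^-1) + 2 / eta))).
    rewrite !big_nat; apply: ler_sum => r /andP[_ rq].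
    apply: le_trans (hr r rq) _; apply: lerD => //.
    by rewrite ler_wpM2l // lerD2l.
  by rewrite sumr_const_nat subn0 [leRHS]mulr_natl.
have hqn : q%:R * n%:R <= H%:R :> R.
  by rewrite -natrM ler_nat mulnC; case/andP: Hn.
have hqQ : q%:R <= Q%:R :> R by rewrite ler_nat.
have Qi : 0 <= Q%:R^-1 :> R by rewrite invr_ge0.
have e2 : 0 <= 2 / eta by rewrite divr_ge0 // ltW.
have q0r : 0 <= q%:R :> R by [].
nra.
Qed.

(** * Slopes close to rationals of small denominator *)

Lemma natr_count (R : realType) (m n : nat) (phi : nat -> bool) :
  \sum_(m <= y < n) (phi y)%:R = (count phi (index_iota m n))%:R :> R.
Proof.
rewrite -natr_sum; congr (_%:R); rewrite -sum1_count [RHS]big_mkcond /=.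
by apply: eq_bigr => i _; case: (phi i).
Qed.

Lemma count_diameter (R : realType) (m n : nat) (D : R) (phi : nat -> bool) :
  0 <= D ->
  (forall y y', (m <= y)%N -> (y <= y')%N -> (y' < n)%N -> phi y -> phi y' ->
     y'%:R - y%:R <= D) ->
  \sum_(m <= y < n) (phi y)%:R <= D + 1.
Proof.
move=> D0 hD; rewrite natr_count -size_filter.
set s := seq.filter _ _.
case hs: s => [|y0 s'] /=; first by lra.
have hy0 : y0 \in s by rewrite hs inE eqxx.
have hmem y : y \in s -> [/\ (m <= y)%N, (y < n)%N & phi y].
  by rewrite mem_filter mem_index_iota => /andP[? /andP[? ?]].
have hord : sorted ltn s by apply: sorted_filter (iota_ltn_sorted _ _); exact: ltn_trans.
have hle y : y \in s -> (y0 <= y)%N.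
  move: hord; rewrite hs /= (path_sortedE ltn_trans) => /andP[/allP hall _].
  by rewrite inE => /orP[/eqP -> //|/hall /ltnW].
have hsub : {subset s <= iota y0 (Num.trunc D).+1}.
  move=> y ys; rewrite mem_iota hle //=.
  have [my yn py] := hmem _ ys; have [my0 _ py0] := hmem _ hy0.
  have := hD _ _ my0 (hle _ ys) yn py0 py.
  have := truncnS_gt D; rewrite -natr1 => h1 h2.
  rewrite -(ltr_nat R) natrD -natr1; lra.
have := uniq_leq_size (filter_uniq _ (iota_uniq _ _)) hsub.
rewrite -/s hs size_iota /= -(ler_nat R) => h.
by apply: le_trans h _; rewrite -natr1 lerD2r truncn_le.
Qed.

(** For fixed q and p the y with |q K / y^2 - p| < eta form a block of length
O(eta J), since K / y^2 decreases at a rate of order at least 1 / J; and only a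
number of pairs (q, p) independent of J occurs. Choosing eta small enough makes
the total proportion at most eps. *)
Lemma few_near_rational (R : realType) (c1 c2 kappa eps : R) (Q : nat) :
  0 < c1 -> 0 < c2 -> 0 < kappa -> 0 < eps ->
  exists2 eta : R, 0 < eta &
  \forall J \near \oo, forall (K : R) (Y0 Y1 : nat),
    c1 * J%:R ^+ 2 <= K <= c2 * J%:R ^+ 2 -> kappa * J%:R <= Y0%:R ->
    (Y1 <= J.+1)%N ->
    \sum_(Y0 <= y < Y1)
      (~~ `[< far_from_rationals Q eta (K / y%:R ^+ 2) >])%:R <= eps * J%:R.
Proof.
move=> c10 c20 k0 e0.
(* Every p that occurs lies between 0 and Q c2 / kappa^2 + 1. *)
pose P := (Num.trunc (Q%:R * c2 / kappa ^+ 2)).+2.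
pose M : R := (Q * P)%:R + 1.
have M0 : 0 < M by rewrite ltr_wpDl.
pose eta := Num.min 1 (eps * c1 / (2 * M)).
have eta0 : 0 < eta by rewrite lt_min ltr01 divr_gt0 // mulr_gt0.
exists eta => //; near=> J => K Y0 Y1 hK hY0 hY1.
have J0 : 0 < J%:R :> R by near: J; apply: nbhs_infty_gtr.
have Jbig : 2 * M / eps <= J%:R by near: J; apply: nbhs_infty_ger.
have K0 : 0 <= K by case/andP: hK => + _; apply: le_trans; rewrite mulr_ge0 ?ltW // exprn_gt0.
have hyp y : (Y0 <= y)%N -> kappa * J%:R <= y%:R.
  by move=> h; apply: le_trans hY0 _; rewrite ler_nat.
pose near_p q p y := `|q%:R * (K / y%:R ^+ 2) - p%:R| < eta.
have hbad y : (Y0 <= y < Y1)%N ->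
  (~~ `[< far_from_rationals Q eta (K / y%:R ^+ 2) >])%:R <=
  \sum_(1 <= q < Q.+1) \sum_(0 <= p < P) (near_p q p y)%:R :> R.
  move=> /andP[hy hy1]; have ky := hyp _ hy.
  have y0 : 0 < y%:R :> R by apply: lt_le_trans ky; rewrite mulr_gt0.
  case: (boolP (`[< _ >])) => [_|/asboolPn].
    by apply: sumr_ge0 => q _; apply: sumr_ge0.
  move=> /existsNP[q /existsNP[p /not_implyP[/andP[q1 qQ] /negP]]].
  rewrite -ltNge => hp /=.
  have b0 : 0 <= K / y%:R ^+ 2 by rewrite divr_ge0 // exprn_ge0 // ltW.
  have b1 : K / y%:R ^+ 2 <= c2 / kappa ^+ 2.
    rewrite ler_pdivrMr ?exprn_gt0 // mulrAC ler_pdivlMr ?exprn_gt0 //.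
    case/andP: hK => _ hK2.
    apply: (@le_trans _ _ (c2 * J%:R ^+ 2 * kappa ^+ 2)).
      by rewrite ler_wpM2r // exprn_ge0 // ltW.
    rewrite -mulrA ler_wpM2l ?(ltW c20) // mulrC -exprMn.
    by rewrite ler_pXn2r // ?nnegrE ?mulr_ge0 // ltW // mulr_gt0.
  have e1 : eta <= 1 by rewrite ge_min lexx.
  have qr : q%:R <= Q%:R :> R by rewrite ler_nat.
  have q0 : 0 <= q%:R :> R by [].
  have qb : 0 <= q%:R * (K / y%:R ^+ 2) by rewrite mulr_ge0.
  have qb2 : q%:R * (K / y%:R ^+ 2) <= Q%:R * c2 / kappa ^+ 2.
    by rewrite -mulrA ler_pM.
  move: hp; rewrite ltr_norml => hp.
  have p0 : 0 <= p.
    by rewrite -ltzD1 -(ltr_int R) intrD; lra.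
  have hpP : (`|p| < P)%N.
    rewrite /P -(ltr_nat R) -!natr1 -[X in X%:R < _]/(`|p|%N).
    have := truncnS_gt (Q%:R * c2 / kappa ^+ 2); rewrite -natr1.
    have -> : `|p|%N%:R = p%:~R :> R by rewrite -[in RHS](gez0_abs p0) -pmulrn.
    lra.
  have hn : near_p q `|p|%N y.
    rewrite /near_p; have -> : `|p|%N%:R = p%:~R :> R.
      by rewrite -[in RHS](gez0_abs p0) -pmulrn.
    by rewrite ltr_norml.
  rewrite (big_rem q) /=; last by rewrite mem_index_iota ltnS q1.
  rewrite (big_rem `|p|%N) /=; last by rewrite mem_index_iota.
  rewrite hn -addrA lerDl addr_ge0 //; apply: sumr_ge0 => // ? _.
  exact: sumr_ge0.
have hcount q p : (0 < q)%N ->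
    \sum_(Y0 <= y < Y1) (near_p q p y)%:R <= eta * J%:R / c1 + 1.
  move=> q0; apply: count_diameter.
    by rewrite divr_ge0 ?ltW // mulr_gt0.
  move=> y y' hy hyy hy'; rewrite /near_p !ltr_norml => h h'.
  have ky := hyp _ hy; have ky' := hyp _ (leq_trans hy hyy).
  have yp : 0 < y%:R :> R by apply: lt_le_trans ky; rewrite mulr_gt0.
  have yp' : 0 < y'%:R :> R by apply: lt_le_trans ky'; rewrite mulr_gt0.
  have yJ' : y'%:R <= J%:R :> R by rewrite ler_nat -ltnS (leq_trans hy').
    have yy : y%:R <= y'%:R :> R by rewrite ler_nat.
  have yJ := le_trans yy yJ'.
  pose u : R := J%:R^-1; pose A : R := y%:R^-1; pose B : R := y'%:R^-1.
  have u0 : 0 < u by rewrite invr_gt0.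
  have uA : u <= A by rewrite lef_pV2 ?posrE.
  have uB : u <= B by rewrite lef_pV2 ?posrE.
  have AB : A - B = (y'%:R - y%:R) * (A * B).
    by rewrite /A /B; field; rewrite !gt_eqF.
  have hd : 2 * u ^+ 3 * (y'%:R - y%:R) <= A ^+ 2 - B ^+ 2.
    have -> : A ^+ 2 - B ^+ 2 = (A * B * (A + B)) * (y'%:R - y%:R).
      have -> : A ^+ 2 - B ^+ 2 = (A - B) * (A + B) by ring.
      by rewrite AB; ring.
    rewrite ler_wpM2r ?subr_ge0 //.
    have -> : 2 * u ^+ 3 = (u * u) * (u + u) by ring.
    have u1 := ltW u0.
    by rewrite ler_pM ?mulr_ge0 ?addr_ge0 // ?ler_pM ?lerD.
  have h2 : q%:R * (K * (A ^+ 2 - B ^+ 2)) < 2 * eta.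
    move: h h'; rewrite -!exprVn -/A -/B.
    have -> : q%:R * (K * (A ^+ 2 - B ^+ 2)) =
       q%:R * (K * A ^+ 2) - q%:R * (K * B ^+ 2) by ring.
    lra.
  have h3 : c1 * (2 * u * (y'%:R - y%:R)) <= K * (A ^+ 2 - B ^+ 2).
    have hpos : 0 <= 2 * u ^+ 3 * (y'%:R - y%:R).
      by rewrite mulr_ge0 ?subr_ge0 // mulr_ge0 // exprn_ge0 // ltW.
    apply: (@le_trans _ _ (K * (2 * u ^+ 3 * (y'%:R - y%:R)))); last first.
      by rewrite ler_wpM2l.
    have -> : c1 * (2 * u * (y'%:R - y%:R)) =
       (c1 * J%:R ^+ 2) * (2 * u ^+ 3 * (y'%:R - y%:R)).
      by rewrite /u; field; rewrite gt_eqF.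
    by rewrite ler_wpM2r //; case/andP: hK.
  have q1 : 1 <= q%:R :> R by rewrite ler1n.
  have h4 : c1 * (2 * u * (y'%:R - y%:R)) < 2 * eta.
    apply: le_lt_trans h2; apply: le_trans h3 _; rewrite ler_peMl //.
    apply: mulr_ge0 => //; apply: le_trans hd.
    by rewrite mulr_ge0 ?subr_ge0 // mulr_ge0 // exprn_ge0 // ltW.
  rewrite ler_pdivlMr // mulrC.
  have -> : c1 * (y'%:R - y%:R) = (c1 * (2 * u * (y'%:R - y%:R))) / 2 * J%:R.
    by rewrite /u; field; rewrite gt_eqF.
  rewrite ler_pM2r //; lra.
apply: (@le_trans _ _ ((Q * P)%:R * (eta * J%:R / c1 + 1))).
  apply: (@le_trans _ _ (\sum_(Y0 <= y < Y1)
    \sum_(1 <= q < Q.+1) \sum_(0 <= p < P) (near_p q p y)%:R)).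
    by rewrite [leLHS]big_nat [leRHS]big_nat; apply: ler_sum => y hy; exact: hbad.
  rewrite exchange_big /=.
  apply: (@le_trans _ _ (\sum_(1 <= q < Q.+1) \sum_(0 <= p < P)
      (eta * J%:R / c1 + 1))).
    rewrite [leLHS]big_nat [leRHS]big_nat; apply: ler_sum => q /andP[q1 _].
    rewrite [leLHS]exchange_big /=; apply: ler_sum => p _; exact: hcount.
  by rewrite !sumr_const_nat subn0 subn1 /= -mulrnA mulr_natl mulnC.
have hM : (Q * P)%:R <= M by rewrite lerDl.
have h1 : eta * J%:R / c1 + 1 <= eps * J%:R / M.
  have : eta <= eps * c1 / (2 * M) by rewrite ge_min lexx orbT.
  move=> he.
  have : eta * (J%:R / c1) <= eps * c1 / (2 * M) * (J%:R / c1).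
    by rewrite ler_wpM2r // divr_ge0 // ltW.
  have -> : eps * c1 / (2 * M) * (J%:R / c1) = eps * J%:R / M / 2.
    by field; rewrite !gt_eqF.
  have : 2 <= eps * J%:R / M.
    by rewrite ler_pdivlMr // -ler_pdivrMl // mulrC.
  rewrite mulrA; lra.
apply: (@le_trans _ _ (M * (eps * J%:R / M))).
  by rewrite ler_pM // addr_ge0 // divr_ge0 ?ltW // mulr_gt0.
by rewrite mulrC divfK // gt_eqF.
Unshelve. all: by end_near.
Qed.

(** * Equidistribution of K / y modulo one *)

(** Averaging over windows of length H counts each y exactly H times, except
the first H values. *)
Lemma sum_sliding_window (R : realType) (Y0 Y1 H : nat) (phi : nat -> bool) :
  H%:R * \sum_(Y0 <= y < Y1) (phi y)%:R <=
  \sum_(Y0 <= y < Y1)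
     \sum_(0 <= h < H) ((y + h < Y1)%N && phi (y + h)%N)%:R + H%:R ^+ 2 :> R.
Proof.
pose F y : R := ((y < Y1)%N && phi y)%:R.
have hS : \sum_(Y0 <= y < Y1) (phi y)%:R = \sum_(Y0 <= y < Y1) F y.
  by apply: eq_big_nat => y /andP[_ hy]; rewrite /F hy.
rewrite hS exchange_big /= expr2.
have hh h : (h < H)%N ->
    \sum_(Y0 <= y < Y1) F y <= \sum_(Y0 <= y < Y1) F (y + h)%N + H%:R.
  move=> hH; case: (leqP Y0 Y1) => Y01; last first.
    by rewrite !big_geq ?(ltnW Y01) // add0r.
  apply: (@le_trans _ _ (\sum_(Y0 <= y < Y1 + h) F y)).
    rewrite [leRHS](@big_cat_nat _ _ _ Y1) ?leq_addr //= lerDl.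
    exact: sumr_ge0.
  rewrite [leLHS](@big_cat_nat _ _ _ (Y0 + h)%N) ?leq_addr ?leq_add2r //= addrC.
  apply: lerD; first by rewrite big_addn addnK.
  apply: le_trans (@sum_bool_le R _ _ _) _; rewrite addKn ler_nat; exact: ltnW.
apply: (@le_trans _ _ (\sum_(0 <= h < H)
    (\sum_(Y0 <= y < Y1) F (y + h)%N + H%:R))); last first.
  by rewrite big_split /= sumr_const_nat subn0 [in leRHS]mulr_natl.
rewrite mulr_natl -[in X in _ *+ X](subn0 H) -sumr_const_nat.
rewrite [leLHS]big_nat [leRHS]big_nat; apply: ler_sum => h /andP[_]; exact: hh.
Qed.

Lemma phase_linearization (R : realType) (K y h : R) : 0 < y -> 0 <= h ->
  K / (y + h) = K / y - h * (K / y ^+ 2) + K * h ^+ 2 / (y ^+ 2 * (y + h)).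
Proof. by move=> y0 h0; field; rewrite !gt_eqF // ltr_wpDr. Qed.

(** On a window of bounded length H the phase K / y is, up to O(1 / J), an orbit
of the rotation by K / y^2, and the Lipschitz arcs barely move. count_rotation
bounds the visits in the windows whose slope is far from rationals, and
few_near_rational bounds the number of the other windows. *)
Lemma equidistribution_upper (R : realType) (c1 c2 kappa L eps : R) :
  0 < c1 -> 0 < c2 -> 0 < kappa -> 0 <= L -> 0 < eps ->
  \forall J \near \oo,
    forall (K : R) (Y0 Y1 : nat) (a l : nat -> R) (phi : nat -> bool),
    c1 * J%:R ^+ 2 <= K <= c2 * J%:R ^+ 2 -> kappa * J%:R <= Y0%:R ->
    (Y1 <= J.+1)%N ->
    (forall y, (Y0 <= y < Y1)%N -> 0 <= l y) ->
    (forall y y', (Y0 <= y)%N -> (y <= y')%N -> (y' < Y1)%N ->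
       `|a y' - a y| <= L * (y'%:R - y%:R) / J%:R /\
       `|l y' - l y| <= L * (y'%:R - y%:R) / J%:R) ->
    (forall y, (Y0 <= y < Y1)%N -> phi y ->
       exists m : int, a y <= K / y%:R - m%:~R <= a y + l y) ->
    \sum_(Y0 <= y < Y1) (phi y)%:R <=
    \sum_(Y0 <= y < Y1) l y + eps * J%:R.
Proof.
move=> c10 c20 k0 L0 e0.
pose Q := (Num.trunc (8 / eps)).+1.
have Qe : Q%:R^-1 <= eps / 8.
  have := truncnS_gt (8 / eps); rewrite -/Q => hQ.
  by rewrite -[leRHS]invf_div lef_pV2 ?posrE ?divr_gt0 // ltW.
have e80 : 0 < eps / 8 by rewrite divr_gt0.
have [eta eta0 hfew] := few_near_rational Q c10 c20 k0 e80.
pose G : R := Q%:R * (1 + 2 / eta).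
have G0 : 0 <= G by rewrite mulr_ge0 // addr_ge0 // divr_ge0 // ltW.
pose H := (Num.trunc (8 * G / eps)).+1.
have hH : G <= H%:R * (eps / 8).
  have := truncnS_gt (8 * G / eps); rewrite -/H => /ltW.
  by rewrite ler_pdivrMr // mulrC; lra.
have H0 : 0 < H%:R :> R by rewrite ltr0n.
(* Curvature and motion of the arc enlarge the arc by at most 5 e2 = eps / 8. *)
pose e2 := eps / 40.
near=> J => K Y0 Y1 a l phi hK hY0 hY1 hl hlip hphi.
have J0 : 0 < J%:R :> R by near: J; apply: nbhs_infty_gtr.
have Jcurv : c2 * H%:R ^+ 2 / kappa ^+ 3 / e2 <= J%:R.
  by near: J; apply: nbhs_infty_ger.
have Jlip : L * H%:R / e2 <= J%:R by near: J; apply: nbhs_infty_ger.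
have JH : H%:R / (eps / 8) <= J%:R by near: J; apply: nbhs_infty_ger.
have J3 : 3 <= J%:R :> R by near: J; apply: nbhs_infty_ger.
have e20 : 0 < e2 by rewrite divr_gt0.
have hbadJ : \sum_(Y0 <= y < Y1)
      (~~ `[< far_from_rationals Q eta (K / y%:R ^+ 2) >])%:R <= eps / 8 * J%:R.
  by move: K Y0 Y1 hK hY0 hY1 {hl hlip hphi}; near: J.
have K0 : 0 <= K.
  by case/andP: hK => + _; apply: le_trans; rewrite mulr_ge0 ?ltW // exprn_gt0.
have hyp y : (Y0 <= y)%N -> kappa * J%:R <= y%:R.
  by move=> h; apply: le_trans hY0 _; rewrite ler_nat.
have kJ0 : 0 < kappa * J%:R by rewrite mulr_gt0.
have hlipH y h : (Y0 <= y)%N -> (h < H)%N -> (y + h < Y1)%N ->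
    `|a (y + h)%N - a y| <= e2 /\ `|l (y + h)%N - l y| <= e2.
  move=> hy hh hy1.
  have le : L * ((y + h)%:R - y%:R) / J%:R <= e2.
    rewrite natrD addrC addKr ler_pdivrMr //.
    apply: (@le_trans _ _ (L * H%:R)).
      by rewrite ler_wpM2l // ler_nat ltnW.
    by rewrite -ler_pdivrMl // mulrC.
  by have [] := hlip y (y + h)%N hy (leq_addr _ _) hy1; split; apply: le_trans le.
clear hlip.
have hblock y : (Y0 <= y < Y1)%N -> far_from_rationals Q eta (K / y%:R ^+ 2) ->
    \sum_(0 <= h < H) ((y + h < Y1)%N && phi (y + h)%N)%:R
     <= H%:R * (l y + 3 * (eps / 8)).
  move=> hy hfar; have /andP[hy0 hy1] := hy; have ky := hyp _ hy0.
  have y0 : 0 < y%:R :> R by apply: lt_le_trans ky.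
  have ly := hl _ hy.
  have := @count_rotation R Q eta (K / y%:R ^+ 2) (a y - 2 * e2) (l y + 5 * e2)
     (K / y%:R) H (fun h => (y + h < Y1)%N && phi (y + h)%N).
  move=> /(_ isT eta0 hfar) hrot.
  apply: (le_trans (hrot _ _)); first by rewrite addr_ge0 // mulr_ge0 // ltW.
    move=> h hh /andP[yh1 ph].
    have yh0 : (Y0 <= y + h)%N by rewrite (leq_trans hy0) // leq_addr.
    have [m hm] := hphi (y + h)%N (introT andP (conj yh0 yh1)) ph.
    exists m; have [] := hlipH y h hy0 hh yh1.
    rewrite !ler_norml => la ll.
    have hlin := phase_linearization K y0 (ler0n _ h).
    have : 0 <= K * h%:R ^+ 2 / (y%:R ^+ 2 * (y%:R + h%:R)) <= e2.
      have d0 : 0 < y%:R ^+ 2 * (y%:R + h%:R) :> R.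
        by rewrite mulr_gt0 ?exprn_gt0 // ltr_wpDr.
      apply/andP; split; first by rewrite divr_ge0 ?(ltW d0) // mulr_ge0 ?exprn_ge0.
      rewrite ler_pdivrMr //.
      apply: (@le_trans _ _ (c2 * J%:R ^+ 2 * H%:R ^+ 2)).
        rewrite ler_pM ?exprn_ge0 //; first by case/andP: hK.
        by rewrite lerXn2r ?nnegrE // ler_nat ltnW.
      apply: (@le_trans _ _ (e2 * (kappa * J%:R) ^+ 3)).
        rewrite ler_pdivrMr // ler_pdivrMr ?exprn_gt0 // in Jcurv.
        have -> : c2 * J%:R ^+ 2 * H%:R ^+ 2 = c2 * H%:R ^+ 2 * J%:R ^+ 2 by ring.
        have -> : e2 * (kappa * J%:R) ^+ 3 = J%:R * e2 * kappa ^+ 3 * J%:R ^+ 2.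
          by ring.
        by rewrite ler_wpM2r // exprn_ge0 // ltW.
      rewrite ler_wpM2l ?(ltW e20) // exprSr ler_pM ?exprn_ge0 ?(ltW kJ0) //.
        by rewrite lerXn2r ?nnegrE ?(ltW kJ0).
      by rewrite (le_trans ky) // lerDl.
    rewrite natrD hlin in hm.
    set E := K * h%:R ^+ 2 / _ in hm *; move=> hE; lra.
  rewrite -/G.
  have : H%:R * (l y + 5 * e2 + Q%:R^-1) <= H%:R * (l y + 2 * (eps / 8)).
    rewrite ler_wpM2l ?(ltW H0) // /e2; lra.
  lra.
clear hphi hlipH hyp.
have htot : \sum_(Y0 <= y < Y1)
     \sum_(0 <= h < H) ((y + h < Y1)%N && phi (y + h)%N)%:R <=
   \sum_(Y0 <= y < Y1) (H%:R * (l y + 3 * (eps / 8)) +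
      H%:R * (~~ `[< far_from_rationals Q eta (K / y%:R ^+ 2) >])%:R).
  rewrite [leLHS]big_nat [leRHS]big_nat; apply: ler_sum => y hy.
  have h1 : 0 <= H%:R * (l y + 3 * (eps / 8)).
    by rewrite mulr_ge0 // addr_ge0 ?hl // mulr_ge0 // ltW.
  case: (boolP `[< _ >]) => [/asboolP hf|_] /=.
    by rewrite mulr0 addr0; apply: hblock.
  rewrite mulr1; apply: le_trans (@sum_bool_le R 0 H _) _.
  by rewrite subn0 lerDr.
have hslide := @sum_sliding_window R Y0 Y1 H phi.
rewrite big_split /= -!mulr_sumr big_split /= sumr_const_nat in htot.
have hn : (3 * (eps / 8)) *+ (Y1 - Y0) <= 4 * (eps / 8) * J%:R.
  apply: (@le_trans _ _ ((3 * (eps / 8)) *+ J.+1)).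
    rewrite ler_wpMn2l ?mulr_ge0 // ?ltW //.
    exact: leq_trans (leq_subr _ _) hY1.
  rewrite -mulr_natr -natr1; nra.
have hH2 : H%:R <= eps / 8 * J%:R by rewrite mulrC -ler_pdivrMr.
set S := \sum_(Y0 <= y < Y1) (phi y)%:R in hslide *.
rewrite -(ler_pM2l H0).
set SL := \sum_(Y0 <= y < Y1) l y in htot *.
set SB := \sum_(Y0 <= y < Y1) (~~ _)%:R in htot hbadJ.
set SS := \sum_(Y0 <= y < Y1) \sum_(_ <= _ < _) _ in htot hslide.
set N := _ *+ (Y1 - Y0) in htot hn.
have h3 : H%:R * (SL + N) + H%:R * SB + H%:R ^+ 2 <= H%:R * (SL + eps * J%:R).
  rewrite expr2 -!mulrDr ler_pM2l //.
  have : 0 <= eps * J%:R by rewrite mulr_ge0 // ltW.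
  lra.
lra.
Unshelve. all: by end_near.
Qed.

(** The complement of an arc is an arc, so the upper bound for phi and for its
negation gives both inequalities. At the endpoints of the arc phi is left
unspecified, which makes open, closed and half-open arcs, including single
points, instances of the same statement. *)
Lemma equidistribution (R : realType) (c1 c2 kappa L eps : R) :
  0 < c1 -> 0 < c2 -> 0 < kappa -> 0 <= L -> 0 < eps ->
  \forall J \near \oo,
    forall (K : R) (Y0 Y1 : nat) (a l : nat -> R) (phi : nat -> bool),
    c1 * J%:R ^+ 2 <= `|K| <= c2 * J%:R ^+ 2 -> kappa * J%:R <= Y0%:R ->
    (Y1 <= J.+1)%N ->
    (forall y, (Y0 <= y < Y1)%N -> 0 <= l y <= 1) ->
    (forall y y', (Y0 <= y)%N -> (y <= y')%N -> (y' < Y1)%N ->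
       `|a y' - a y| <= L * (y'%:R - y%:R) / J%:R /\
       `|l y' - l y| <= L * (y'%:R - y%:R) / J%:R) ->
    (forall y, (Y0 <= y < Y1)%N -> phi y ->
       exists m : int, a y <= K / y%:R - m%:~R <= a y + l y) ->
    (forall (y : nat) (m : int), (Y0 <= y < Y1)%N ->
       a y < K / y%:R - m%:~R < a y + l y -> phi y) ->
    `|\sum_(Y0 <= y < Y1) (phi y)%:R - \sum_(Y0 <= y < Y1) l y|
      <= eps * J%:R.
Proof.
move=> c10 c20 k0 L0 e0.
have L20 : 0 <= 2 * L by rewrite mulr_ge0.
near=> J => K Y0 Y1 a l phi hK hY0 hY1 hl hlip hphi1 hphi2.
have J0 : 0 < J%:R :> R by near: J; apply: nbhs_infty_gtr.
have hub : forall (K : R) (Y0 Y1 : nat) (a l : nat -> R) (phi : nat -> bool),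
    c1 * J%:R ^+ 2 <= K <= c2 * J%:R ^+ 2 -> kappa * J%:R <= Y0%:R ->
    (Y1 <= J.+1)%N ->
    (forall y, (Y0 <= y < Y1)%N -> 0 <= l y) ->
    (forall y y', (Y0 <= y)%N -> (y <= y')%N -> (y' < Y1)%N ->
       `|a y' - a y| <= 2 * L * (y'%:R - y%:R) / J%:R /\
       `|l y' - l y| <= 2 * L * (y'%:R - y%:R) / J%:R) ->
    (forall y, (Y0 <= y < Y1)%N -> phi y ->
       exists m : int, a y <= K / y%:R - m%:~R <= a y + l y) ->
    \sum_(Y0 <= y < Y1) (phi y)%:R <=
    \sum_(Y0 <= y < Y1) l y + eps * J%:R.
  by near: J; exact: equidistribution_upper.
(* For negative K, the arcs are reflected. *)
have {}hub : forall (a l : nat -> R) (phi : nat -> bool),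
    (forall y, (Y0 <= y < Y1)%N -> 0 <= l y) ->
    (forall y y', (Y0 <= y)%N -> (y <= y')%N -> (y' < Y1)%N ->
       [/\ `|a y' - a y| <= 2 * L * (y'%:R - y%:R) / J%:R,
        `|l y' - l y| <= 2 * L * (y'%:R - y%:R) / J%:R &
        `|(a y' + l y') - (a y + l y)| <= 2 * L * (y'%:R - y%:R) / J%:R]) ->
    (forall y, (Y0 <= y < Y1)%N -> phi y ->
       exists m : int, a y <= K / y%:R - m%:~R <= a y + l y) ->
    \sum_(Y0 <= y < Y1) (phi y)%:R <=
    \sum_(Y0 <= y < Y1) l y + eps * J%:R.
  move=> a' l' phi' h1 h2 h3.
  case: (lerP 0 K) => K0.
    rewrite ger0_norm // in hK; apply: (hub K _ _ a') => //.
    by move=> y y' p1 p2 p3; have [] := h2 _ _ p1 p2 p3.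
  rewrite ltr0_norm // in hK.
  apply: (hub (- K) _ _ (fun y => - (a' y + l' y))) => //.
    move=> y y' p1 p2 p3; have [q1 q2 q3] := h2 _ _ p1 p2 p3; split => //.
    by rewrite -normrN opprB opprK addrC.
  move=> y hy hp; have [m hm] := h3 y hy hp; exists (- m).
  rewrite intrN mulNr; lra.
have hLL y y' : (y <= y')%N ->
    L * (y'%:R - y%:R) / J%:R <= 2 * L * (y'%:R - y%:R) / J%:R.
  move=> yy; rewrite -!mulrA ler_peMl ?ler1n //.
  by rewrite mulr_ge0 // divr_ge0 ?subr_ge0 ?ler_nat.
have hlip2 y y' : (Y0 <= y)%N -> (y <= y')%N -> (y' < Y1)%N ->
    `|(a y' + l y') - (a y + l y)| <= 2 * L * (y'%:R - y%:R) / J%:R.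
  move=> p1 p2 p3; have [q1 q2] := hlip _ _ p1 p2 p3.
  have -> : a y' + l y' - (a y + l y) = (a y' - a y) + (l y' - l y) by ring.
  apply: le_trans (ler_normD _ _) _.
  have -> : 2 * L * (y'%:R - y%:R) / J%:R =
    L * (y'%:R - y%:R) / J%:R + L * (y'%:R - y%:R) / J%:R by ring.
  exact: lerD.
have h1 : \sum_(Y0 <= y < Y1) (phi y)%:R <=
    \sum_(Y0 <= y < Y1) l y + eps * J%:R.
  apply: (hub a) => //; first by move=> y /hl /andP[].
  move=> y y' p1 p2 p3; have [q1 q2] := hlip _ _ p1 p2 p3.
  by split; [exact: le_trans (hLL _ _ p2)|exact: le_trans (hLL _ _ p2)|exact: hlip2].
have h2 : \sum_(Y0 <= y < Y1) (~~ phi y)%:R <=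
    \sum_(Y0 <= y < Y1) (1 - l y) + eps * J%:R.
  apply: (hub (fun y => a y + l y)).
  - by move=> y /hl; lra.
  - move=> y y' p1 p2 p3; have [q1 q2] := hlip _ _ p1 p2 p3; split.
    + exact: hlip2.
    + have -> : 1 - l y' - (1 - l y) = - (l y' - l y) by ring.
      by rewrite normrN; exact: le_trans (hLL _ _ p2).
    + have -> : a y' + l y' + (1 - l y') - (a y + l y + (1 - l y)) = a y' - a y.
        by ring.
      exact: le_trans (hLL _ _ p2).
  (* Let m satisfy a <= z - m < a + 1. As z - m is not inside the arc, it is at
     least a + l, or equal to a, the end of the preceding complementary arc. *)
  move=> y hy hn; pose z := K / y%:R.
  have hf := floor_bounds (z - a y); set m := Num.floor (z - a y) in hf.
  have hno (n : int) : ~ (a y < z - n%:~R < a y + l y).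
    by move=> h; move/negP: hn; apply; exact: hphi2 h.
  have hly := hl _ hy.
  case: (lerP (a y + l y) (z - m%:~R)) => hz.
    by exists m; rewrite -/z; lra.
  have hm := hno m; exists (m - 1); rewrite -/z intrB.
  case: (ltrP (a y) (z - m%:~R)) => hz2; last by lra.
  by exfalso; apply: hm; rewrite hz2 hz.
have hsum : \sum_(Y0 <= y < Y1) (~~ phi y)%:R =
    \sum_(Y0 <= y < Y1) (1 - (phi y)%:R) :> R.
  by apply: eq_bigr => y _; case: (phi y); rewrite ?subrr ?subr0.
rewrite hsum !sumrB in h2; rewrite ler_norml; lra.
Unshelve. all: by end_near.
Qed.

(** * Equidistribution over lattice regions *)

Lemma sum_upper_set (R : realType) (U : nat -> bool) (Y0 Y1 : nat) :
  (Y0 <= Y1)%N ->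
  (forall y y', (Y0 <= y)%N -> (y <= y')%N -> (y' < Y1)%N -> U y -> U y') ->
  exists2 Y, (Y0 <= Y <= Y1)%N &
    forall F : nat -> R,
      \sum_(Y0 <= y < Y1) (U y)%:R * F y = \sum_(Y <= y < Y1) F y.
Proof.
move: {2}(Y1 - Y0)%N (erefl (Y1 - Y0)%N) => d.
elim: d Y0 => [|d IHd] Y0 hd hY hU.
  by exists Y1 => [|F]; rewrite ?hY ?leqnn // !big_geq // -subn_eq0 hd.
case: (boolP (U Y0)) => hU0.
  exists Y0 => [|F]; first by rewrite leqnn hY.
  apply: eq_big_nat => y /andP[h1 h2].
  by rewrite (hU Y0 y) // mul1r.
have lt01 : (Y0 < Y1)%N by rewrite -subn_gt0 hd.
have [|//|y y' h1|Y /andP[hY1 hY2] hF] := IHd Y0.+1.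
- by rewrite subnS hd.
- by apply: hU; exact: ltnW.
exists Y => [|F]; first by rewrite (ltnW hY1) hY2.
by rewrite big_ltn // (negPf hU0) mul0r add0r hF.
Qed.

(** In each column i the rows allowed by U form a final segment, on which the
phases equidistribute with constants independent of i. Summing over i and
exchanging the sums replaces U by the number 2 J A(y) of columns, up to C. *)
Lemma equidistribution_region (R : realType) (c1 c2 kappa L C eps : R) :
  0 < c1 -> 0 < c2 -> 0 < kappa -> 0 <= L -> 0 <= C -> 0 < eps ->
  \forall J \near \oo,
    forall (K : nat -> R) (Y0 : nat) (a l A : nat -> R)
      (U phi : nat -> nat -> bool),
    (forall i, (i < (2 * J).+1)%N ->
       c1 * J%:R ^+ 2 <= `|K i| <= c2 * J%:R ^+ 2) ->
    kappa * J%:R <= Y0%:R ->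
    (forall y, (Y0 <= y < J.+1)%N -> 0 <= l y <= 1) ->
    (forall y y', (Y0 <= y)%N -> (y <= y')%N -> (y' < J.+1)%N ->
       `|a y' - a y| <= L * (y'%:R - y%:R) / J%:R /\
       `|l y' - l y| <= L * (y'%:R - y%:R) / J%:R) ->
    (forall i y, (i < (2 * J).+1)%N -> (Y0 <= y < J.+1)%N -> phi i y ->
       exists m : int, a y <= K i / y%:R - m%:~R <= a y + l y) ->
    (forall i y (m : int), (i < (2 * J).+1)%N -> (Y0 <= y < J.+1)%N ->
       a y < K i / y%:R - m%:~R < a y + l y -> phi i y) ->
    (forall i y y', (i < (2 * J).+1)%N -> (Y0 <= y)%N -> (y <= y')%N ->
       (y' < J.+1)%N -> U i y -> U i y') ->
    (forall y, (Y0 <= y < J.+1)%N ->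
       `|\sum_(0 <= i < (2 * J).+1) (U i y)%:R - 2 * J%:R * A y| <= C) ->
    `|\sum_(Y0 <= y < J.+1) \sum_(0 <= i < (2 * J).+1) (U i y && phi i y)%:R
       - \sum_(Y0 <= y < J.+1) 2 * J%:R * A y * l y| <= eps * J%:R ^+ 2.
Proof.
move=> c10 c20 k0 L0 C0 e0.
have e40 : 0 < eps / 4 by rewrite divr_gt0.
near=> J => K Y0 a l A U phi hK hY0 hl hlip hphi1 hphi2 hU hA.
have J1 : 1 <= J%:R :> R by near: J; apply: nbhs_infty_ger.
have JC : 8 * C / eps <= J%:R by near: J; apply: nbhs_infty_ger.
have heq : forall (K : R) (Y0 Y1 : nat) (a l : nat -> R) (phi : nat -> bool),
    c1 * J%:R ^+ 2 <= `|K| <= c2 * J%:R ^+ 2 -> kappa * J%:R <= Y0%:R ->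
    (Y1 <= J.+1)%N ->
    (forall y, (Y0 <= y < Y1)%N -> 0 <= l y <= 1) ->
    (forall y y', (Y0 <= y)%N -> (y <= y')%N -> (y' < Y1)%N ->
       `|a y' - a y| <= L * (y'%:R - y%:R) / J%:R /\
       `|l y' - l y| <= L * (y'%:R - y%:R) / J%:R) ->
    (forall y, (Y0 <= y < Y1)%N -> phi y ->
       exists m : int, a y <= K / y%:R - m%:~R <= a y + l y) ->
    (forall (y : nat) (m : int), (Y0 <= y < Y1)%N ->
       a y < K / y%:R - m%:~R < a y + l y -> phi y) ->
    `|\sum_(Y0 <= y < Y1) (phi y)%:R - \sum_(Y0 <= y < Y1) l y|
      <= eps / 4 * J%:R.
  by near: J; exact: equidistribution.
case: (leqP Y0 J.+1) => hY; last first.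
  rewrite !big_geq ?(ltnW hY) // subrr normr0.
  by rewrite mulr_ge0 ?exprn_ge0 // ltW.
have hrow i : (i < (2 * J).+1)%N ->
    `|\sum_(Y0 <= y < J.+1) (U i y && phi i y)%:R
      - \sum_(Y0 <= y < J.+1) (U i y)%:R * l y| <= eps / 4 * J%:R.
  move=> hi.
  have [|Y /andP[hY1 hY2] hF] := @sum_upper_set R (U i) _ _ hY.
    by move=> y y'; exact: hU.
  have -> : \sum_(Y0 <= y < J.+1) (U i y && phi i y)%:R =
     \sum_(Y0 <= y < J.+1) (U i y)%:R * (phi i y)%:R :> R.
    by apply: eq_bigr => y _; rewrite -mulnb natrM.
  have hin y : (Y <= y < J.+1)%N -> (Y0 <= y < J.+1)%N.
    by case/andP=> h1 ->; rewrite (leq_trans hY1).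
  rewrite !hF; apply: (heq (K i) _ _ a) => //; first exact: hK.
  - by apply: le_trans hY0 _; rewrite ler_nat.
  - by move=> y /hin; exact: hl.
  - by move=> y y' h1; apply: hlip; exact: leq_trans h1.
  - by move=> y /hin; exact: hphi1.
  - by move=> y m /hin; exact: hphi2.
clear heq hphi1 hphi2 hlip hU hK.
set S1 := \sum_(Y0 <= y < J.+1) \sum_(0 <= i < (2 * J).+1) _.
pose S2 : R := \sum_(0 <= i < (2 * J).+1) \sum_(Y0 <= y < J.+1) (U i y)%:R * l y.
have h12 : `|S1 - S2| <= (2 * J).+1%:R * (eps / 4 * J%:R).
  rewrite /S1 /S2 exchange_big /= -sumrB.
  apply: le_trans (ler_norm_sum _ _ _) _.
  rewrite mulr_natl -[in leRHS](subn0 (2 * J).+1) -sumr_const_nat.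
  rewrite [leLHS]big_nat [leRHS]big_nat.
  by apply: ler_sum => i /andP[_]; exact: hrow.
have h23 : `|S2 - \sum_(Y0 <= y < J.+1) 2 * J%:R * A y * l y| <= J.+1%:R * C.
  rewrite /S2 exchange_big /= -sumrB.
  apply: le_trans (ler_norm_sum _ _ _) _.
  apply: (@le_trans _ _ (\sum_(Y0 <= y < J.+1) C)).
    rewrite [leLHS]big_nat [leRHS]big_nat; apply: ler_sum => y hy.
    rewrite -mulr_suml -mulrBl normrM.
    have := hl _ hy => hly; rewrite [X in _ * X]ger0_norm; last by lra.
    have hc := hA _ hy.
    have n0 := normr_ge0 (\sum_(0 <= i < (2 * J).+1) (U i y)%:R - 2 * J%:R * A y).
    nra.
  by rewrite sumr_const_nat mulr_natl ler_wpMn2l // leq_subr.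
set S3 := \sum_(Y0 <= y < J.+1) _ in h23 *.
have -> : S1 - S3 = (S1 - S2) + (S2 - S3) by ring.
apply: le_trans (ler_normD _ _) _.
have hC : J.+1%:R * C <= eps / 4 * J%:R ^+ 2.
  have hC1 : 8 * C <= eps * J%:R by move: JC; rewrite ler_pdivrMr // [J%:R * _]mulrC.
  rewrite -natr1 expr2.
  have : (J%:R + 1) * C <= (2 * J%:R) * C by rewrite ler_wpM2r //; lra.
  have : J%:R * (8 * C) <= J%:R * (eps * J%:R) by rewrite ler_wpM2l.
  lra.
have hn : (2 * J).+1%:R * (eps / 4 * J%:R) <= 3 / 4 * (eps * J%:R ^+ 2).
  rewrite -natr1 natrM expr2.
  have h0 : 0 <= eps / 4 * J%:R by rewrite mulr_ge0 // ltW.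
  have : (2%:R * J%:R + 1) * (eps / 4 * J%:R) <= (3 * J%:R) * (eps / 4 * J%:R).
    by rewrite ler_wpM2r //; lra.
  lra.
lra.
Unshelve. all: by end_near.
Qed.

(** * Counting columns in an interval *)

Definition clamp (R : realType) (n : nat) (x : R) : R :=
  Num.min n%:R (Num.max 0 x).

Lemma clamp_lipschitz (R : realType) (n : nat) (x y : R) :
  `|clamp n x - clamp n y| <= `|x - y|.
Proof.
have n0 : 0 <= n%:R :> R by [].
have [h|h] := lerP x y.
  by rewrite /clamp ler_norml !maxEle; repeat case: ifP => ?; rewrite !minEle; repeat case: ifP => ?; lra.
by rewrite /clamp ler_norml !maxEle; repeat case: ifP => ?; rewrite !minEle; repeat case: ifP => ?; lra.
Qed.

Lemma count_below (R : realType) (n : nat) (x : R) :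
  clamp n x <= \sum_(0 <= i < n) (i%:R < x)%R%:R <= clamp n x + 1.
Proof.
elim: n => [|n IHn].
  rewrite big_geq // /clamp maxEle.
  by case: ifP => ?; rewrite minEle; case: ifP => ?; lra.
rewrite big_nat_recr //=; move: IHn; set S := \sum_(_ <= _ < _) _.
have n0 : 0 <= n%:R :> R by [].
case: (ltrP n%:R x) => hx /=.
  have -> : S = n%:R.
    rewrite /S (eq_big_nat _ _ (F2 := fun=> 1)) ?sumr_const_nat ?subn0 //.
    move=> i /andP[_ hi]; have -> // : i%:R < x.
    by apply: le_lt_trans hx; rewrite ler_nat ltnW.
  move=> _; rewrite /clamp -natr1 maxEle.
  by case: ifP => ?; rewrite !minEle; repeat case: ifP => ?; lra.
rewrite addr0 /clamp -natr1 !maxEle.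
by repeat case: ifP => ?; rewrite !minEle; repeat case: ifP => ?; lra.
Qed.

Lemma count_between (R : realType) (n : nat) (x1 x2 : R) :
  `|\sum_(0 <= i < n) ((i%:R < x2) && (x1 <= i%:R))%R%:R
    - Num.max 0 (clamp n x2 - clamp n x1)| <= 1.
Proof.
case: (lerP x1 x2) => hx; last first.
  rewrite big1 => [|i _]; last first.
    case: (boolP (i%:R < x2)) => //= h1; case: (boolP (x1 <= i%:R)) => // h2; lra.
  have : clamp n x2 <= clamp n x1.
    by rewrite /clamp !maxEle; repeat case: ifP => ?; rewrite !minEle; repeat case: ifP => ?; lra.
  move=> h; rewrite maxEle; case: ifP => ?; rewrite ler_norml; lra.
have -> : \sum_(0 <= i < n) ((i%:R < x2) && (x1 <= i%:R))%R%:R =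
   \sum_(0 <= i < n) (i%:R < x2)%R%:R - \sum_(0 <= i < n) (i%:R < x1)%R%:R :> R.
  rewrite -sumrB; apply: eq_bigr => i _.
  case: (lerP x1 i%:R) => h1; case: (ltrP i%:R x2) => h2 /=; rewrite ?subr0 ?subrr //.
  lra.
have h1 := count_below n x1; have h2 := count_below n x2.
have h : clamp n x1 <= clamp n x2.
  by rewrite /clamp !maxEle; repeat case: ifP => ?; rewrite !minEle; repeat case: ifP => ?; lra.
rewrite max_r ?subr_ge0 // ler_norml; lra.
Qed.

(** * Points hit by the neighbouring rows *)

Definition frac (R : realType) (x : R) : R := x - (Num.floor x)%:~R.

Lemma frac_bounds (R : realType) (x : R) : 0 <= frac x < 1.
Proof. by have := floor_bounds x; rewrite /frac; lra. Qed.

Lemma fracE (R : realType) (x : R) (m : int) : 0 <= x - m%:~R < 1 ->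
  frac x = x - m%:~R.
Proof.
move=> h; rewrite /frac; congr (_ - _%:~R).
by apply: floor_def; rewrite intrD; lra.
Qed.

Lemma frac_double (R : realType) (x : R) :
  frac (2 * x) = if frac x < 1 / 2 then 2 * frac x else 2 * frac x - 1.
Proof.
have h := frac_bounds x; set m := Num.floor x.
have hm : frac x = x - m%:~R by [].
case: ifP => hf.
  rewrite (@fracE _ (2 * x) (2 * m)) intrM -?[2%:~R]/(2%:R); lra.
rewrite (@fracE _ (2 * x) (2 * m + 1)) intrD intrM -?[2%:~R]/(2%:R); lra.
Qed.

Lemma frac_opp (R : realType) (x : R) :
  frac (- x) = if frac x == 0 then 0 else 1 - frac x.
Proof.
have h := frac_bounds x; set m := Num.floor x.
have hm : frac x = x - m%:~R by [].
case: ifP => /eqP hf.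
  rewrite (@fracE _ (- x) (- m)) intrN; lra.
rewrite (@fracE _ (- x) (- m - 1)) intrB intrN; last by lra.
rewrite -[1%:~R]/(1 : R); lra.
Qed.

Lemma arc_of_frac (R : realType) (a l z : R) :
  a <= frac z <= a + l -> exists m : int, a <= z - m%:~R <= a + l.
Proof. by move=> h; exists (Num.floor z). Qed.

Lemma frac_of_arc (R : realType) (a l z : R) (m : int) :
  0 <= a -> a + l <= 1 -> a < z - m%:~R < a + l -> a < frac z < a + l.
Proof. by move=> a0 l1 h; rewrite (@fracE _ z m) //; lra. Qed.

(** Horizontal distance from the observer to column i; columns are numbered from
0 to 2J, so column i has abscissa i - J. *)
Definition depth (R : realType) (t : R) (J i : nat) : R :=
  t * J%:R ^+ 2 + (i%:R - J%:R).

(** The first point of row y + k that is not seen before (i, y) lies in column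
i + floor (k T / y), T being the depth of column i, and its determinant with
(i, y) is frac (k T / y) * y. The point (i, y) is hit when that column belongs to
the box and that determinant is less than D, the determinant of the prescribed
gap length. *)
Definition hit (R : realType) (t D : R) (J : nat) (k : int) (i y : nat) : bool :=
  (frac (k%:~R * depth t J i / y%:R) * y%:R < D) &&
  (0 <= i%:Z + Num.floor (k%:~R * depth t J i / y%:R) <= (2 * J)%:Z).

Definition unhit (R : realType) (t D : R) (J i y : nat) : bool :=
  [&& ~~ hit t D J 1 i y, ~~ hit t D J 2 i y,
      ~~ hit t D J (-1) i y & ~~ hit t D J (-2) i y].

Lemma hit_up (R : realType) (t D : R) (J i y k : nat) :
  (0 < y)%N -> 0 <= depth t J i ->
  hit t D J k%:Z i y =
    (k%:R * (depth t J i / y%:R) < 2 * J%:R - i%:R + 1) &&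
    (frac (k%:R * (depth t J i / y%:R)) < D / y%:R).
Proof.
move=> y0 T0; have y0r : 0 < y%:R :> R by rewrite ltr0n.
rewrite /hit -pmulrn -mulrA; set z := k%:R * _.
have z0 : 0 <= z by rewrite mulr_ge0 // divr_ge0 // ltW.
have -> : 0 <= i%:Z + Num.floor z by rewrite addr_ge0 // floor_ge0.
rewrite andTb -ltr_pdivlMr // andbC; congr (_ && _).
rewrite -ltzD1 -ltrBrDl floor_lt_int.
have -> // : ((2 * J)%:Z + 1 - i%:Z)%:~R = 2 * J%:R - i%:R + 1 :> R.
by rewrite intrB intrD -!pmulrn natrM; lra.
Qed.

Lemma hit_down (R : realType) (t D : R) (J i y k : nat) :
  (0 < y)%N -> (i <= 2 * J)%N -> 0 <= depth t J i ->
  hit t D J (- k%:Z) i y =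
    (k%:R * (depth t J i / y%:R) <= i%:R) &&
    (frac (k%:R * (- (depth t J i / y%:R))) < D / y%:R).
Proof.
move=> y0 iJ T0; have y0r : 0 < y%:R :> R by rewrite ltr0n.
have hz : (- k%:Z)%:~R * depth t J i / y%:R = - (k%:R * (depth t J i / y%:R)).
  by rewrite intrN -pmulrn !mulNr mulrA.
rewrite /hit hz.
rewrite mulrN; set z := k%:R * _.
have z0 : 0 <= z by rewrite mulr_ge0 // divr_ge0 // ltW.
have -> : i%:Z + Num.floor (- z) <= (2 * J)%:Z.
  have : Num.floor (- z) <= 0 by rewrite floor_le0; lra.
  have : i%:Z <= (2 * J)%:Z by rewrite lez_nat.
  lra.
rewrite andbT -ltr_pdivlMr // andbC; congr (_ && _).
rewrite -lerBlDl sub0r floor_ge_int intrN -pmulrn lerN2 //.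
Qed.

(** Inclusion and exclusion, with z = T / y the phase. The bound on 3z
says that two rows three steps apart never both reach over (i, y), so when row
y + 2 does, the rows y - 1 and y - 2 do not, whereas row y + 1 does.
Row y + 2 then adds to the hits of row y + 1 exactly the phases of an arc
starting at max (s, 1/2); the situation below is symmetric. When the rows y + 1
and y - 1 both reach over (i, y), their common hits are the phase 0 and the
phases in (1 - s, s). *)
Lemma unhit_indicator (R : realType) (t D : R) (J i y : nat) :
  (0 < y)%N -> (i <= 2 * J)%N -> 0 < D < y%:R ->
  let z := depth t J i / y%:R in
  let s := D / y%:R in
  2 * J%:R + 1 <= 3 * z ->
  (unhit t D J i y)%:R = 1
    - ((1 * z < 2 * J%:R - i%:R + 1) && (frac z < s))%R%:R
    - ((2 * z < 2 * J%:R - i%:R + 1) &&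
         (Num.max s (1 / 2) <= frac z < (1 + s) / 2))%R%:R
    - ((1 * z <= i%:R) && (frac (- z) < s))%R%:R
    - ((2 * z <= i%:R) &&
         (Num.max s (1 / 2) <= frac (- z) < (1 + s) / 2))%R%:R
    + (((1 * z < 2 * J%:R - i%:R + 1) && (1 * z <= i%:R)) &&
         (frac z == 0))%R%:R
    + (((1 * z < 2 * J%:R - i%:R + 1) && (1 * z <= i%:R)) &&
         (1 - s < frac z < s))%R%:R :> R.
Proof.
move=> y0 iJ hD z s hz; have y0r : 0 < y%:R :> R by rewrite ltr0n.
have s01 : 0 < s < 1 by rewrite /s divr_gt0 ?ltr_pdivrMr //; lra.
have iJr : i%:R <= 2 * J%:R :> R by rewrite -natrM ler_nat.
have i0 : 0 <= i%:R :> R by [].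
have J0 : 0 <= J%:R :> R by [].
have z0 : 0 <= z by lra.
have T0 : 0 <= depth t J i.
  by rewrite -(divfK (lt0r_neq0 y0r) (depth t J i)) mulr_ge0 // ltW.
have h1 : hit t D J 1 i y = _ := @hit_up R t D J i y 1 y0 T0.
have h2 : hit t D J 2 i y = _ := @hit_up R t D J i y 2 y0 T0.
have h3 : hit t D J (-1) i y = _ := @hit_down R t D J i y 1 y0 iJ T0.
have h4 : hit t D J (-2) i y = _ := @hit_down R t D J i y 2 y0 iJ T0.
rewrite /unhit h1 h2 h3 h4 {h1 h2 h3 h4} -/z -/s !frac_double !mul1r frac_opp.
have := frac_bounds z; move: (frac z) => f hf.
clear hD T0 y0r y0 iJ; clearbody z s.
have max_le x : (Num.max s (2^-1) <= x) = (s <= x) && (2^-1 <= x).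
  by rewrite ge_max.
rewrite !max_le.
case: (ltrP (2 * z) (2 * J%:R - i%:R + 1)) => hU2.
  have hU1 : z < 2 * J%:R - i%:R + 1 by lra.
  have hV1 : (z <= i%:R) = false by apply/negP => h; lra.
  have hV2 : (2 * z <= i%:R) = false by apply/negP => h; lra.
  rewrite hU1 hV1 hV2 /= !andbT.
  case: (ltrP f s) => h1; case: (ltrP f (2^-1)) => h2 /=;
    rewrite ?andbF /=; try lra.
    have -> : (2 * f < s) = false by apply/negP => h; lra.
    rewrite /=; lra.
  case: (ltrP f ((1 + s) / 2)) => h3.
    have -> : 2 * f - 1 < s by lra.
    rewrite /=; lra.
  have -> : (2 * f - 1 < s) = false by apply/negP => h; lra.
  rewrite /=; lra.
rewrite !andFb !andTb.
case: (lerP (2 * z) i%:R) => hV2.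
  have hU1 : (z < 2 * J%:R - i%:R + 1) = false by apply/negP => h; lra.
  have hV1 : z <= i%:R by lra.
  rewrite hU1 hV1 !andFb !andTb.
  set g := if f == 0 then 0 else 1 - f.
  have hg : 0 <= g < 1.
    rewrite /g; case: eqP => [_|/eqP f0]; first by lra.
    have : 0 < f by rewrite lt_neqAle eq_sym f0; case/andP: hf.
    lra.
  case: (ltrP g s) => h1; case: (ltrP g (2^-1)) => h2 /=;
    rewrite ?andbF /=; try lra.
    have -> : (2 * g < s) = false by apply/negP => h; lra.
    rewrite /=; lra.
  case: (ltrP g ((1 + s) / 2)) => h3.
    have -> : 2 * g - 1 < s by lra.
    rewrite /=; lra.
  have -> : (2 * g - 1 < s) = false by apply/negP => h; lra.
  rewrite /=; lra.
rewrite !andFb /=.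
case: (ltrP z (2 * J%:R - i%:R + 1)) => hU1; case: (lerP z i%:R) => hV1 /=; try lra.
- case: eqP => f0 /=.
    rewrite f0; have -> : 0 < s by lra.
    have -> : (1 - s < 0) = false by apply/negP => h; lra.
    rewrite /=; lra.
  have -> : (1 - s < f) = (1 - f < s) by apply/idP/idP => ?; lra.
  by case: (f < s); case: (1 - f < s) => /=; lra.
- by case: (f < s) => /=; lra.
- by case: (_ < s) => /=; lra.
Qed.

(** * Columns over which a neighbouring row extends *)

(** Proportion, up to O(1 / J), of the columns of row y over which row y + k
extends, and likewise row y - k. *)
Definition cover (R : realType) (t k : R) (J y : nat) : R :=
  Num.max 0 (1 - k * t * J%:R / (2 * y%:R)).

(** The columns over which row y + k extends are those of index less than
this bound. *)
Definition up_bound (R : realType) (t k : R) (J y : nat) : R :=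
  (y%:R * (2 * J%:R + 1) - k * (t * J%:R ^+ 2 - J%:R)) / (y%:R + k).

(** The columns over which row y - k extends are those of index at least
this bound. *)
Definition down_bound (R : realType) (t k : R) (J y : nat) : R :=
  k * (t * J%:R ^+ 2 - J%:R) / (y%:R - k).

Lemma up_boundE (R : realType) (t k : R) (J i y : nat) :
  0 < y%:R :> R -> 0 <= k ->
  (k * (depth t J i / y%:R) < 2 * J%:R - i%:R + 1) = (i%:R < up_bound t k J y).
Proof.
move=> y0 k0; rewrite /up_bound /depth mulrA ltr_pdivrMr // ltr_pdivlMr; last by lra.
by apply/idP/idP => h; lra.
Qed.

Lemma down_boundE (R : realType) (t k : R) (J i y : nat) :
  0 < y%:R :> R -> k < y%:R ->
  (k * (depth t J i / y%:R) <= i%:R) = (down_bound t k J y <= i%:R).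
Proof.
move=> y0 k0; rewrite /down_bound /depth mulrA ler_pdivrMr // ler_pdivrMr; last by lra.
by apply/idP/idP => h; lra.
Qed.

Definition column_error (R : realType) (t kappa : R) : R :=
  4 / kappa + 8 * t / kappa ^+ 2.

Lemma depth_ratio_bounds (R : realType) (t kappa : R) (J y : nat) :
  0 < t -> 0 < kappa -> 1 <= J%:R :> R -> kappa * J%:R <= y%:R :> R ->
  0 <= t * J%:R ^+ 2 / y%:R <= t * J%:R / kappa.
Proof.
move=> t0 k0 J1 hy; have y0 : 0 < y%:R :> R by apply: lt_le_trans hy; nra.
apply/andP; split; first by rewrite divr_ge0 ?mulr_ge0 ?exprn_ge0 // ltW.
rewrite ler_pdivrMr // mulrAC ler_pdivlMr // expr2.
have -> : t * (J%:R * J%:R) * kappa = t * J%:R * (kappa * J%:R) by ring.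
by rewrite ler_wpM2l // mulr_ge0 // ltW.
Qed.

Lemma up_bound_approx (R : realType) (t kappa k : R) (J y : nat) :
  0 < t -> 0 < kappa -> 0 <= k <= 2 -> 1 <= J%:R :> R ->
  kappa * J%:R <= y%:R <= (J%:R : R) ->
  `|up_bound t k J y - (2 * J%:R - k * (t * J%:R ^+ 2 / y%:R))|
    <= column_error t kappa.
Proof.
move=> t0 k0 hk J1 /andP[hy hyJ].
have y0 : 0 < y%:R :> R by apply: lt_le_trans hy; nra.
have := depth_ratio_bounds t0 k0 J1 hy.
set X := t * J%:R ^+ 2 / y%:R => hX.
have yk : 0 < y%:R + k by lra.
have -> : up_bound t k J y - (2 * J%:R - k * X) =
    (y%:R - k * J%:R + k ^+ 2 * X) / (y%:R + k).
  rewrite /up_bound.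
  have -> : t * J%:R ^+ 2 = X * y%:R by rewrite /X divfK // lt0r_neq0.
  by field; rewrite lt0r_neq0.
rewrite normrM normfV (gtr0_norm yk) ler_pdivrMr //.
have h1 : `|y%:R - k * J%:R + k ^+ 2 * X| <= 4 * J%:R + 8 * (t * J%:R / kappa).
  have a1 : 0 <= k * J%:R <= 2 * J%:R by nra.
  have a2 : 0 <= k ^+ 2 * X <= 4 * X.
    have : 0 <= k ^+ 2 <= 4 by rewrite expr2; nra.
    nra.
  by rewrite ler_norml; lra.
apply: le_trans h1 _.
apply: (@le_trans _ _ (column_error t kappa * (kappa * J%:R))).
  rewrite /column_error.
  have -> : (4 / kappa + 8 * t / kappa ^+ 2) * (kappa * J%:R) =
     4 * J%:R + 8 * (t * J%:R / kappa) by field; rewrite lt0r_neq0.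
  exact: lexx.
rewrite ler_wpM2l //; last by lra.
by rewrite addr_ge0 // divr_ge0 ?exprn_ge0 ?mulr_ge0 // ltW.
Qed.

Lemma down_bound_approx (R : realType) (t kappa k : R) (J y : nat) :
  0 < t -> 0 < kappa -> 0 <= k <= 2 -> 1 <= J%:R :> R ->
  kappa * J%:R <= y%:R <= (J%:R : R) -> 4 <= y%:R :> R ->
  `|down_bound t k J y - k * (t * J%:R ^+ 2 / y%:R)|
    <= column_error t kappa.
Proof.
move=> t0 k0 hk J1 /andP[hy hyJ] y4.
have y0 : 0 < y%:R :> R by apply: lt_le_trans hy; nra.
have := depth_ratio_bounds t0 k0 J1 hy.
set X := t * J%:R ^+ 2 / y%:R => hX.
have yk : 0 < y%:R - k by lra.
have -> : down_bound t k J y - k * X =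
    (k ^+ 2 * X - k * J%:R) / (y%:R - k).
  rewrite /down_bound.
  have -> : t * J%:R ^+ 2 = X * y%:R by rewrite /X divfK // lt0r_neq0.
  by field; rewrite lt0r_neq0.
rewrite normrM normfV (gtr0_norm yk) ler_pdivrMr //.
have h1 : `|k ^+ 2 * X - k * J%:R| <= 2 * J%:R + 4 * (t * J%:R / kappa).
  have a1 : 0 <= k * J%:R <= 2 * J%:R by nra.
  have a2 : 0 <= k ^+ 2 * X <= 4 * X.
    have : 0 <= k ^+ 2 <= 4 by rewrite expr2; nra.
    nra.
  by rewrite ler_norml; lra.
apply: le_trans h1 _.
apply: (@le_trans _ _ (column_error t kappa * (kappa * J%:R / 2))).
  rewrite /column_error.
  have -> : (4 / kappa + 8 * t / kappa ^+ 2) * (kappa * J%:R / 2) =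
     2 * J%:R + 4 * (t * J%:R / kappa) by field; rewrite lt0r_neq0.
  exact: lexx.
rewrite ler_wpM2l //; last by lra.
by rewrite addr_ge0 // divr_ge0 ?exprn_ge0 ?mulr_ge0 // ltW.
Qed.

Lemma coverE (R : realType) (t k : R) (J y : nat) : 0 < y%:R :> R ->
  2 * J%:R * cover t k J y = Num.max 0 (2 * J%:R - k * (t * J%:R ^+ 2 / y%:R)).
Proof.
move=> y0; rewrite /cover maxr_pMr ?mulr_ge0 // mulr0; congr Num.max.
by field; rewrite lt0r_neq0.
Qed.

Lemma columns_up (R : realType) (t kappa k : R) (J y : nat) :
  0 < t -> 0 < kappa -> 0 <= k <= 2 -> 1 <= J%:R :> R ->
  kappa * J%:R <= y%:R <= (J%:R : R) ->
  `|\sum_(0 <= i < (2 * J).+1)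
      (k * (depth t J i / y%:R) < 2 * J%:R - i%:R + 1)%R%:R
    - 2 * J%:R * cover t k J y| <= 2 * column_error t kappa + 2.
Proof.
move=> t0 k0 hk J1 hy.
have y0 : 0 < y%:R :> R by case/andP: hy => + _; apply: lt_le_trans; rewrite mulr_gt0 //; lra.
have hX := depth_ratio_bounds t0 k0 J1 (andP hy).1.
have kk : 0 <= k by case/andP: hk.
under eq_bigr => i _ do rewrite up_boundE //.
rewrite coverE //; set e := 2 * J%:R - _.
have he : e <= 2 * J%:R by rewrite /e gerBl mulr_ge0 //; case/andP: hk; case/andP: hX.
have -> : Num.max 0 e = clamp (2 * J).+1 e.
  rewrite /clamp min_r // ge_max -natr1 natrM; have : 0 <= J%:R :> R by []; lra.
have h1 := count_below (2 * J).+1 (up_bound t k J y).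
have h2 := clamp_lipschitz (2 * J).+1 (up_bound t k J y) e.
have h3 := le_trans h2 (up_bound_approx t0 k0 hk J1 hy).
move: h3; rewrite !ler_norml; have : 0 <= column_error t kappa.
  by apply: le_trans (up_bound_approx t0 k0 hk J1 hy).
lra.
Qed.

Lemma columns_down (R : realType) (t kappa k : R) (J y : nat) :
  0 < t -> 0 < kappa -> 0 <= k <= 2 -> 1 <= J%:R :> R ->
  kappa * J%:R <= y%:R <= (J%:R : R) -> 4 <= y%:R :> R ->
  `|\sum_(0 <= i < (2 * J).+1)
      (k * (depth t J i / y%:R) <= i%:R)%R%:R
    - 2 * J%:R * cover t k J y| <= 2 * column_error t kappa + 2.
Proof.
move=> t0 k0 hk J1 hy y4.
have y0 : 0 < y%:R :> R by lra.
have hX := depth_ratio_bounds t0 k0 J1 (andP hy).1.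
have kk : k < y%:R by lra.
under eq_bigr => i _ do rewrite down_boundE //.
rewrite coverE //; set X := k * _.
have X0 : 0 <= X by rewrite /X mulr_ge0 //; case/andP: hk; case/andP: hX.
have hc := clamp_lipschitz (2 * J).+1 (down_bound t k J y) X.
have h3 := le_trans hc (down_bound_approx t0 k0 hk J1 hy y4).
have h1 := count_below (2 * J).+1 (down_bound t k J y).
have -> : \sum_(0 <= i < (2 * J).+1) (down_bound t k J y <= i%:R)%R%:R =
  (2 * J).+1%:R - \sum_(0 <= i < (2 * J).+1) (i%:R < down_bound t k J y)%R%:R :> R.
  have hn : \sum_(0 <= i < (2 * J).+1) (1 : R) = (2 * J).+1%:R.
    by rewrite sumr_const_nat subn0.
  rewrite -hn -sumrB.
  by apply: eq_bigr => i _; case: lerP; rewrite ?subr0 ?subrr.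
have h4 : `|(2 * J).+1%:R - clamp (2 * J).+1 X - Num.max 0 (2 * J%:R - X)| <= 1.
  rewrite /clamp (max_r X0) -natr1 natrM minEle maxEle ler_norml.
  have : 0 <= J%:R :> R by [].
  by repeat case: ifP => ?; lra.
have : 0 <= column_error t kappa.
  by apply: le_trans (down_bound_approx t0 k0 hk J1 hy y4).
by move: h3 h4; rewrite !ler_norml; lra.
Qed.

(** Rows y + 1 and y - 1 overlap over row y in as many columns as row y + 2
extends over, asymptotically: 1 - 2 (1/w) in both cases, where w is the number of
row spacings covered by row y. *)
Lemma columns_both (R : realType) (t kappa : R) (J y : nat) :
  0 < t -> 0 < kappa -> 1 <= J%:R :> R ->
  kappa * J%:R <= y%:R <= (J%:R : R) -> 4 <= y%:R :> R ->
  `|\sum_(0 <= i < (2 * J).+1)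
      ((1 * (depth t J i / y%:R) < 2 * J%:R - i%:R + 1)
        && (1 * (depth t J i / y%:R) <= i%:R))%R%:R
    - 2 * J%:R * cover t 2 J y| <= 2 * column_error t kappa + 2.
Proof.
move=> t0 k0 J1 hy y4.
have y0 : 0 < y%:R :> R by lra.
have k1 : 0 <= (1 : R) <= 2 by lra.
have hX := depth_ratio_bounds t0 k0 J1 (andP hy).1.
have kk : 1 < y%:R :> R by lra.
under eq_bigr => i _ do rewrite up_boundE // down_boundE //.
rewrite coverE //.
have h0 := count_between (2 * J).+1 (down_bound t 1 J y) (up_bound t 1 J y).
have h1 := le_trans (clamp_lipschitz (2 * J).+1 _ _)
  (down_bound_approx t0 k0 k1 J1 hy y4).
have h2 := le_trans (clamp_lipschitz (2 * J).+1 _ _)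
  (up_bound_approx t0 k0 k1 J1 hy).
move: h0 h1 h2 hX; rewrite !mul1r; set X := t * _ / _.
set S := \sum_(_ <= _ < _) _.
set c1 := clamp _ (down_bound _ _ _ _); set c2 := clamp _ (up_bound _ _ _ _).
have C0 : 0 <= column_error t kappa.
  by apply: le_trans (up_bound_approx t0 k0 k1 J1 hy).
move=> h0 h1 h2 /andP[X0 _].
have hm : `|Num.max 0 (c2 - c1) - Num.max 0 (2 * J%:R - 2 * X)|
    <= 2 * column_error t kappa.
  have J0 : 0 <= J%:R :> R by [].
  have hcl : Num.max 0 (2 * J%:R - 2 * X) =
      Num.max 0 (clamp (2 * J).+1 (2 * J%:R - X) - clamp (2 * J).+1 X).
    have hn : (2 * J).+1%:R = 2 * J%:R + 1 :> R by rewrite -natr1 natrM.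
    rewrite /clamp (max_r X0) hn.
    case: (lerP X (2 * J%:R)) => hXJ.
      have m1 : Num.min (2 * J%:R + 1) X = X by rewrite min_r //; lra.
      have m2 : Num.max 0 (2 * J%:R - X) = 2 * J%:R - X by rewrite max_r //; lra.
      have m3 : Num.min (2 * J%:R + 1) (2 * J%:R - X) = 2 * J%:R - X.
        by rewrite min_r //; lra.
      by rewrite m1 m2 m3; congr (Order.max _ _); lra.
    rewrite (@max_l _ _ 0 (2 * J%:R - X)); last by lra.
    rewrite min_r; last by lra.
    have : 0 <= Num.min (2 * J%:R + 1) X by rewrite le_min; lra.
    by move=> ?; rewrite !max_l //; lra.
  rewrite hcl; move: h1 h2.
  set d1 := clamp _ X; set d2 := clamp _ (_ - X).
  rewrite !ler_norml !maxEle => h1 h2.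
  by do 2 case: ifP => ?; lra.
by move: hm h0; rewrite !ler_norml; lra.
Qed.

(** * Asymptotic number of unhit points *)

(** The proportion of unhit points in row y predicted by uniform phases. The
ratio s is the prescribed gap length measured in steps of row y. *)
Definition row_density (R : realType) (t D : R) (J y : nat) : R :=
  let s := D / y%:R in
  1 - 2 * s * cover t 1 J y
    - 2 * Num.min (s / 2) ((1 - s) / 2) * cover t 2 J y
    + Num.max 0 (2 * s - 1) * cover t 2 J y.

Lemma depth_bounds (R : realType) (t : R) (J i : nat) :
  0 < t -> 2 <= t * J%:R -> (i <= 2 * J)%N ->
  t / 2 * J%:R ^+ 2 <= depth t J i <= 2 * t * J%:R ^+ 2.
Proof.
move=> t0 hJ hi; rewrite /depth expr2.
have : i%:R <= 2 * J%:R :> R by rewrite -natrM ler_nat.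
have : 0 <= i%:R :> R by [].
have : 0 <= J%:R :> R by [].
nra.
Qed.

Lemma middle_arc (R : realType) (s : R) : 0 < s < 1 ->
  [/\ 0 <= Num.max s (1 / 2), 0 <= Num.min (s / 2) ((1 - s) / 2) &
      Num.max s (1 / 2) + Num.min (s / 2) ((1 - s) / 2) = (1 + s) / 2].
Proof.
rewrite maxEle minEle => h.
by case: ifP => ?; case: ifP => ?; split; lra.
Qed.

Lemma middle_arc_lipschitz (R : realType) (s s' : R) :
  `|Num.max s' (1 / 2) - Num.max s (1 / 2)| <= 2 * `|s' - s| /\
  `|Num.min (s' / 2) ((1 - s') / 2) - Num.min (s / 2) ((1 - s) / 2)|
     <= 2 * `|s' - s|.
Proof.
rewrite !maxEle !minEle.
by split; case: (lerP s' s) => ?; repeat case: ifP => ?;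
  rewrite ler_norml; lra.
Qed.

Lemma reflected_arc_lipschitz (R : realType) (s s' : R) :
  `|(1 - s') - (1 - s)| <= 2 * `|s' - s| /\
  `|Num.max 0 (2 * s' - 1) - Num.max 0 (2 * s - 1)| <= 2 * `|s' - s|.
Proof.
rewrite !maxEle.
by split; case: (lerP s' s) => ?; repeat case: ifP => ?;
  rewrite ler_norml; lra.
Qed.

Lemma linear_arc (R : realType) (s : R) : 0 < s < 1 ->
  [/\ 0 <= (0 : R), 0 <= s & 0 + s <= 1].
Proof. by move=> h; split; lra. Qed.

Lemma linear_arc_lipschitz (R : realType) (s s' : R) :
  `|(0 : R) - 0| <= 2 * `|s' - s| /\ `|s' - s| <= 2 * `|s' - s|.
Proof. by rewrite subrr normr0; have := normr_ge0 (s' - s); lra. Qed.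

Lemma point_arc_lipschitz (R : realType) (s s' : R) :
  `|(0 : R) - 0| <= 2 * `|s' - s| /\ `|(0 : R) - 0| <= 2 * `|s' - s|.
Proof. by rewrite subrr normr0; have := normr_ge0 (s' - s); lra. Qed.

Lemma reflected_arc (R : realType) (s : R) : 0 < s < 1 ->
  [/\ 0 <= 1 - s, 0 <= Num.max 0 (2 * s - 1) &
      1 - s + Num.max 0 (2 * s - 1) <= 1].
Proof. by rewrite maxEle => h; case: ifP => ?; split; lra. Qed.

Lemma reflected_arc_mem (R : realType) (s f : R) :
  (1 - s < f < s -> 1 - s <= f <= 1 - s + Num.max 0 (2 * s - 1)) /\
  (1 - s < f < 1 - s + Num.max 0 (2 * s - 1) -> 1 - s < f < s).
Proof. by rewrite maxEle; case: ifP => ?; split => ?; lra. Qed.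

Lemma row_range (R : realType) (kappa D : R) (J Y0 y : nat) :
  D = kappa * J%:R -> D < Y0%:R -> 4 <= D -> (Y0 <= y < J.+1)%N ->
  [/\ D < y%:R, kappa * J%:R <= y%:R <= (J%:R : R) & 4 <= (y%:R : R)].
Proof.
move=> hDk hDY h4 /andP[h1 h2].
have h3 : D < y%:R by apply: lt_le_trans hDY _; rewrite ler_nat.
have h5 : y%:R <= J%:R :> R by rewrite ler_nat -ltnS.
by split; [ | rewrite -hDk h5 andbT ltW | apply: le_trans h4 (ltW h3)].
Qed.

Lemma ratio_lipschitz (R : realType) (kappa J D y y' : R) :
  0 < kappa -> 0 < J -> 0 < D -> D < y -> y <= y' -> kappa * J <= y' ->
  2 * `|D / y' - D / y| <= 2 / kappa * (y' - y) / J.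
Proof.
move=> k0 J0 D0 Dy yy hy'.
have y0 : 0 < y by lra.
have y0' : 0 < y' by lra.
have -> : D / y' - D / y = - (D / y * ((y' - y) / y')).
  by field; rewrite !lt0r_neq0.
rewrite normrN ger0_norm; last first.
  by rewrite mulr_ge0 ?divr_ge0 ?subr_ge0 // ltW.
have h4 : (y' - y) / y' <= (y' - y) / (kappa * J).
  by rewrite ler_wpM2l ?subr_ge0 // lef_pV2 // posrE mulr_gt0.
have -> : 2 / kappa * (y' - y) / J = 2 * ((y' - y) / (kappa * J)).
  by field; rewrite !lt0r_neq0.
rewrite ler_pM2l //; apply: le_trans h4.
have h5 : 0 <= (y' - y) / y' by rewrite divr_ge0 ?subr_ge0 // ltW.
by rewrite ler_piMl // ler_pdivrMr // mul1r ltW.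
Qed.

(** equidistribution_region for the phases T / y and - T / y, with arcs whose
ends are functions of s = D / y. Since y > D, the ratio s is a Lipschitz function
of y / J, and so are the ends of the arcs. *)
Lemma arc_asymptotics (R : realType) (t c C eps : R) :
  0 < t -> 0 < c -> 0 <= C -> 0 < eps ->
  \forall J \near \oo, forall (D : R) (Y0 : nat)
      (e : R) (fa fl : R -> R) (A : nat -> R) (U phi : nat -> nat -> bool),
    D = c * t / 2 * J%:R -> D < Y0%:R -> `|e| = 1 ->
    (forall s, 0 < s < 1 -> [/\ 0 <= fa s, 0 <= fl s & fa s + fl s <= 1]) ->
    (forall s s', `|fa s' - fa s| <= 2 * `|s' - s| /\
                  `|fl s' - fl s| <= 2 * `|s' - s|) ->
    (forall i y, (Y0 <= y < J.+1)%N -> phi i y ->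
       fa (D / y%:R) <= frac (e * (depth t J i / y%:R))
         <= fa (D / y%:R) + fl (D / y%:R)) ->
    (forall i y, (Y0 <= y < J.+1)%N ->
       fa (D / y%:R) < frac (e * (depth t J i / y%:R))
         < fa (D / y%:R) + fl (D / y%:R) -> phi i y) ->
    (forall i y y', (i < (2 * J).+1)%N -> (Y0 <= y)%N -> (y <= y')%N ->
       (y' < J.+1)%N -> U i y -> U i y') ->
    (forall y, (Y0 <= y < J.+1)%N ->
       `|\sum_(0 <= i < (2 * J).+1) (U i y)%:R - 2 * J%:R * A y| <= C) ->
    `|\sum_(Y0 <= y < J.+1) \sum_(0 <= i < (2 * J).+1) (U i y && phi i y)%:R
       - \sum_(Y0 <= y < J.+1) 2 * J%:R * A y * fl (D / y%:R)|
    <= eps * J%:R ^+ 2.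
Proof.
move=> t0 c0 C0 e0.
have k0 : 0 < c * t / 2 by rewrite divr_gt0 // mulr_gt0.
have t20 : 0 < t / 2 by lra.
have t2 : 0 < 2 * t by lra.
have L0 : 0 <= 2 / (c * t / 2) by rewrite divr_ge0 // ltW.
near=> J => D Y0 e fa fl A U phi hDk hDY e1 hf hflip hphi1 hphi2 hU hA.
have J1 : 1 <= J%:R :> R by near: J; apply: nbhs_infty_ger.
have JtJ : 2 / t <= J%:R by near: J; apply: nbhs_infty_ger.
have Jk : 4 / (c * t / 2) <= J%:R by near: J; apply: nbhs_infty_ger.
have J0 : 0 < J%:R :> R by exact: lt_le_trans J1.
have {}JtJ : 2 <= t * J%:R by rewrite mulrC -ler_pdivrMr.
have D0 : 0 < D by rewrite hDk mulr_gt0.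
have D4 : 4 <= D by rewrite hDk mulrC -ler_pdivrMr.
have hrange y := row_range hDk hDY D4 (y := y).
have hs y : (Y0 <= y < J.+1)%N -> 0 < D / y%:R < 1.
  move=> /hrange[h1 _ h3]; have y0 : 0 < y%:R :> R by exact: lt_trans h1.
  by rewrite divr_gt0 //= ltr_pdivrMr // mul1r.
have hT i : (i < (2 * J).+1)%N ->
    t / 2 * J%:R ^+ 2 <= depth t J i <= 2 * t * J%:R ^+ 2.
  by move=> hi; apply: depth_bounds.
have hT0 i : (i < (2 * J).+1)%N -> 0 < depth t J i.
  move=> /hT /andP[+ _]; apply: lt_le_trans.
  by rewrite mulr_gt0 // exprn_gt0.
have hreg : forall (K : nat -> R) (a l : nat -> R),
    (forall i, (i < (2 * J).+1)%N ->
       t / 2 * J%:R ^+ 2 <= `|K i| <= 2 * t * J%:R ^+ 2) ->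
    c * t / 2 * J%:R <= Y0%:R ->
    (forall y, (Y0 <= y < J.+1)%N -> 0 <= l y <= 1) ->
    (forall y y', (Y0 <= y)%N -> (y <= y')%N -> (y' < J.+1)%N ->
       `|a y' - a y| <= 2 / (c * t / 2) * (y'%:R - y%:R) / J%:R /\
       `|l y' - l y| <= 2 / (c * t / 2) * (y'%:R - y%:R) / J%:R) ->
    (forall i y, (i < (2 * J).+1)%N -> (Y0 <= y < J.+1)%N -> phi i y ->
       exists m : int, a y <= K i / y%:R - m%:~R <= a y + l y) ->
    (forall i y (m : int), (i < (2 * J).+1)%N -> (Y0 <= y < J.+1)%N ->
       a y < K i / y%:R - m%:~R < a y + l y -> phi i y) ->
    `|\sum_(Y0 <= y < J.+1) \sum_(0 <= i < (2 * J).+1) (U i y && phi i y)%:R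
       - \sum_(Y0 <= y < J.+1) 2 * J%:R * A y * l y| <= eps * J%:R ^+ 2.
  move=> K a l h1 h2 h3 h4 h5 h6.
  move: K Y0 a l A U phi h1 h2 h3 h4 h5 h6 hU hA
    {hDY hphi1 hphi2 hrange hs} ; near: J; exact: equidistribution_region.
apply: (hreg (fun i => e * depth t J i) (fun y => fa (D / y%:R))) => //.
- by move=> i hi; rewrite normrM e1 mul1r gtr0_norm ?hT0 // hT.
- by rewrite -hDk ltW.
- move=> y /hs /hf[f0 l0 fl1]; rewrite l0 /=; apply: le_trans fl1.
  by rewrite lerDr.
- move=> y y' h1 h2 h3.
  have [p1 _ _] := hrange y (introT andP (conj h1 (leq_ltn_trans h2 h3))).
  have [_ /andP[q2 _] _] := hrange y' (introT andP (conj (leq_trans h1 h2) h3)).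
  have yy : y%:R <= y'%:R :> R by rewrite ler_nat.
  have [l1 l2] := hflip (D / y%:R) (D / y'%:R).
  have l3 := ratio_lipschitz k0 J0 D0 p1 yy q2.
  by split; [exact: le_trans l3|exact: le_trans l3].
- by move=> i y _ hy /(hphi1 i y hy); rewrite mulrA => h; exact: arc_of_frac.
- move=> i y m _ hy; have [f0 l0 fl1] := hf _ (hs _ hy); rewrite -mulrA => h.
  by apply: hphi2 => //; exact: frac_of_arc h.
Unshelve. all: by end_near.
Qed.

(** Each term of unhit_indicator is an arc of phases over a set of columns that
grows with y; arc_asymptotics evaluates all of them. *)
Lemma unhit_asymptotics (R : realType) (t c eps : R) :
  2 / 3 < t -> 0 < c -> 0 < eps ->
  \forall J \near \oo, forall (D : R) (Y0 : nat),
    D = c * t / 2 * J%:R -> D < Y0%:R ->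
    `|\sum_(Y0 <= y < J.+1) \sum_(0 <= i < (2 * J).+1) (unhit t D J i y)%:R
      - \sum_(Y0 <= y < J.+1) 2 * J%:R * row_density t D J y|
    <= eps * J%:R ^+ 2.
Proof.
move=> t23 c0 e0; have t0 : 0 < t by lra.
have k0 : 0 < c * t / 2 by rewrite divr_gt0 // mulr_gt0.
have C0 : 0 <= 2 * column_error t (c * t / 2) + 2.
  by rewrite addr_ge0 // mulr_ge0 // addr_ge0 // divr_ge0 ?exprn_ge0 ?mulr_ge0 // ltW.
have e80 : 0 < eps / 8 by lra.
near=> J => D Y0 hDk hDY.
have J1 : 1 <= J%:R :> R by near: J; apply: nbhs_infty_ger.
have JtJ : 2 / t <= J%:R by near: J; apply: nbhs_infty_ger.
have Jk : 4 / (c * t / 2) <= J%:R by near: J; apply: nbhs_infty_ger.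
have J3 : 4 / (3 * t - 2) <= J%:R by near: J; apply: nbhs_infty_ger.
have Je : 16 / eps <= J%:R by near: J; apply: nbhs_infty_ger.
have J0 : 0 < J%:R :> R by exact: lt_le_trans J1.
have {}JtJ : 2 <= t * J%:R by rewrite mulrC -ler_pdivrMr.
have {}J3 : 4 <= (3 * t - 2) * J%:R.
  by move: J3; rewrite ler_pdivrMr; [rewrite mulrC|lra].
have D0 : 0 < D by rewrite hDk mulr_gt0.
have D4 : 4 <= D by rewrite hDk mulrC -ler_pdivrMr.
have hterm (e : R) (fa fl : R -> R) (A : nat -> R) (U phi : nat -> nat -> bool) :
    `|e| = 1 ->
    (forall s, 0 < s < 1 -> [/\ 0 <= fa s, 0 <= fl s & fa s + fl s <= 1]) ->
    (forall s s', `|fa s' - fa s| <= 2 * `|s' - s| /\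
                  `|fl s' - fl s| <= 2 * `|s' - s|) ->
    (forall i y, (Y0 <= y < J.+1)%N -> phi i y ->
       fa (D / y%:R) <= frac (e * (depth t J i / y%:R))
         <= fa (D / y%:R) + fl (D / y%:R)) ->
    (forall i y, (Y0 <= y < J.+1)%N ->
       fa (D / y%:R) < frac (e * (depth t J i / y%:R))
         < fa (D / y%:R) + fl (D / y%:R) -> phi i y) ->
    (forall i y y', (i < (2 * J).+1)%N -> (Y0 <= y)%N -> (y <= y')%N ->
       (y' < J.+1)%N -> U i y -> U i y') ->
    (forall y, (Y0 <= y < J.+1)%N ->
       `|\sum_(0 <= i < (2 * J).+1) (U i y)%:R - 2 * J%:R * A y|
         <= 2 * column_error t (c * t / 2) + 2) ->
    `|\sum_(Y0 <= y < J.+1) \sum_(0 <= i < (2 * J).+1) (U i y && phi i y)%:R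
       - \sum_(Y0 <= y < J.+1) 2 * J%:R * A y * fl (D / y%:R)|
    <= eps / 8 * J%:R ^+ 2.
  move=> h1 h2 h3 h4 h5 h6 h7.
  move: D Y0 e fa fl A U phi hDk hDY h1 h2 h3 h4 h5 h6 h7 {D0 D4}; near: J.
  exact: arc_asymptotics.
have hrange y := row_range hDk hDY D4 (y := y).
have hs y : (Y0 <= y < J.+1)%N -> 0 < D / y%:R < 1.
  move=> /hrange[h1 _ h3]; have y0 : 0 < y%:R :> R by exact: lt_trans h1.
  by rewrite divr_gt0 //= ltr_pdivrMr // mul1r.
pose z i y := depth t J i / y%:R.
have hdec i y y' : (i < (2 * J).+1)%N -> (Y0 <= y)%N -> (y <= y')%N ->
    (y' < J.+1)%N -> z i y' <= z i y.
  move=> hi h1 h2 h3.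
  have [p1 _ _] := hrange y (introT andP (conj h1 (leq_ltn_trans h2 h3))).
  have y0 : 0 < y%:R :> R by exact: lt_trans p1.
  have yy : y%:R <= y'%:R :> R by rewrite ler_nat.
  have /andP[hT _] := depth_bounds t0 JtJ hi.
  rewrite /z ler_wpM2l //; last by rewrite lef_pV2 // posrE (lt_le_trans y0).
  by apply: le_trans hT; rewrite mulr_ge0 ?exprn_ge0 // divr_ge0 // ltW.
pose U1 i y := 1 * z i y < 2 * J%:R - i%:R + 1.
pose U2 i y := 2 * z i y < 2 * J%:R - i%:R + 1.
pose V1 i y := 1 * z i y <= i%:R.
pose V2 i y := 2 * z i y <= i%:R.
have up1 i y y' : (i < (2 * J).+1)%N -> (Y0 <= y)%N -> (y <= y')%N ->
    (y' < J.+1)%N -> U1 i y -> U1 i y'.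
  move=> h1 h2 h3 h4; apply: le_lt_trans; rewrite ler_pM2l //; exact: hdec.
have up2 i y y' : (i < (2 * J).+1)%N -> (Y0 <= y)%N -> (y <= y')%N ->
    (y' < J.+1)%N -> U2 i y -> U2 i y'.
  move=> h1 h2 h3 h4; apply: le_lt_trans; rewrite ler_pM2l //; exact: hdec.
have down1 i y y' : (i < (2 * J).+1)%N -> (Y0 <= y)%N -> (y <= y')%N ->
    (y' < J.+1)%N -> V1 i y -> V1 i y'.
  move=> h1 h2 h3 h4; apply: le_trans; rewrite ler_pM2l //; exact: hdec.
have down2 i y y' : (i < (2 * J).+1)%N -> (Y0 <= y)%N -> (y <= y')%N ->
    (y' < J.+1)%N -> V2 i y -> V2 i y'.
  move=> h1 h2 h3 h4; apply: le_trans; rewrite ler_pM2l //; exact: hdec.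
have k1 : 0 <= (1 : R) <= 2 by rewrite ler01 ler1n.
have k2 : 0 <= (2 : R) <= 2 by rewrite ler0n lexx.
have e1 : `|1 : R| = 1 by rewrite normr1.
have em1 : `|-1 : R| = 1 by rewrite normrN normr1.
have lin1 (x s : R) : 0 <= x < 1 -> x < s -> 0 <= x <= 0 + s.
  by rewrite add0r => /andP[-> _] /ltW ->.
have lin2 (x s : R) : 0 < x < 0 + s -> x < s by rewrite add0r => /andP[].
have pt1 (x : R) : x = 0 -> 0 <= x <= 0 + 0 by move=> ->; rewrite addr0 lexx.
have pt2 (x : R) (b : bool) : 0 < x < 0 + 0 -> b.
  by rewrite addr0 => /andP[h /(lt_trans h)]; rewrite ltxx.
have A1 : `|\sum_(Y0 <= y < J.+1) \sum_(0 <= i < (2 * J).+1)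
      (U1 i y && (frac (z i y) < D / y%:R))%R%:R
    - \sum_(Y0 <= y < J.+1) 2 * J%:R * cover t 1 J y * (D / y%:R)|
    <= eps / 8 * J%:R ^+ 2.
  apply: (hterm 1 (fun=> 0) id) => //.
  - exact: linear_arc.
  - exact: linear_arc_lipschitz.
  - by move=> i y _; rewrite mul1r => h; apply: lin1; rewrite ?frac_bounds.
  - by move=> i y _; rewrite mul1r; exact: lin2.
  - by move=> y /hrange[_ h _]; apply: columns_up.
have B1 : `|\sum_(Y0 <= y < J.+1) \sum_(0 <= i < (2 * J).+1)
      (V1 i y && (frac (- z i y) < D / y%:R))%R%:R
    - \sum_(Y0 <= y < J.+1) 2 * J%:R * cover t 1 J y * (D / y%:R)|
    <= eps / 8 * J%:R ^+ 2.
  apply: (hterm (-1) (fun=> 0) id) => //.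
  - exact: linear_arc.
  - exact: linear_arc_lipschitz.
  - by move=> i y _; rewrite mulN1r => h; apply: lin1; rewrite ?frac_bounds.
  - by move=> i y _; rewrite mulN1r; exact: lin2.
  - by move=> y /hrange[_ h1 h2]; apply: columns_down.
have A2 : `|\sum_(Y0 <= y < J.+1) \sum_(0 <= i < (2 * J).+1)
      (U2 i y && (Num.max (D / y%:R) (1 / 2) <= frac (z i y)
                    < (1 + D / y%:R) / 2))%R%:R
    - \sum_(Y0 <= y < J.+1) 2 * J%:R * cover t 2 J y *
       Num.min (D / y%:R / 2) ((1 - D / y%:R) / 2)|
    <= eps / 8 * J%:R ^+ 2.
  apply: (hterm 1 (fun s => Num.max s (1 / 2))
     (fun s => Num.min (s / 2) ((1 - s) / 2))) => //.
  - move=> s hs1; have [m1 m2 m3] := middle_arc hs1; split=> //.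
    by rewrite m3 ler_pdivrMr // mul1r lerD2l ltW //; case/andP: hs1.
  - exact: middle_arc_lipschitz.
  - move=> i y hy /=; rewrite [1 * (_ / _)]mul1r => /andP[h1 h2].
    by have [_ _ ->] := middle_arc (hs _ hy); rewrite h1 ltW.
  - move=> i y hy /=; rewrite [1 * (_ / _)]mul1r; have [_ _ ->] := middle_arc (hs _ hy).
    by move=> /andP[/ltW h1 h2]; rewrite h1 h2.
  - by move=> y /hrange[_ h _]; apply: columns_up.
have B2 : `|\sum_(Y0 <= y < J.+1) \sum_(0 <= i < (2 * J).+1)
      (V2 i y && (Num.max (D / y%:R) (1 / 2) <= frac (- z i y)
                    < (1 + D / y%:R) / 2))%R%:R
    - \sum_(Y0 <= y < J.+1) 2 * J%:R * cover t 2 J y *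
       Num.min (D / y%:R / 2) ((1 - D / y%:R) / 2)|
    <= eps / 8 * J%:R ^+ 2.
  apply: (hterm (-1) (fun s => Num.max s (1 / 2))
     (fun s => Num.min (s / 2) ((1 - s) / 2))) => //.
  - move=> s hs1; have [m1 m2 m3] := middle_arc hs1; split=> //.
    by rewrite m3 ler_pdivrMr // mul1r lerD2l ltW //; case/andP: hs1.
  - exact: middle_arc_lipschitz.
  - move=> i y hy /=; rewrite mulN1r => /andP[h1 h2].
    by have [_ _ ->] := middle_arc (hs _ hy); rewrite h1 ltW.
  - move=> i y hy /=; rewrite mulN1r; have [_ _ ->] := middle_arc (hs _ hy).
    by move=> /andP[/ltW h1 h2]; rewrite h1 h2.
  - by move=> y /hrange[_ h1 h2]; apply: columns_down.
have both i y y' : (i < (2 * J).+1)%N -> (Y0 <= y)%N -> (y <= y')%N ->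
    (y' < J.+1)%N -> U1 i y && V1 i y -> U1 i y' && V1 i y'.
  move=> h1 h2 h3 h4 /andP[h5 h6]; apply/andP.
  by split; [exact: up1 h5|exact: down1 h6].
have C1 : `|\sum_(Y0 <= y < J.+1) \sum_(0 <= i < (2 * J).+1)
      ((U1 i y && V1 i y) && (frac (z i y) == 0))%R%:R
    - \sum_(Y0 <= y < J.+1) 2 * J%:R * cover t 2 J y * 0|
    <= eps / 8 * J%:R ^+ 2.
  apply: (hterm 1 (fun=> 0) (fun=> 0) _ (fun i y => U1 i y && V1 i y)) => //.
  - exact: point_arc_lipschitz.
  - by move=> i y _; rewrite mul1r => /eqP; exact: pt1.
  - by move=> i y _; exact: pt2.
  - by move=> y /hrange[_ h1 h2]; apply: columns_both.
have C2 : `|\sum_(Y0 <= y < J.+1) \sum_(0 <= i < (2 * J).+1)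
      ((U1 i y && V1 i y) && (1 - D / y%:R < frac (z i y) < D / y%:R))%R%:R
    - \sum_(Y0 <= y < J.+1) 2 * J%:R * cover t 2 J y *
         Num.max 0 (2 * (D / y%:R) - 1)|
    <= eps / 8 * J%:R ^+ 2.
  apply: (hterm 1 (fun s => 1 - s) (fun s => Num.max 0 (2 * s - 1)) _
     (fun i y => U1 i y && V1 i y)) => //.
  - exact: reflected_arc.
  - exact: reflected_arc_lipschitz.
  - by move=> i y hy; rewrite mul1r; exact: (reflected_arc_mem _ _).1.
  - by move=> i y hy; rewrite mul1r; exact: (reflected_arc_mem _ _).2.
  - by move=> y /hrange[_ h1 h2]; apply: columns_both.
have hN : `|\sum_(Y0 <= y < J.+1) \sum_(0 <= i < (2 * J).+1) (1 : R)
    - \sum_(Y0 <= y < J.+1) 2 * J%:R| <= eps / 8 * J%:R ^+ 2.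
  rewrite -sumrB.
  rewrite (eq_bigr (fun=> 1 : R)) => [|y _]; last first.
    by rewrite sumr_const_nat subn0 -[(2 * J).+1]addn1 natrD natrM; ring.
  rewrite sumr_const_nat ger0_norm //.
  apply: (@le_trans _ _ (J%:R + 1)).
    by rewrite natr1 ler_nat leq_subr.
  have h16 : 16 <= eps * J%:R by rewrite mulrC -ler_pdivrMr.
  have : 16 * J%:R <= eps * J%:R * J%:R by rewrite ler_pM2r.
  move: J1; rewrite expr2; clear; lra.
have hsum : \sum_(Y0 <= y < J.+1) \sum_(0 <= i < (2 * J).+1) (unhit t D J i y)%:R
  = \sum_(Y0 <= y < J.+1) \sum_(0 <= i < (2 * J).+1) (1 : R)
  - \sum_(Y0 <= y < J.+1) \sum_(0 <= i < (2 * J).+1)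
      (U1 i y && (frac (z i y) < D / y%:R))%R%:R
  - \sum_(Y0 <= y < J.+1) \sum_(0 <= i < (2 * J).+1)
      (U2 i y && (Num.max (D / y%:R) (1 / 2) <= frac (z i y)
                    < (1 + D / y%:R) / 2))%R%:R
  - \sum_(Y0 <= y < J.+1) \sum_(0 <= i < (2 * J).+1)
      (V1 i y && (frac (- z i y) < D / y%:R))%R%:R
  - \sum_(Y0 <= y < J.+1) \sum_(0 <= i < (2 * J).+1)
      (V2 i y && (Num.max (D / y%:R) (1 / 2) <= frac (- z i y)
                    < (1 + D / y%:R) / 2))%R%:R
  + \sum_(Y0 <= y < J.+1) \sum_(0 <= i < (2 * J).+1)
      ((U1 i y && V1 i y) && (frac (z i y) == 0))%R%:R
  + \sum_(Y0 <= y < J.+1) \sum_(0 <= i < (2 * J).+1)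
      ((U1 i y && V1 i y) && (1 - D / y%:R < frac (z i y) < D / y%:R))%R%:R.
  rewrite -!sumrB -!big_split /=; apply: eq_big_nat => y hy.
  rewrite -!sumrB -!big_split /=; apply: eq_big_nat => i hi.
  have [p1 /andP[_ p2] p3] := hrange _ hy.
  have y0 : 0 < y%:R :> R by exact: lt_trans p1.
  apply: unhit_indicator => //; first by rewrite -(ltr0n R).
    by rewrite D0 p1.
  rewrite mulrA ler_pdivlMr //.
  apply: (@le_trans _ _ ((2 * J%:R + 1) * J%:R)).
    by rewrite ler_wpM2l // addr_ge0 // mulr_ge0.
  have : 4 * J%:R <= (3 * t - 2) * J%:R * J%:R by rewrite ler_pM2r.
  have : 0 <= i%:R :> R by [].
  rewrite /depth expr2; clear; lra.
have hrow : \sum_(Y0 <= y < J.+1) 2 * J%:R * row_density t D J y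
  = \sum_(Y0 <= y < J.+1) 2 * J%:R
  - \sum_(Y0 <= y < J.+1) 2 * J%:R * cover t 1 J y * (D / y%:R)
  - \sum_(Y0 <= y < J.+1) 2 * J%:R * cover t 2 J y *
       Num.min (D / y%:R / 2) ((1 - D / y%:R) / 2)
  - \sum_(Y0 <= y < J.+1) 2 * J%:R * cover t 1 J y * (D / y%:R)
  - \sum_(Y0 <= y < J.+1) 2 * J%:R * cover t 2 J y *
       Num.min (D / y%:R / 2) ((1 - D / y%:R) / 2)
  + \sum_(Y0 <= y < J.+1) 2 * J%:R * cover t 2 J y * 0
  + \sum_(Y0 <= y < J.+1) 2 * J%:R * cover t 2 J y *
         Num.max 0 (2 * (D / y%:R) - 1).
  rewrite -!sumrB -!big_split /=; apply: eq_bigr => y _.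
  by rewrite /row_density; ring.
rewrite hsum hrow {hsum hrow}.
move: A1 A2 B1 B2 C1 C2 hN; clear.
move: (\sum_(_ <= _ < _) _) => a1; move: (\sum_(_ <= _ < _) _) => a1'.
move: (\sum_(_ <= _ < _) _) => a2; move: (\sum_(_ <= _ < _) _) => a2'.
move: (\sum_(_ <= _ < _) _) => b1; move: (\sum_(_ <= _ < _) _) => b2.
move: (\sum_(_ <= _ < _) _) => c1; move: (\sum_(_ <= _ < _) _) => c1'.
move: (\sum_(_ <= _ < _) _) => c2; move: (\sum_(_ <= _ < _) _) => c2'.
move: (\sum_(_ <= _ < _) _) => n1; move: (\sum_(_ <= _ < _) _) => n1'.
move: (J%:R ^+ 2) => q.
rewrite !ler_norml => h1 h2 h3 h4 h5 h6 h7; lra.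
Unshelve. all: by end_near.
Qed.

(** * Antiderivatives for the sum over the rows *)

(** An antiderivative in w of max 0 (1 - a/w) / w: the argument is frozen below
a, where the integrand vanishes. *)
Definition log_ramp (R : realType) (a w : R) : R :=
  ln (Num.max a w) + a / Num.max a w.

(** For b >= 2, an antiderivative in w of
max 0 (1 - 2/w) * max 0 (b/w - 1): the argument is frozen outside [2, b], where
the integrand vanishes. *)
Definition bump (R : realType) (b w : R) : R :=
  (b + 2) * ln (Num.min b (Num.max 2 w)) - Num.min b (Num.max 2 w)
  + 2 * b / Num.min b (Num.max 2 w).

Lemma ln_quadratic (R : realType) (u v : R) : 0 < u -> u <= v ->
  `|ln v - ln u - (v - u) / u| <= (v - u) ^+ 2 / u ^+ 2.
Proof.
move=> u0 uv; have v0 : 0 < v by lra.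
have ln1 (x : R) : 0 < x -> ln x <= x - 1.
  by move=> x0; have := @le_ln1Dx R (x - 1); rewrite addrCA subrr addr0; apply; lra.
have h1 : ln v - ln u <= v / u - 1.
  by rewrite -ln_div ?posrE //; apply: ln1; rewrite divr_gt0.
have h2 : ln u - ln v <= u / v - 1.
  by rewrite -ln_div ?posrE //; apply: ln1; rewrite divr_gt0.
have e1 : v / u - 1 = (v - u) / u by field; rewrite lt0r_neq0.
have e2 : 1 - u / v = (v - u) / v by field; rewrite lt0r_neq0.
have e3 : (v - u) / u - (v - u) / v <= (v - u) ^+ 2 / u ^+ 2.
  have -> : (v - u) / u - (v - u) / v = (v - u) ^+ 2 / (u * v).
    by field; rewrite !lt0r_neq0.
  rewrite ler_wpM2l ?exprn_ge0 ?subr_ge0 // lef_pV2 ?posrE ?mulr_gt0 //.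
  by rewrite expr2 ler_wpM2l // ltW.
have e4 : 0 <= (v - u) ^+ 2 / u ^+ 2 by rewrite divr_ge0 ?exprn_ge0 ?subr_ge0 // ltW.
rewrite ler_norml; lra.
Qed.

Lemma inv_quadratic (R : realType) (u v : R) : 0 < u -> u <= v ->
  v^-1 - u^-1 + (v - u) / u ^+ 2 = (v - u) ^+ 2 / (u ^+ 2 * v).
Proof. by move=> u0 uv; field; rewrite !lt0r_neq0 //; lra. Qed.

(** Second-order Taylor estimate. It survives the kink at a because the
integrand vanishes there: an interval containing a may be shortened to start at
a. *)
Lemma log_ramp_quadratic (R : realType) (a u v : R) : 0 < a -> 0 < u -> u <= v ->
  `|log_ramp a v - log_ramp a u - (v - u) * (Num.max 0 (1 - a / u) / u)|
    <= 2 / a ^+ 2 * (v - u) ^+ 2.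
Proof.
move=> a0.
have main (x y : R) : a <= x -> x <= y ->
    `|ln y + a / y - (ln x + a / x) - (y - x) * ((1 - a / x) / x)|
      <= 2 / a ^+ 2 * (y - x) ^+ 2.
  move=> ax xy; have x0 : 0 < x by lra.
  have y0 : 0 < y by lra.
  have h1 := ln_quadratic x0 xy; have h2 := inv_quadratic x0 xy.
  have -> : ln y + a / y - (ln x + a / x) - (y - x) * ((1 - a / x) / x) =
     (ln y - ln x - (y - x) / x) + a * (y^-1 - x^-1 + (y - x) / x ^+ 2).
    by field; rewrite !lt0r_neq0.
  apply: le_trans (ler_normD _ _) _; rewrite h2.
  have q0 : 0 <= (y - x) ^+ 2 / x ^+ 2 by rewrite divr_ge0 ?exprn_ge0 ?subr_ge0 // ltW.
  have h3 : (y - x) ^+ 2 / x ^+ 2 <= (y - x) ^+ 2 / a ^+ 2.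
    rewrite ler_wpM2l ?exprn_ge0 ?subr_ge0 // lef_pV2 ?posrE ?exprn_gt0 //.
    by rewrite lerXn2r ?nnegrE // ltW.
  have h4 : `|a * ((y - x) ^+ 2 / (x ^+ 2 * y))| <= (y - x) ^+ 2 / x ^+ 2.
    have -> : a * ((y - x) ^+ 2 / (x ^+ 2 * y)) = (a / y) * ((y - x) ^+ 2 / x ^+ 2).
      by field; rewrite !lt0r_neq0.
    rewrite ger0_norm; last by rewrite mulr_ge0 // divr_ge0 // ltW.
    by rewrite ler_piMl // ler_pdivrMr // mul1r; lra.
  have -> : 2 / a ^+ 2 * (y - x) ^+ 2 =
     (y - x) ^+ 2 / a ^+ 2 + (y - x) ^+ 2 / a ^+ 2 by ring.
  by apply: lerD; [exact: le_trans h3|exact: le_trans h3].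
move=> u0 uv; rewrite /log_ramp.
case: (lerP a u) => au.
  rewrite (max_r (le_trans au uv)) max_r; last first.
    by rewrite subr_ge0 ler_pdivrMr // mul1r.
  exact: main.
rewrite (@max_l _ _ 0); last by rewrite subr_le0 ler_pdivlMr // mul1r ltW.
rewrite mul0r mulr0 subr0.
case: (lerP v a) => av.
  by rewrite subrr normr0 mulr_ge0 ?exprn_ge0 ?subr_ge0 // divr_ge0 // ?exprn_ge0 // ltW.
have := main a v (lexx _) (ltW av).
rewrite divff ?lt0r_neq0 // subrr mul0r mulr0 subr0 => h; apply: le_trans h _.
rewrite ler_wpM2l ?divr_ge0 ?exprn_ge0 // ?(ltW a0) //.
by rewrite lerXn2r ?nnegrE ?subr_ge0 // ?(ltW av) //; lra.
Qed.

(** The same estimate with two kinks; when u < b < v, the integrand at u is at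
most (b - u) / 2, which is absorbed by the quadratic error. *)
Lemma bump_quadratic (R : realType) (b u v : R) : 2 <= b -> 0 < u -> u <= v ->
  `|bump b v - bump b u
     - (v - u) * (Num.max 0 (1 - 2 / u) * Num.max 0 (b / u - 1))|
    <= (b + 2) * (v - u) ^+ 2.
Proof.
move=> b2.
pose G (w : R) := (b + 2) * ln w - w + 2 * b / w.
have main (x y : R) : 2 <= x -> x <= y ->
    `|G y - G x - (y - x) * ((1 - 2 / x) * (b / x - 1))|
      <= (b + 1) * (y - x) ^+ 2.
  move=> ax xy; have x0 : 0 < x by lra.
  have y0 : 0 < y by lra.
  have h1 := ln_quadratic x0 xy; have h2 := inv_quadratic x0 xy.
  have -> : G y - G x - (y - x) * ((1 - 2 / x) * (b / x - 1)) =
     (b + 2) * (ln y - ln x - (y - x) / x)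
       + 2 * b * (y^-1 - x^-1 + (y - x) / x ^+ 2).
    by rewrite /G; field; rewrite !lt0r_neq0.
  apply: le_trans (ler_normD _ _) _; rewrite h2.
  have q0 : 0 <= (y - x) ^+ 2 by rewrite exprn_ge0 ?subr_ge0.
  have h3 : (y - x) ^+ 2 / x ^+ 2 <= (y - x) ^+ 2 / 4.
    rewrite ler_wpM2l // lef_pV2 ?posrE ?exprn_gt0 // expr2; nra.
  have h4 : `|(y - x) ^+ 2 / (x ^+ 2 * y)| <= (y - x) ^+ 2 / 8.
    rewrite ger0_norm; last by rewrite divr_ge0 // mulr_ge0 ?exprn_ge0 // ltW.
    rewrite ler_wpM2l // lef_pV2 ?posrE ?mulr_gt0 ?exprn_gt0 // expr2; nra.
  rewrite (normrM (b + 2)) (normrM (2 * b)).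
  rewrite (ger0_norm (_ : 0 <= b + 2)) ?(ger0_norm (_ : 0 <= 2 * b)); try lra.
  have h5 : (b + 2) * `|ln y - ln x - (y - x) / x| <= (b + 2) * ((y - x) ^+ 2 / 4).
    by rewrite ler_wpM2l //; [lra|exact: le_trans h3].
  have h6 : 2 * b * `|(y - x) ^+ 2 / (x ^+ 2 * y)| <= 2 * b * ((y - x) ^+ 2 / 8).
    by rewrite ler_wpM2l //; lra.
  have : 0 <= b * (y - x) ^+ 2 by rewrite mulr_ge0 //; lra.
  lra.
have gb (x : R) : 2 <= x <= b -> 0 <= (1 - 2 / x) * (b / x - 1) <= (b - x) / 2.
  move=> /andP[x2 xb]; have x0 : 0 < x by lra.
  have i1 : 0 <= 1 - 2 / x <= 1.
    by rewrite subr_ge0 ler_pdivrMr // mul1r x2 /= gerBl divr_ge0 // ltW.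
  have i2 : 0 <= b / x - 1 <= (b - x) / 2.
    rewrite subr_ge0 ler_pdivlMr // mul1r xb /=.
    have -> : b / x - 1 = (b - x) / x by field; rewrite lt0r_neq0.
    by rewrite ler_wpM2l ?subr_ge0 // lef_pV2 ?posrE.
  nra.
have E w : bump b w = G (Num.min b (Num.max 2 w)) by [].
move=> u0 uv; rewrite !E; have v0 : 0 < v by lra.
have d0 : 0 <= (v - u) ^+ 2 by rewrite exprn_ge0 ?subr_ge0.
have b1 : (b + 1) * (v - u) ^+ 2 <= (b + 2) * (v - u) ^+ 2.
  by rewrite ler_wpM2r // lerD2l; lra.
have b0 : 0 <= (b + 2) * (v - u) ^+ 2 by rewrite mulr_ge0 //; lra.
case: (lerP u 2) => u2.
  rewrite (@max_l _ _ 0); last by rewrite subr_le0 ler_pdivlMr // mul1r.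
  rewrite (min_r b2) mul0r mulr0 subr0.
  case: (lerP v 2) => v2; first by rewrite (min_r b2) subrr normr0.
  have m2 : 2 <= Num.min b v by rewrite le_min b2 ltW.
  have := main 2 _ (lexx _) m2.
  rewrite divff // subrr mul0r mulr0 subr0 => h; apply: le_trans h _.
  apply: le_trans b1; rewrite ler_wpM2l //; first by lra.
  have mv : Num.min b v <= v by rewrite ge_min lexx orbT.
  by rewrite lerXn2r ?nnegrE ?subr_ge0 //; lra.
rewrite (max_r (le_trans (ltW u2) uv)).
case: (lerP b u) => bu.
  rewrite (min_l (le_trans bu uv)) (@max_l _ _ 0 (b / u - 1)); last first.
    by rewrite subr_le0 ler_pdivrMr // mul1r.
  by rewrite mulr0 mulr0 !subrr normr0.
rewrite (@max_r _ _ 0 (1 - 2 / u)); last by rewrite subr_ge0 ler_pdivrMr // mul1r ltW.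
rewrite (@max_r _ _ 0 (b / u - 1)); last by rewrite subr_ge0 ler_pdivlMr // mul1r ltW.
case: (lerP v b) => vb.
  apply: le_trans b1; apply: main => //; exact: ltW.
have hg := gb u; rewrite (ltW u2) (ltW bu) in hg; have {}hg := hg isT.
have hm := main u b (ltW u2) (ltW bu).
move: hg hm; set g := (1 - 2 / u) * _; rewrite !ler_norml => hg hm.
have h1 : (v - u) ^+ 2 = (b - u) ^+ 2 + 2 * ((v - b) * (b - u)) + (v - b) ^+ 2 by ring.
have h2 : 0 <= (v - b) * g <= (v - b) * ((b - u) / 2).
  by rewrite mulr_ge0 ?ler_wpM2l ?subr_ge0 ?(ltW vb) //; case/andP: hg.
have h3 : 0 <= (v - b) * (b - u) by rewrite mulr_ge0 // subr_ge0 ltW.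
have h4 : 0 <= (b - u) ^+ 2 by rewrite exprn_ge0 // subr_ge0 ltW.
have h5 : 0 <= (v - b) ^+ 2 by rewrite exprn_ge0 // subr_ge0 ltW.
have h6 : (v - u) * g = (b - u) * g + (v - b) * g by ring.
have h7 : (b + 2) * (v - u) ^+ 2 = (b + 1) * (b - u) ^+ 2 + (b - u) ^+ 2 +
   (2 * b + 4) * ((v - b) * (b - u)) + (b + 2) * (v - b) ^+ 2 by rewrite h1; ring.
have h8 : 0 <= b * ((v - b) * (b - u)) by rewrite mulr_ge0 //; lra.
have h9 : 0 <= (b + 2) * (v - b) ^+ 2 by rewrite mulr_ge0 //; lra.
rewrite h6 h7; lra.
Qed.

(** * The sum over the rows as a Riemann sum *)

(** An antiderivative in w of gap_profile c. *)
Definition gap_potential (R : realType) (c w : R) : R :=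
  w - 2 * c * log_ramp 1 w - c * log_ramp 2 w + 2 * bump (2 * Num.max 1 c) w.

(** row_density in the variable w = 2 y / (t J), the number of row spacings
covered by row y. *)
Definition gap_profile (R : realType) (c w : R) : R :=
  let s := c / w in
  1 - 2 * s * Num.max 0 (1 - 1 / w)
    - 2 * Num.min (s / 2) ((1 - s) / 2) * Num.max 0 (1 - 2 / w)
    + Num.max 0 (2 * s - 1) * Num.max 0 (1 - 2 / w).

(** Limiting proportion of the normalized gaps that are at least c: the integral
of gap_profile c over c <= w <= 2 / t, with y / J = (t / 2) w. The maximum makes
it vanish beyond c = 2 / t. *)
Definition gap_tail (R : realType) (t c : R) : R :=
  t / 2 * (gap_potential c (Num.max c (2 / t)) - gap_potential c c).

(** min (s, 1 - s) = s - max 0 (2 s - 1) splits the profile into the integrands of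
log_ramp and bump. Replacing c by max 1 c in the last one changes nothing, as
both versions vanish for c <= 1 and w >= 2. *)
Lemma gap_profileE (R : realType) (c w : R) : 0 < c -> 0 < w ->
  gap_profile c w = 1 - 2 * c * (Num.max 0 (1 - 1 / w) / w)
    - c * (Num.max 0 (1 - 2 / w) / w)
    + 2 * (Num.max 0 (1 - 2 / w) * Num.max 0 (2 * Num.max 1 c / w - 1)).
Proof.
move=> c0 w0; rewrite /gap_profile.
have -> : 2 * Num.min (c / w / 2) ((1 - c / w) / 2) =
    c / w - Num.max 0 (2 * (c / w) - 1).
  by rewrite minEle maxEle; case: ifP => ?; case: ifP => ?; lra.
have -> : Num.max 0 (1 - 2 / w) * Num.max 0 (2 * Num.max 1 c / w - 1) =
    Num.max 0 (1 - 2 / w) * Num.max 0 (2 * (c / w) - 1).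
  case: (lerP w 2) => w2.
    by rewrite max_l ?mul0r // subr_le0 ler_pdivlMr // mul1r.
  congr (_ * _); case: (lerP 1 c) => c1; first by rewrite mulrA.
  have l1 : 2 * 1 / w - 1 <= 0 by rewrite subr_le0 ler_pdivrMr //; lra.
  have l2 : 2 * (c / w) - 1 <= 0 by rewrite subr_le0 mulrA ler_pdivrMr //; lra.
  by rewrite (max_l l1) (max_l l2).
ring.
Qed.

Definition potential_error (R : realType) (c : R) : R :=
  9 / 2 * c + 2 * (2 * Num.max 1 c + 2).

Lemma gap_potential_quadratic (R : realType) (c u v : R) :
  0 < c -> 0 < u -> u <= v ->
  `|gap_potential c v - gap_potential c u - (v - u) * gap_profile c u|
    <= potential_error c * (v - u) ^+ 2.
Proof.
move=> c0 u0 uv; rewrite gap_profileE // /gap_potential /potential_error.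
have c1 : 1 <= Num.max 1 c by rewrite le_max lexx.
have b2 : 2 <= 2 * Num.max 1 c by lra.
have := log_ramp_quadratic (@ltr01 R) u0 uv.
have := log_ramp_quadratic (ltr0n _ 2 : 0 < 2 :> R) u0 uv.
have := bump_quadratic b2 u0 uv.
move: (Num.max 1 c) c1 {b2} => b _.
move: (bump _ v) (bump _ u) (log_ramp 1 v) (log_ramp 1 u) (log_ramp 2 v)
  (log_ramp 2 u) => x1 x2 y1 y2 z1 z2.
move: (Num.max 0 (1 - 1 / u) / u) (Num.max 0 (1 - 2 / u) / u) => g1 g2.
move: (_ * Num.max 0 (_ - 1)) => g3.
have e1 : 2 / 1 ^+ 2 = 2 :> R by rewrite expr1n divr1.
have e2 : 2 / 2 ^+ 2 = 1 / 2 :> R by rewrite expr2; field.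
rewrite e1 e2; move: ((v - u) ^+ 2) => q h3 h2 h1.
have k1 : `|2 * c * (y1 - y2 - (v - u) * g1)| <= 2 * c * (2 * q).
  by rewrite normrM ger0_norm ?ler_wpM2l //; lra.
have k2 : `|c * (z1 - z2 - (v - u) * g2)| <= c * (1 / 2 * q).
  by rewrite normrM ger0_norm ?ler_wpM2l //; lra.
move: k1 k2 h3; rewrite !ler_norml => k1 k2 h3; lra.
Qed.

Lemma riemann_sum_potential (R : realType) (c h : R) (Y0 Y1 : nat) :
  0 < c -> 0 < h -> (0 < Y0)%N -> (Y0 <= Y1)%N ->
  `|\sum_(Y0 <= y < Y1) h * gap_profile c (y%:R * h)
     - (gap_potential c (Y1%:R * h) - gap_potential c (Y0%:R * h))|
    <= Y1%:R * (potential_error c * h ^+ 2).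
Proof.
move=> c0 h0 y0 yy.
rewrite -(telescope_sumr (fun y => gap_potential c (y%:R * h))) // -sumrB.
apply: le_trans (ler_norm_sum _ _ _) _.
have pe : 0 <= potential_error c.
  have : 1 <= Num.max 1 c by rewrite le_max lexx.
  by rewrite /potential_error; lra.
apply: (@le_trans _ _ (\sum_(Y0 <= y < Y1) potential_error c * h ^+ 2)).
  rewrite [leLHS]big_nat [leRHS]big_nat; apply: ler_sum => y /andP[hy _].
  have yr : 0 < y%:R :> R by rewrite ltr0n (leq_trans y0).
  have hu : 0 < y%:R * h by rewrite mulr_gt0.
  have huv : y%:R * h <= y.+1%:R * h by rewrite ler_pM2r // ler_nat.
  have := gap_potential_quadratic c0 hu huv.
  have -> : y.+1%:R * h - y%:R * h = h by rewrite -natr1; ring.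
  by rewrite distrC.
rewrite sumr_const_nat [leRHS]mulr_natl ler_wpMn2l ?leq_subr //.
by rewrite mulr_ge0 // exprn_ge0 // ltW.
Qed.

Lemma row_densityE (R : realType) (t c : R) (J y : nat) :
  0 < t -> 0 < J%:R :> R -> 0 < y%:R :> R ->
  row_density t (c * t / 2 * J%:R) J y =
    gap_profile c (y%:R * (2 / (t * J%:R))).
Proof.
move=> t0 J0 y0; rewrite /row_density /gap_profile /cover.
have -> : c * t / 2 * J%:R / y%:R = c / (y%:R * (2 / (t * J%:R))).
  by field; rewrite !lt0r_neq0.
have e k : k * t * J%:R / (2 * y%:R) = k / (y%:R * (2 / (t * J%:R))).
  by field; rewrite !lt0r_neq0.
by rewrite !e.
Qed.

(** Rows correspond to steps 2 / (t J) in the variable w, starting at w = c and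
ending at w = 2 / t; for c >= 2 / t there is no row at all. *)
Lemma row_sum_asymptotics (R : realType) (t c eps : R) :
  0 < t -> 0 < c -> 0 < eps ->
  \forall J \near \oo, forall (D : R) (Y0 : nat),
    D = c * t / 2 * J%:R -> D < Y0%:R -> Y0%:R <= D + 1 ->
    `|\sum_(Y0 <= y < J.+1) row_density t D J y - J%:R * gap_tail t c|
      <= eps * J%:R.
Proof.
move=> t0 c0 e0.
pose W := 2 / t; have W0 : 0 < W by rewrite divr_gt0.
pose B := `|gap_profile c W| + `|gap_profile c c|.
pose C := potential_error c.
have C0 : 0 <= C.
  have : 1 <= Num.max 1 c by rewrite le_max lexx.
  by rewrite /C /potential_error; lra.
near=> J => D Y0 hD hDY hYD.
have J1 : 1 <= J%:R :> R by near: J; apply: nbhs_infty_ger.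
have JB : (4 * C * W + B) / eps <= J%:R by near: J; apply: nbhs_infty_ger.
have J0 : 0 < J%:R :> R by exact: lt_le_trans J1.
have D0 : 0 < D by rewrite hD !mulr_gt0.
have {}JB : 4 * C * W + B <= eps * J%:R by rewrite [eps * _]mulrC -ler_pdivrMr.
case: (lerP W c) => Wc.
  have hJ : J%:R <= D.
    rewrite hD ler_peMl ?(ltW J0) //.
    by move: Wc; rewrite /W ler_pdivrMr // => ?; lra.
  have hYJ : (J.+1 <= Y0)%N by rewrite -(ltr_nat R); exact: le_lt_trans hDY.
  rewrite big_geq // /gap_tail (max_l Wc) subrr !mulr0 subrr normr0.
  by rewrite mulr_ge0 // ltW.
pose h := 2 / (t * J%:R).
have h0 : 0 < h by rewrite divr_gt0 // mulr_gt0.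
have Jh : J%:R * h = W by rewrite /h /W; field; rewrite !lt0r_neq0.
have hW : h <= W by rewrite -Jh ler_peMl // ltW.
have hDh : D * h = c by rewrite hD /h; field; rewrite !lt0r_neq0.
have DJ : D < J%:R by rewrite -(ltr_pM2r h0) hDh Jh.
have YJ : (Y0 <= J.+1)%N.
  by rewrite -(ler_nat R) -natr1; apply: le_trans hYD _; rewrite lerD2r ltW.
have Y00 : (0 < Y0)%N by rewrite -(ltr0n R); exact: lt_trans hDY.
have hrs := riemann_sum_potential c0 h0 Y00 YJ.
have htop : `|gap_potential c (J.+1%:R * h) - gap_potential c W|
    <= h * `|gap_profile c W| + C * h ^+ 2.
  have le1 : W <= J.+1%:R * h by rewrite -Jh ler_pM2r // ler_nat.
  have := gap_potential_quadratic c0 W0 le1.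
  have -> : J.+1%:R * h - W = h by rewrite -Jh -natr1; ring.
  set g := gap_potential c _ - _ => hq.
  have -> : g = (g - h * gap_profile c W) + h * gap_profile c W by ring.
  apply: le_trans (ler_normD _ _) _; rewrite addrC lerD //.
  by rewrite normrM gtr0_norm.
have hbot : `|gap_potential c (Y0%:R * h) - gap_potential c c|
    <= h * `|gap_profile c c| + C * h ^+ 2.
  have le1 : c <= Y0%:R * h by rewrite -hDh ler_pM2r // ltW.
  have := gap_potential_quadratic c0 c0 le1.
  set d := Y0%:R * h - c.
  have d0 : 0 <= d <= h.
    rewrite /d -hDh -mulrBl mulr_ge0 ?subr_ge0 ?(ltW hDY) ?(ltW h0) //=.
    by rewrite ler_piMl ?(ltW h0) // lerBlDl.
  have [d1 d2] := andP d0.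
  set g := gap_potential c _ - _ => hq.
  have -> : g = (g - d * gap_profile c c) + d * gap_profile c c by ring.
  apply: le_trans (ler_normD _ _) _; rewrite addrC lerD //.
    by rewrite normrM ger0_norm // ler_wpM2r.
  by apply: le_trans hq _; rewrite ler_wpM2l // lerXn2r ?nnegrE // ltW.
have hrow : \sum_(Y0 <= y < J.+1) row_density t D J y =
    h^-1 * \sum_(Y0 <= y < J.+1) h * gap_profile c (y%:R * h).
  rewrite mulr_sumr; apply: eq_big_nat => y /andP[hy _].
  rewrite mulrA mulVf ?lt0r_neq0 // mul1r hD row_densityE //.
  by rewrite ltr0n (leq_trans Y00).
have htail : J%:R * gap_tail t c = h^-1 * (gap_potential c W - gap_potential c c).
  by rewrite /gap_tail (max_r (ltW Wc)) /h -/W; field; rewrite !lt0r_neq0.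
rewrite hrow htail -mulrBr normrM gtr0_norm ?invr_gt0 //.
rewrite mulrC ler_pdivrMr //.
have hall : `|\sum_(Y0 <= y < J.+1) h * gap_profile c (y%:R * h)
     - (gap_potential c W - gap_potential c c)|
   <= J.+1%:R * (C * h ^+ 2) + (h * B + 2 * (C * h ^+ 2)).
  have -> : h * B = h * `|gap_profile c W| + h * `|gap_profile c c|.
    by rewrite /B; ring.
  move: hrs htop hbot; rewrite -/C.
  move: (\sum_(_ <= _ < _) _) (gap_potential c (J.+1%:R * h)) (gap_potential c W)
    (gap_potential c (Y0%:R * h)) (gap_potential c c) => S p1 p2 p3 p4.
  by clear; rewrite !ler_norml; lra.
apply: le_trans hall _.
have -> : J.+1%:R * (C * h ^+ 2) + (h * B + 2 * (C * h ^+ 2)) =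
   (C * (J%:R * h + 3 * h) + B) * h by rewrite -natr1; ring.
rewrite ler_pM2r // Jh; apply: le_trans JB; rewrite lerD2r.
have -> : 4 * C * W = C * (4 * W) by ring.
rewrite ler_wpM2l //; lra.
Unshelve. all: by end_near.
Qed.

Lemma unhit_count_asymptotics (R : realType) (t c eps : R) :
  2 / 3 < t -> 0 < c -> 0 < eps ->
  \forall J \near \oo, forall (D : R) (Y0 : nat),
    D = c * t / 2 * J%:R -> D < Y0%:R -> Y0%:R <= D + 1 ->
    `|\sum_(Y0 <= y < J.+1) \sum_(0 <= i < (2 * J).+1) (unhit t D J i y)%:R
      - 2 * J%:R ^+ 2 * gap_tail t c| <= eps * J%:R ^+ 2.
Proof.
move=> t23 c0 e0; have t0 : 0 < t by lra.
have e4 : 0 < eps / 4 by lra.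
near=> J => D Y0 hD hDY hYD.
have h1 : `|\sum_(Y0 <= y < J.+1) \sum_(0 <= i < (2 * J).+1) (unhit t D J i y)%:R
      - \sum_(Y0 <= y < J.+1) 2 * J%:R * row_density t D J y|
    <= eps / 4 * J%:R ^+ 2.
  by move: D Y0 hD hDY {hYD}; near: J; exact: unhit_asymptotics.
have h2 : `|\sum_(Y0 <= y < J.+1) row_density t D J y - J%:R * gap_tail t c|
      <= eps / 4 * J%:R.
  by move: D Y0 hD hDY hYD {h1}; near: J; exact: row_sum_asymptotics.
rewrite -mulr_sumr in h1.
have h3 : `|2 * J%:R * \sum_(Y0 <= y < J.+1) row_density t D J y
    - 2 * J%:R ^+ 2 * gap_tail t c| <= 2 * J%:R * (eps / 4 * J%:R).
  have -> : 2 * J%:R ^+ 2 * gap_tail t c = 2 * J%:R * (J%:R * gap_tail t c) by ring.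
  by rewrite -mulrBr normrM ger0_norm ?ler_wpM2l // mulr_ge0.
have J2 : 0 <= eps * J%:R ^+ 2 by rewrite mulr_ge0 ?exprn_ge0 // ltW.
have e : 2 * J%:R * (eps / 4 * J%:R) = eps / 2 * J%:R ^+ 2 by field.
rewrite e in h3; move: h1 h3; rewrite !ler_norml.
move: (\sum_(_ <= _ < _) \sum_(_ <= _ < _) _) (2 * _ * \sum_(_ <= _ < _) _).
move=> X1 X2; move: J2; move: (J%:R ^+ 2) => q; clear; lra.
Unshelve. all: by end_near.
Qed.

(** * Gaps of a sorted sequence *)

Definition gaps_ge (R : realType) (d : R) (s : seq R) : nat :=
  count (fun j => d <= nth 0 s j.+1 - nth 0 s j) (iota 0 (size s).-1).

Definition crowd (R : realType) (d : R) (s : seq R) (v : R) : nat :=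
  count (fun u => v <= u < v + d) s.

Definition crowded (R : realType) (d : R) (s : seq R) (v : R) : bool :=
  has (fun u => v < u < v + d) s.

Lemma count_nth (R : realType) (P : pred R) (s : seq R) :
  count P s = count (fun j => P (nth 0 s j)) (iota 0 (size s)).
Proof. by rewrite -[in LHS](mkseq_nth 0 s) /mkseq count_map. Qed.

Lemma sub_in_count (T : eqType) (P Q : pred T) (s : seq T) :
  {in s, forall x, P x -> Q x} -> (count P s <= count Q s)%N.
Proof.
move=> h; rewrite (@eq_in_count _ _ (predI P Q)); last first.
  by move=> x /h /=; case: (P x) => // ->.
by apply: sub_count => x /andP[].
Qed.

(** A value that is alone in [v, v + d) is followed by a gap of length at least
d, unless it is the last one. *)
Lemma lone_le_gaps (R : realType) (d : R) (s : seq R) :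
  0 < d -> sorted <=%R s ->
  (count (fun v => (crowd d s v <= 1)%N) s <= gaps_ge d s + 1)%N.
Proof.
move=> d0 hsort; rewrite count_nth /gaps_ge.
case hs: (size s) => [|n]; first by [].
rewrite -[X in (count _ (iota 0 X) <= _)%N]addn1 [n.+1.-1]/= iotaD count_cat add0n.
apply: leq_add; last by rewrite /= addn0 leq_b1.
apply: sub_in_count => j; rewrite mem_iota add0n => /andP[_ jn] h.
rewrite leNgt; apply/negP => hd; move: h; apply/negP; rewrite -ltnNge.
have js : (j < size s)%N by rewrite hs ltnS ltnW.
have js1 : (j.+1 < size s)%N by rewrite hs ltnS.
rewrite /crowd -[X in (_ < count _ X)%N](cat_take_drop j s) count_cat (drop_nth 0 js) (drop_nth 0 js1) /=.
have hle : nth 0 s j <= nth 0 s j.+1.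
  by apply: (sorted_leq_nth le_trans le_refl 0 hsort) => //; rewrite inE.
have -> : nth 0 s j <= nth 0 s j < nth 0 s j + d by rewrite lexx ltrDl.
have -> : nth 0 s j <= nth 0 s j.+1 < nth 0 s j + d by rewrite hle -ltrBlDl.
by apply: leq_trans (leq_addl _ _).
Qed.

Lemma gaps_le_uncrowded (R : realType) (d : R) (s : seq R) :
  sorted <=%R s ->
  (gaps_ge d s <= count (fun v => ~~ crowded d s v) s)%N.
Proof.
move=> hs; rewrite [leqRHS]count_nth /gaps_ge.
case hn: (size s) => [|n]; first by [].
rewrite -[X in (_ <= count _ (iota 0 X))%N]addn1 [n.+1.-1]/= iotaD count_cat; apply: leq_trans (leq_addr _ _).
apply: sub_in_count => j; rewrite mem_iota add0n => /andP[_ jn] hd.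
apply/hasPn => u /(nthP 0)[i hi <-]; apply/negP => /andP[h1 h2].
case: (leqP i j) => ij.
  have : nth 0 s i <= nth 0 s j.
    by apply: (sorted_leq_nth le_trans le_refl 0 hs) => //; rewrite inE hn ltnS ltnW.
  lra.
have : nth 0 s j.+1 <= nth 0 s i.
  by apply: (sorted_leq_nth le_trans le_refl 0 hs) => //; rewrite inE hn ltnS.
lra.
Qed.

(** * The angles *)

Definition angle (R : realType) (t : R) (J i y : nat) : R :=
  atan (y%:R / depth t J i).

Definition angles (R : realType) (t : R) (J : nat) : seq R :=
  [seq vertex_angle (point_of R p) (observer t J) (0, 0) | p <- lattice_box J].

(** The quotient in the definition of the angle is T / sqrt (T^2 + y^2), which is
the cosine of atan (y / T). *)
Lemma vertex_angle_atan (R : realType) (b x y : R) :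
  0 < b -> 0 < x + b -> 0 <= y ->
  vertex_angle (x, y) (- b, 0) (0, 0) = atan (y / (x + b)).
Proof.
move=> b0 xb0 y0; rewrite /vertex_angle /enorm2 /dot2 /=.
rewrite !opprK !subr0 !add0r !mulr0 !addr0 -!expr2.
set T := x + b in xb0 *; rewrite sqrtr_sqr gtr0_norm //.
have -> : T * b / (Num.sqrt (T ^+ 2 + y ^+ 2) * b) = cos (atan (y / T)).
  rewrite cos_atan.
  have -> : T ^+ 2 + y ^+ 2 = T ^+ 2 * (1 + (y / T) ^+ 2).
    by field; rewrite lt0r_neq0.
  rewrite sqrtrM ?exprn_ge0 ?(ltW xb0) // sqrtr_sqr gtr0_norm //.
  have s0 : 0 < Num.sqrt (1 + (y / T) ^+ 2).
    by rewrite sqrtr_gt0 ltr_wpDr // exprn_ge0 // divr_ge0 // ltW.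
  by field; rewrite !lt0r_neq0.
rewrite cosK // in_itv /=; apply/andP; split.
  by rewrite -(@atan0 R) le_atan // divr_ge0 // ltW.
have := @atan_ltpi2 R (y / T); have := @pi_gt0 R; lra.
Qed.

Lemma anglesE (R : realType) (t : R) (J : nat) :
  0 < t -> 1 < t * J%:R ->
  angles t J = [seq angle t J i y | i <- iota 0 (2 * J).+1, y <- iota 0 J.+1].
Proof.
move=> t0 tJ; have J0 : 0 < J%:R :> R.
  by rewrite -(pmulr_rgt0 _ t0) (lt_trans _ tJ).
have tJ2 : J%:R < t * J%:R ^+ 2 by rewrite expr2 mulrA ltr_pMl.
rewrite /angles /lattice_box map_allpairs; apply: eq_allpairs => i y.
rewrite /point_of /observer /= intrB -!pmulrn.
have i0 : 0 <= i%:R :> R by [].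
rewrite vertex_angle_atan //; last by lra.
- by rewrite /angle /depth addrC.
- exact: lt_trans tJ2.
Qed.

Lemma count_angles (R : realType) (t : R) (J : nat) (P : pred R) :
  0 < t -> 1 < t * J%:R ->
  (count P (angles t J))%:R =
  \sum_(0 <= y < J.+1) \sum_(0 <= i < (2 * J).+1) (P (angle t J i y))%:R :> R.
Proof.
move=> t0 tJ; rewrite anglesE //.
have hc (s : seq R) : (count P s)%:R = \sum_(v <- s) (P v)%:R :> R.
  rewrite -natr_sum -sum1_count; congr (_%:R); rewrite [LHS]big_mkcond /=.
  by apply: eq_bigr => v _; case: (P v).
by rewrite hc big_allpairs_dep exchange_big.
Qed.

Lemma sorted_sorted_angles (R : realType) (t : R) (J : nat) :
  sorted <=%R (sorted_angles t J).
Proof. exact: (sort_sorted le_total). Qed.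

Lemma count_sorted_angles (R : realType) (t : R) (J : nat) (P : pred R) :
  count P (sorted_angles t J) = count P (angles t J).
Proof. by apply: (permP _ P); rewrite perm_sort. Qed.

Lemma size_sorted_angles (R : realType) (t : R) (J : nat) :
  size (sorted_angles t J) = box_card J.
Proof. by rewrite size_sort size_map size_lattice_box. Qed.

Lemma depth_gt0 (R : realType) (t : R) (J i : nat) :
  0 < t -> 1 < t * J%:R -> 0 < depth t J i.
Proof.
move=> t0 tJ; have J0 : 0 < J%:R :> R.
  by rewrite -(pmulr_rgt0 _ t0) (lt_trans _ tJ).
have tJ2 : J%:R < t * J%:R ^+ 2 by rewrite expr2 mulrA ltr_pMl.
have i0 : 0 <= i%:R :> R by [].
rewrite /depth; lra.
Qed.

Lemma angle_le_max (R : realType) (t : R) (J i y : nat) :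
  0 < t -> 1 < t * J%:R -> (y <= J)%N -> angle t J i y <= angle t J 0 J.
Proof.
move=> t0 tJ yJ; have d0 := depth_gt0 0 t0 tJ; have di := depth_gt0 i t0 tJ.
rewrite /angle le_atan //.
apply: (@le_trans _ _ (y%:R / depth t J 0)).
  by rewrite ler_wpM2l // lef_pV2 ?posrE // /depth lerD2l lerD2r ler_nat.
by rewrite ler_wpM2r ?invr_ge0 ?(ltW d0) // ler_nat.
Qed.

Lemma mean_gapE (R : realType) (t : R) (J : nat) :
  0 < t -> 1 < t * J%:R ->
  mean_gap t J = angle t J 0 J / (box_card J)%:R.
Proof.
move=> t0 tJ; rewrite /mean_gap /alpha; congr (_ / _).
have N0 : (0 < box_card J)%N by rewrite /box_card !addn1.
have hlast : ((box_card J).-1 < size (sorted_angles t J))%N.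
  by rewrite size_sorted_angles prednK.
have hmem v : (v \in sorted_angles t J) =
    (v \in [seq angle t J i y | i <- iota 0 (2 * J).+1, y <- iota 0 J.+1]).
  by rewrite mem_sort -anglesE.
apply/eqP; rewrite eq_le; apply/andP; split.
  have := mem_nth 0 hlast; rewrite hmem => /allpairsP[[i y] /= [_ hy ->]].
  by apply: angle_le_max => //; move: hy; rewrite -/(iota 0 J.+1) mem_iota ltnS.
have : angle t J 0 J \in sorted_angles t J.
  rewrite hmem; apply/allpairsP; exists (0%N, J).
  by split; rewrite ?mem_iota ?add0n ?ltnSn //=.
move=> /(nthP 0)[k hk <-].
apply: (sorted_leq_nth le_trans le_refl 0 (sorted_sorted_angles t J)) => //.
by rewrite -ltnS prednK // -(size_sorted_angles t J).
Qed.

Lemma gap_countE (R : realType) (t lam del : R) (J : nat) :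
  0 <= del -> 0 < mean_gap t J ->
  (gap_count t lam del J)%:R =
  (gaps_ge ((lam - del) * mean_gap t J) (sorted_angles t J))%:R -
  (gaps_ge ((lam + del) * mean_gap t J) (sorted_angles t J))%:R :> R.
Proof.
move=> del0 m0; rewrite /gap_count /gaps_ge size_sorted_angles.
have -> : index_iota 1 (box_card J) = map S (iota 0 (box_card J).-1).
  by rewrite /index_iota subn1 (iotaDl 1 0).
rewrite count_map; set s := sorted_angles t J.
set A := fun j => (lam - del) * _ <= _; set B := fun j => (lam + del) * _ <= _.
set l := iota _ _.
have BA j : B j -> A j.
  rewrite /A /B; apply: le_trans; rewrite ler_pM2r //; lra.
have hsplit : count A l = (count (fun j => A j && ~~ B j) l + count B l)%N.
  elim: l => //= j l ->; have := BA j.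
  by case: (A j); case: (B j) => //= h; [lia|have := h isT].
rewrite hsplit natrD addrK; congr (_%:R).
apply: eq_count => j /=; rewrite /A /B /alpha /=.
by rewrite ler_pdivlMr // ltr_pdivrMr // -ltNge.
Qed.

(** * Angular distance and determinants *)

Lemma atan_increment (R : realType) (r r' : R) : 0 <= r -> r <= r' ->
  (r' - r) / (1 + r' ^+ 2) <= atan r' - atan r <= r' - r.
Proof.
move=> r0; rewrite le_eqVlt => /orP[/eqP <-|rr'].
  by rewrite !subrr mul0r lexx.
have hder x : x \in `]r, r'[%R -> is_derive x 1 (@atan R) (1 + x ^+ 2)^-1.
  by move=> _; exact: is_derive1_atan.
have hcont : {within `[r, r'], continuous (@atan R)}.
  by apply: continuous_subspaceT => x; exact: continuous_atan.
have [x hx ->] := MVT rr' hder hcont.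
move: hx; rewrite in_itv /= => /andP[x1 x2].
have d0 : 0 <= r' - r by rewrite subr_ge0 ltW.
have x0 : 0 <= x by rewrite (le_trans r0) // ltW.
have xx : 1 + x ^+ 2 <= 1 + r' ^+ 2.
  by rewrite lerD2l lerXn2r ?nnegrE ?(le_trans r0 (ltW rr')) // ltW.
have p1 : 0 < 1 + x ^+ 2 by rewrite ltr_wpDr // exprn_ge0.
apply/andP; split.
  by rewrite [leRHS]mulrC ler_wpM2l // lef_pV2 // posrE (lt_le_trans p1).
by rewrite ler_piMl // invf_le1 // lerDl exprn_ge0.
Qed.

(** Determinant of the two points as seen from the observer; it is positive
exactly when the second point is seen at the larger angle. *)
Definition cross (R : realType) (t : R) (J i y i' y' : nat) : R :=
  y'%:R * depth t J i - y%:R * depth t J i'.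

Lemma cross_shift (R : realType) (t : R) (J i y i' y' : nat) (m k : int) :
  i'%:Z = i%:Z + m -> y'%:Z = y%:Z + k ->
  cross t J i y i' y' = k%:~R * depth t J i - m%:~R * y%:R.
Proof.
move=> hi hy; rewrite /cross /depth.
have -> : i'%:R = i%:R + m%:~R :> R by rewrite !pmulrn hi intrD.
have -> : y'%:R = y%:R + k%:~R :> R by rewrite !pmulrn hy intrD.
ring.
Qed.

Lemma ratio_sub_cross (R : realType) (t : R) (J i y i' y' : nat) :
  0 < depth t J i -> 0 < depth t J i' ->
  y'%:R / depth t J i' - y%:R / depth t J i =
  cross t J i y i' y' / (depth t J i * depth t J i').
Proof. by move=> h h'; rewrite /cross; field; rewrite !lt0r_neq0. Qed.

Lemma angle_lt_cross (R : realType) (t : R) (J i y i' y' : nat) :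
  0 < depth t J i -> 0 < depth t J i' ->
  (angle t J i y < angle t J i' y') = (0 < cross t J i y i' y').
Proof.
move=> h h'.
have hr := ratio_sub_cross y y' h h'.
have e : (0 < cross t J i y i' y') = (y%:R / depth t J i < y'%:R / depth t J i').
  by rewrite -[RHS]subr_gt0 hr pmulr_lgt0 // invr_gt0 mulr_gt0.
rewrite e /angle; apply/idP/idP; last exact: lt_atan.
by apply: contraTT; rewrite -!leNgt; exact: le_atan.
Qed.

(** For large J every lower-order term is a relative error of at most theta. *)
Lemma scale_estimates (R : realType) (t theta : R) : 0 < t -> 0 < theta <= 1 ->
  \forall J \near \oo,
    [/\ 1 <= (J%:R : R), 1 < t * J%:R,
        (1 - theta) * (t * J%:R ^+ 2) <= t * J%:R ^+ 2 - J%:R,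
        t * J%:R ^+ 2 + J%:R <= (1 + theta) * (t * J%:R ^+ 2) &
        (J%:R / (t * J%:R ^+ 2 - J%:R)) ^+ 2 <= theta /\
        2 * J%:R ^+ 2 <= ((box_card J)%:R : R) <= 2 * (1 + theta) * J%:R ^+ 2].
Proof.
move=> t0 /andP[th0 th1]; near=> J.
have J1 : 1 <= J%:R :> R by near: J; apply: nbhs_infty_ger.
have Jt : (1 + theta^-1) / t <= J%:R by near: J; apply: nbhs_infty_ger.
have J2 : 2 / theta <= J%:R by near: J; apply: nbhs_infty_ger.
have i1 : 1 <= theta^-1 by rewrite invf_ge1.
have J0 : 0 < J%:R :> R by exact: lt_le_trans J1.
have {}Jt : 1 + theta^-1 <= t * J%:R by rewrite [t * _]mulrC -ler_pdivrMr.
have {}J2 : 2 <= theta * J%:R by rewrite [theta * _]mulrC -ler_pdivrMr.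
have tJ1 : 1 < t * J%:R by lra.
have key : J%:R <= theta * (t * J%:R ^+ 2).
  have -> : theta * (t * J%:R ^+ 2) = theta * (t * J%:R) * J%:R by ring.
  rewrite ler_peMl ?(ltW J0) // mulrC -ler_pdivrMr // div1r.
  by apply: le_trans Jt; rewrite lerDr.
split=> //; try lra; split.
  have -> : J%:R / (t * J%:R ^+ 2 - J%:R) = (t * J%:R - 1)^-1.
    have d0 : 0 < t * J%:R - 1 by lra.
    have -> : t * J%:R ^+ 2 - J%:R = J%:R * (t * J%:R - 1) by ring.
    by field; rewrite !lt0r_neq0.
  have d0 : theta^-1 <= t * J%:R - 1 by lra.
  have h : (t * J%:R - 1)^-1 <= theta.
    by rewrite -[leRHS]invrK lef_pV2 ?posrE ?invr_gt0 //; lra.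
  have h0 : 0 <= (t * J%:R - 1)^-1 by rewrite invr_ge0; lra.
  rewrite expr2; apply: (@le_trans _ _ (theta * 1)); last by rewrite mulr1.
  by rewrite ler_pM // (le_trans h).
have -> : (box_card J)%:R = 2 * J%:R ^+ 2 + 3 * J%:R + 1 :> R.
  by rewrite /box_card !(natrM, natrD); ring.
have : 2 * J%:R <= theta * J%:R ^+ 2 by rewrite expr2 mulrA ler_pM2r.
lra.
Unshelve. all: by end_near.
Qed.

Lemma depth0E (R : realType) (t : R) (J : nat) :
  depth t J 0 = t * J%:R ^+ 2 - J%:R.
Proof. by rewrite /depth sub0r. Qed.

Lemma depth_range (R : realType) (t : R) (J i : nat) : (i <= 2 * J)%N ->
  depth t J 0 <= depth t J i <= t * J%:R ^+ 2 + J%:R.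
Proof.
move=> hi; have h : i%:R <= 2 * J%:R :> R by rewrite -natrM ler_nat.
have i0 : 0 <= i%:R :> R by [].
by rewrite depth0E /depth; lra.
Qed.

Lemma mean_gap_bounds (R : realType) (t rho : R) (J : nat) :
  0 < t -> 1 < t * J%:R -> rho = J%:R / depth t J 0 ->
  rho / (1 + rho ^+ 2) / (box_card J)%:R <= mean_gap t J
    <= rho / (box_card J)%:R.
Proof.
move=> t0 tJ hrho; rewrite mean_gapE //.
have d0 := depth_gt0 0 t0 tJ.
have rho0 : 0 <= rho by rewrite hrho divr_ge0 // ltW.
have := atan_increment (lexx 0) rho0; rewrite atan0 !subr0 => /andP[h1 h2].
by rewrite /angle -hrho !ler_wpM2r // invr_ge0.
Qed.

Lemma mean_gap_gt0 (R : realType) (t : R) (J : nat) :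
  0 < t -> 1 < t * J%:R -> 0 < mean_gap t J.
Proof.
move=> t0 tJ; have /andP[h _] := mean_gap_bounds t0 tJ erefl; apply: lt_le_trans h.
have J0 : 0 < J%:R :> R by rewrite -(pmulr_rgt0 _ t0) (lt_trans _ tJ).
have d0 := depth_gt0 0 t0 tJ.
rewrite !divr_gt0 // ?ltr0n ?/box_card ?addn1 //.
by rewrite ltr_wpDr // exprn_ge0 // divr_ge0 // ltW.
Qed.

(** A determinant delta between two points makes their angles differ by about
delta / (t J^2)^2, and a mean gap is about 1 / (2 t J^3): the margin between c1
and c absorbs all relative errors. *)
Lemma small_cross_close (R : realType) (t c1 c : R) :
  0 < t -> 0 < c1 -> c1 < c ->
  \forall J \near \oo, forall i y i' y' : nat,
    (i <= 2 * J)%N -> (i' <= 2 * J)%N ->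
    0 <= cross t J i y i' y' <= c1 * t / 2 * J%:R ->
    angle t J i' y' < angle t J i y + c * mean_gap t J.
Proof.
move=> t0 c10 c1c.
(* Chosen so that c1 = c (1 - 5 th); then c1 (1 + th)^2 < c (1 - th). *)
pose th := (c - c1) / (5 * c).
have c0 : 0 < c by exact: lt_trans c1c.
have th0 : 0 < th by rewrite divr_gt0 // ?subr_gt0 // mulr_gt0.
have hth : c1 = c * (1 - 5 * th) by rewrite /th; field; rewrite lt0r_neq0.
have th5 : th < 1 / 5.
  by rewrite /th ltr_pdivrMr ?mulr_gt0 //; lra.
have thb : 0 < th <= 1 by rewrite th0; lra.
near=> J => i y i' y' hi hi' hd.
have [J1 tJ hA _ [hrho /andP[_ hN]]] : [/\ 1 <= (J%:R : R), 1 < t * J%:R,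
        (1 - th) * (t * J%:R ^+ 2) <= t * J%:R ^+ 2 - J%:R,
        t * J%:R ^+ 2 + J%:R <= (1 + th) * (t * J%:R ^+ 2) &
        (J%:R / (t * J%:R ^+ 2 - J%:R)) ^+ 2 <= th /\
        2 * J%:R ^+ 2 <= ((box_card J)%:R : R) <= 2 * (1 + th) * J%:R ^+ 2].
  by near: J; exact: scale_estimates.
have J0 : 0 < J%:R :> R by exact: lt_le_trans J1.
rewrite -depth0E in hA hrho.
have d0 := depth_gt0 0 t0 tJ; set A := depth t J 0 in hA hrho d0.
have T0 := depth_gt0 i t0 tJ; have T0' := depth_gt0 i' t0 tJ.
have /andP[hT _] := depth_range t hi; have /andP[hT' _] := depth_range t hi'.
have [cr0 cr1] := andP hd.
have hr := ratio_sub_cross y y' T0 T0'.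
have r0 : 0 <= y%:R / depth t J i by rewrite divr_ge0 // ltW.
have rr : y%:R / depth t J i <= y'%:R / depth t J i'.
  by rewrite -subr_ge0 hr divr_ge0 // mulr_ge0 // ltW.
have /andP[_ hat] := atan_increment r0 rr.
have /andP[hm _] := mean_gap_bounds t0 tJ erefl.
rewrite addrC -ltrBlDr; apply: le_lt_trans hat _; rewrite hr.
have N0 : 0 < (box_card J)%:R :> R by rewrite ltr0n /box_card !addn1.
set N := (box_card J)%:R in hN hm N0; set rho := J%:R / A in hrho hm.
have p0 : 0 < 1 + rho ^+ 2.
  by rewrite ltr_wpDr // exprn_ge0 // divr_ge0 // ltW.
apply: (@lt_le_trans _ _ (c * (rho / (1 + rho ^+ 2) / N))); last first.
  by rewrite ler_pM2l.
apply: (@le_lt_trans _ _ (c1 * t / 2 * J%:R / (A * A))).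
  by rewrite ler_pM ?invr_ge0 ?mulr_ge0 ?(ltW T0) ?(ltW T0') // lef_pV2 ?posrE ?mulr_gt0 // ler_pM // ltW.
have -> : c * (rho / (1 + rho ^+ 2) / N) =
   (c * A / ((1 + rho ^+ 2) * N)) * (J%:R / (A * A)).
  rewrite /rho; field; rewrite -/rho !lt0r_neq0 //.
  have -> : A * A + J%:R * J%:R = A ^+ 2 * (1 + rho ^+ 2).
    by rewrite /rho; field; rewrite lt0r_neq0.
  by rewrite mulr_gt0 // exprn_gt0.
have -> : c1 * t / 2 * J%:R / (A * A) = c1 * (t / 2) * (J%:R / (A * A)).
  by rewrite !mulrA.
rewrite ltr_pM2r; last by rewrite divr_gt0 // mulr_gt0.
rewrite ltr_pdivlMr ?mulr_gt0 //.
have q0 : 0 < t * J%:R ^+ 2 by rewrite mulr_gt0 // exprn_gt0.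
apply: (@le_lt_trans _ _ (c1 * (t / 2) * ((1 + th) * (2 * (1 + th) * J%:R ^+ 2)))).
  rewrite ler_wpM2l //; first by rewrite mulr_ge0 // ltW // divr_gt0.
  by rewrite ler_pM // ?lerD2l // ltW.
apply: (@lt_le_trans _ _ (c * ((1 - th) * (t * J%:R ^+ 2)))); last first.
  by rewrite ler_pM2l.
rewrite hth.
have -> : c * (1 - 5 * th) * (t / 2) * ((1 + th) * (2 * (1 + th) * J%:R ^+ 2)) =
  c * (((1 - 5 * th) * (1 + th) ^+ 2) * (t * J%:R ^+ 2)) by field.
rewrite ltr_pM2l // ltr_pM2r //.
have th3 : 0 < th ^+ 2 by rewrite exprn_gt0.
have th4 : 0 < th ^+ 3 by rewrite exprn_gt0.
have -> : (1 - 5 * th) * (1 + th) ^+ 2 = 1 - 3 * th - 9 * th ^+ 2 - 5 * th ^+ 3 by ring.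
lra.
Unshelve. all: by end_near.
Qed.

(** The converse comparison; here the increments of atan are bounded from below,
which costs one more relative error. *)
Lemma large_cross_far (R : realType) (t c c2 : R) :
  0 < t -> 0 < c -> c < c2 ->
  \forall J \near \oo, forall i y i' y' : nat,
    (i <= 2 * J)%N -> (i' <= 2 * J)%N -> (y' <= J)%N ->
    c2 * t / 2 * J%:R <= cross t J i y i' y' ->
    angle t J i y + c * mean_gap t J <= angle t J i' y'.
Proof.
move=> t0 c0 cc2.
(* Chosen so that c = c2 (1 - 8 th); then c (1 + th)^3 <= c2 (1 - th). *)
pose th := (c2 - c) / (8 * c2).
have c20 : 0 < c2 by exact: lt_trans cc2.
have th0 : 0 < th by rewrite divr_gt0 // ?subr_gt0 // mulr_gt0.
have hth : c = c2 * (1 - 8 * th) by rewrite /th; field; rewrite lt0r_neq0.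
have th8 : th < 1 / 8 by rewrite /th ltr_pdivrMr ?mulr_gt0 //; lra.
have thb : 0 < th <= 1 by rewrite th0; lra.
near=> J => i y i' y' hi hi' hy' hd.
have [J1 tJ hA hB [hrho /andP[hN _]]] : [/\ 1 <= (J%:R : R), 1 < t * J%:R,
        (1 - th) * (t * J%:R ^+ 2) <= t * J%:R ^+ 2 - J%:R,
        t * J%:R ^+ 2 + J%:R <= (1 + th) * (t * J%:R ^+ 2) &
        (J%:R / (t * J%:R ^+ 2 - J%:R)) ^+ 2 <= th /\
        2 * J%:R ^+ 2 <= ((box_card J)%:R : R) <= 2 * (1 + th) * J%:R ^+ 2].
  by near: J; exact: scale_estimates.
have J0 : 0 < J%:R :> R by exact: lt_le_trans J1.
rewrite -depth0E in hA hrho.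
have d0 := depth_gt0 0 t0 tJ; set A := depth t J 0 in hA hrho d0.
have T0 := depth_gt0 i t0 tJ; have T0' := depth_gt0 i' t0 tJ.
have /andP[_ hT] := depth_range t hi; have /andP[hA' hT'] := depth_range t hi'.
have D0 : 0 < c2 * t / 2 * J%:R by rewrite !mulr_gt0.
have cr0 : 0 < cross t J i y i' y' by exact: lt_le_trans hd.
have hr := ratio_sub_cross y y' T0 T0'.
have r0 : 0 <= y%:R / depth t J i by rewrite divr_ge0 // ltW.
have rr : y%:R / depth t J i <= y'%:R / depth t J i'.
  by rewrite -subr_ge0 hr divr_ge0 ?(ltW cr0) // mulr_ge0 // ltW.
have /andP[hat _] := atan_increment r0 rr.
have /andP[_ hm] := mean_gap_bounds t0 tJ erefl.
rewrite addrC -lerBrDr; apply: le_trans hat; rewrite hr.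
have N0 : 0 < (box_card J)%:R :> R by rewrite ltr0n /box_card !addn1.
set N := (box_card J)%:R in hN hm N0; set rho := J%:R / A in hrho hm.
have rho0 : 0 <= rho by rewrite divr_ge0 // ltW.
set r' := y'%:R / depth t J i'.
have hr' : r' <= rho.
  by rewrite ler_pM ?invr_ge0 ?(ltW T0') ?ler_nat // lef_pV2 ?posrE.
have r'0 : 0 <= r' by rewrite divr_ge0 // ltW.
have hp : 1 + r' ^+ 2 <= 1 + th.
  by rewrite lerD2l (le_trans _ hrho) // lerXn2r ?nnegrE.
have p0 : 0 < 1 + r' ^+ 2 by rewrite ltr_wpDr // exprn_ge0.
have th1 : 0 < 1 + th by lra.
set B := t * J%:R ^+ 2 + J%:R in hB hT hT'.
have B0 : 0 < B by apply: lt_le_trans hT.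
have q0 : 0 < t * J%:R ^+ 2 by rewrite mulr_gt0 // exprn_gt0.
apply: (@le_trans _ _ (c * (rho / N))); first by rewrite ler_pM2l.
apply: (@le_trans _ _ (c2 * t / 2 * J%:R / (B * B) / (1 + th))); last first.
  apply: ler_pM.
  - by rewrite divr_ge0 ?(ltW D0) // mulr_ge0 // ltW.
  - by rewrite invr_ge0 ltW.
  - apply: ler_pM => //; first by rewrite ltW.
      by rewrite invr_ge0 mulr_ge0 // ltW.
    by rewrite lef_pV2 ?posrE ?mulr_gt0 // ler_pM // ltW.
  - by rewrite lef_pV2 ?posrE.
have -> : c * (rho / N) = c * (J%:R / (A * N)).
  by rewrite /rho; field; rewrite !lt0r_neq0.
have -> : c2 * t / 2 * J%:R / (B * B) / (1 + th) =
    J%:R * (c2 * (t / 2) / (B * B * (1 + th))).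
  by field; rewrite !lt0r_neq0.
have -> : c * (J%:R / (A * N)) = J%:R * (c / (A * N)).
  by field; rewrite !lt0r_neq0.
rewrite ler_pM2l // ler_pdivrMr ?mulr_gt0 // mulrAC ler_pdivlMr ?mulr_gt0 //.
pose q := t * J%:R ^+ 2.
have hBB : B * B <= ((1 + th) * q) * ((1 + th) * q).
  by rewrite ler_pM // ltW.
have th2 : 0 < th ^+ 2 by rewrite exprn_gt0.
have th3 : 0 < th ^+ 3 by rewrite exprn_gt0.
have th4 : 0 < th ^+ 4 by rewrite exprn_gt0.
apply: (@le_trans _ _ (c * ((1 + th) * q * ((1 + th) * q) * (1 + th)))).
  by rewrite ler_pM2l // ler_pM2r.
apply: (@le_trans _ _ (c2 * (t / 2) * (((1 - th) * q) * (2 * J%:R ^+ 2)))); last first.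
  rewrite ler_wpM2l ?mulr_ge0 ?(ltW c20) ?divr_ge0 ?(ltW t0) //.
  apply: ler_pM => //.
  by rewrite mulr_ge0 ?(ltW q0) // subr_ge0 (andP thb).2.
have -> : c2 * (t / 2) * (((1 - th) * q) * (2 * J%:R ^+ 2)) =
   c2 * ((1 - th) * q ^+ 2) by rewrite /q; field.
have -> : c * ((1 + th) * q * ((1 + th) * q) * (1 + th)) =
   c2 * (((1 - 8 * th) * (1 + th) ^+ 3) * q ^+ 2) by rewrite hth; ring.
rewrite ler_pM2l // ler_wpM2r ?exprn_ge0 ?(ltW q0) //.
have -> : (1 - 8 * th) * (1 + th) ^+ 3 =
   1 - 5 * th - 21 * th ^+ 2 - 23 * th ^+ 3 - 8 * th ^+ 4 by ring.
lra.
Unshelve. all: by end_near.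
Qed.

Lemma mem_sorted_angles (R : realType) (t : R) (J i y : nat) :
  0 < t -> 1 < t * J%:R -> (i <= 2 * J)%N -> (y <= J)%N ->
  angle t J i y \in sorted_angles t J.
Proof.
move=> t0 tJ hi hy; rewrite mem_sort -/(angles t J) anglesE //.
by apply/allpairsP; exists (i, y); split; rewrite ?mem_iota ?add0n ?ltnS.
Qed.

Lemma crowded_of_cross (R : realType) (t c1 c : R) :
  0 < t -> 0 < c1 -> c1 < c ->
  \forall J \near \oo, forall i y i' y' : nat,
    (i <= 2 * J)%N -> (i' <= 2 * J)%N -> (y' <= J)%N ->
    0 < cross t J i y i' y' <= c1 * t / 2 * J%:R ->
    crowded (c * mean_gap t J) (sorted_angles t J) (angle t J i y).
Proof.
move=> t0 c10 c1c; near=> J => i y i' y' hi hi' hy' /andP[h0 h1].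
have J1 : 2 / t <= J%:R by near: J; apply: nbhs_infty_ger.
have tJ : 1 < t * J%:R.
  by move: J1; rewrite ler_pdivrMr // => ?; lra.
apply/hasP; exists (angle t J i' y'); first exact: mem_sorted_angles.
have hclose : forall i y i' y' : nat,
    (i <= 2 * J)%N -> (i' <= 2 * J)%N ->
    0 <= cross t J i y i' y' <= c1 * t / 2 * J%:R ->
    angle t J i' y' < angle t J i y + c * mean_gap t J.
  by near: J; exact: small_cross_close.
rewrite hclose ?(ltW h0) // andbT angle_lt_cross //; exact: depth_gt0.
Unshelve. all: by end_near.
Qed.

Lemma hit_crowds (R : realType) (t D : R) (J i y : nat) (k : int) :
  0 < t -> 1 < t * J%:R -> (0 < y)%N ->
  0 <= y%:Z + k <= J%:Z ->
  hit t D J k i y -> frac (k%:~R * depth t J i / y%:R) != 0 ->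
  exists i' y' : nat,
    [/\ (i' <= 2 * J)%N, (y' <= J)%N & 0 < cross t J i y i' y' < D].
Proof.
move=> t0 tJ y0 /andP[hy0 hyJ] /andP[hD /andP[hm0 hmJ]] hf.
set z := k%:~R * depth t J i / y%:R in hD hm0 hmJ hf.
have yr : 0 < y%:R :> R by rewrite ltr0n.
have f0 : 0 < frac z by rewrite lt_neqAle eq_sym hf; case/andP: (frac_bounds z).
exists (absz (i%:Z + Num.floor z)), (absz (y%:Z + k)); split.
- by rewrite -lez_nat gez0_abs.
- by rewrite -lez_nat gez0_abs.
rewrite (@cross_shift _ _ _ _ _ _ _ (Num.floor z) k) ?gez0_abs //.
have -> : k%:~R * depth t J i - (Num.floor z)%:~R * y%:R = frac z * y%:R.
  by rewrite /frac mulrBl /z divfK // lt0r_neq0.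
by rewrite mulr_gt0.
Qed.

Lemma frac_double_eq0 (R : realType) (x : R) : frac x = 0 -> frac (2 * x) = 0.
Proof. by move=> h; rewrite frac_double h; case: ifP; lra. Qed.

(** In a row y <= D the left neighbour is close enough to crowd the point, and in
the other rows every hit with nonzero phase is a point seen strictly later and
close by. A zero phase is a tie, which does not crowd; it forces 2 T / y to be an
integer. *)
Lemma uncrowded_unhit (R : realType) (t c1 c : R) :
  0 < t -> 0 < c1 -> c1 < c ->
  \forall J \near \oo, forall (D : R) (Y0 i y : nat),
    D = c1 * t / 2 * J%:R -> D < Y0%:R -> Y0%:R <= D + 1 ->
    (i <= 2 * J)%N -> (y <= J)%N ->
    ~~ crowded (c * mean_gap t J) (sorted_angles t J) (angle t J i y) ->
    (0 < i)%N -> (0 < y)%N -> (y + 2 <= J)%N ->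
    (Y0 <= y)%N && (unhit t D J i y ||
       (frac (2 * (depth t J i / y%:R)) == 0)).
Proof.
move=> t0 c10 c1c; near=> J => D Y0 i y hD hDY hYD hi hy hcr i0 y0 hyJ.
have J1 : 2 / t <= J%:R by near: J; apply: nbhs_infty_ger.
have J3 : 3 / (c1 * t / 2) <= J%:R by near: J; apply: nbhs_infty_ger.
have tJ : 1 < t * J%:R.
  by move: J1; rewrite ler_pdivrMr // => ?; lra.
have D3 : 3 <= D by rewrite hD mulrC -ler_pdivrMr // divr_gt0 // mulr_gt0.
have hcross : forall i y i' y' : nat,
    (i <= 2 * J)%N -> (i' <= 2 * J)%N -> (y' <= J)%N ->
    0 < cross t J i y i' y' <= c1 * t / 2 * J%:R ->
    crowded (c * mean_gap t J) (sorted_angles t J) (angle t J i y).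
  by near: J; exact: crowded_of_cross.
have Y0y : (Y0 <= y)%N.
  rewrite leqNgt; apply/negP => hlt; move/negP: hcr; apply.
  apply: (hcross _ _ i.-1 y) => //.
    by rewrite (leq_trans (leq_pred _)).
  rewrite (@cross_shift _ _ _ _ _ _ _ (-1) 0) ?addr0 //; last first.
    by rewrite -{2}(prednK i0) -addn1 PoszD addrK.
  rewrite mul0r sub0r intrN mulN1r opprK ltr0n y0 -hD /=.
  have : y.+1%:R <= Y0%:R :> R by rewrite ler_nat.
  rewrite -natr1; lra.
rewrite Y0y /=; case: eqP => [|hf]; first by rewrite orbT.
rewrite orbF.
have y3 : (2 < y)%N.
  have Dy : D < y%:R by apply: lt_le_trans hDY _; rewrite ler_nat.
  by rewrite -(ltr_nat R) (lt_trans _ Dy) // (lt_le_trans _ D3) // ltr_nat.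
have nohit (k : int) : -2 <= k <= 2 ->
    frac (k%:~R * depth t J i / y%:R) != 0 -> ~~ hit t D J k i y.
  move=> hk hfk; apply/negP => hh; move/negP: hcr; apply.
  have hyk : 0 <= y%:Z + k <= J%:Z by move: hk y3 hyJ; clear; lia.
  have [i' [y' [h1 h2 /andP[h3 h4]]]] := hit_crowds t0 tJ y0 hyk hh hfk.
  by apply: (hcross _ _ i' y') => //; rewrite h3 -hD ltW.
have fz : frac (depth t J i / y%:R) != 0.
  by apply/eqP => /frac_double_eq0.
have opp x : frac x != 0 -> frac (- x) != 0 :> R.
  move=> hx; rewrite frac_opp (negPf hx); have := frac_bounds x.
  by move=> ?; apply/eqP; lra.
have e1 : (1%:~R : R) = 1 by []. 
have e2 : (2%:~R : R) = 2 by [].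
have em1 : ((-1)%:~R : R) = -1 by [].
have em2 : ((-2)%:~R : R) = -2 by rewrite intrN.
rewrite /unhit; apply/and4P; split; apply: nohit => //.
- by rewrite e1 mul1r.
- by rewrite e2 -mulrA; apply/eqP.
- by rewrite em1 mulN1r mulNr; exact: opp.
- by rewrite em2 -mulrA mulNr; apply: opp; apply/eqP.
Unshelve. all: by end_near.
Qed.

(** A competitor in row y + k has determinant in [0, D) with the point. As D < y,
its column must be i + floor (k T / y): it is the point itself if k = 0, a hit if
|k| is 1 or 2, and outside the box if |k| >= 3, because 3 T / y >= 2 J + 1 when
t > 2/3. *)
Lemma unhit_lone (R : realType) (t c c2 : R) :
  2 / 3 < t -> 0 < c -> c < c2 ->
  \forall J \near \oo, forall (D : R) (Y0 i y : nat),
    D = c2 * t / 2 * J%:R -> D < Y0%:R -> (i <= 2 * J)%N -> (Y0 <= y <= J)%N ->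
    unhit t D J i y ->
    (crowd (c * mean_gap t J) (sorted_angles t J) (angle t J i y) <= 1)%N.
Proof.
move=> t23 c0 cc2; have t0 : 0 < t by lra.
near=> J => D Y0 i y hD hDY hi /andP[hY hy] hun.
have J1 : 2 / t <= J%:R by near: J; apply: nbhs_infty_ger.
have J3 : 4 / (3 * t - 2) <= J%:R by near: J; apply: nbhs_infty_ger.
have tJ : 1 < t * J%:R.
  by move: J1; rewrite ler_pdivrMr // => ?; lra.
have J0 : 0 < J%:R :> R by rewrite -(pmulr_rgt0 _ t0) (lt_trans _ tJ).
have {}J3 : 4 <= (3 * t - 2) * J%:R.
  by move: J3; rewrite ler_pdivrMr; [rewrite mulrC|lra].
have hfar : forall i y i' y' : nat,
    (i <= 2 * J)%N -> (i' <= 2 * J)%N -> (y' <= J)%N ->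
    c2 * t / 2 * J%:R <= cross t J i y i' y' ->
    angle t J i y + c * mean_gap t J <= angle t J i' y'.
  by near: J; exact: large_cross_far.
have Dy : D < y%:R by apply: lt_le_trans hDY _; rewrite ler_nat.
have D0 : 0 < D by rewrite hD !mulr_gt0 //; lra.
have yr : 0 < y%:R :> R by exact: lt_trans Dy.
have yJ : y%:R <= J%:R :> R by rewrite ler_nat.
rewrite /crowd count_sorted_angles anglesE //.
have -> : [seq angle t J i' y' | i' <- iota 0 (2 * J).+1, y' <- iota 0 J.+1] =
  map (fun p => angle t J p.1 p.2)
    [seq (i', y') | i' <- iota 0 (2 * J).+1, y' <- iota 0 J.+1].
  by rewrite map_allpairs.
rewrite count_map; set pairs := [seq (_, _) | _ <- _, _ <- _].
have hu : uniq pairs.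
  by apply: allpairs_uniq; rewrite ?iota_uniq // => -[a b] [a' b'] _ _ [-> ->].
apply: (@leq_trans (count (pred1 (i, y)) pairs)); last first.
  by rewrite count_uniq_mem // leq_b1.
apply: sub_in_count => -[i' y'] /allpairsP[[a b] /= [ha hb [ea eb]]].
move: ha hb; rewrite -/(iota 0 (2 * J).+1) -/(iota 0 J.+1) !mem_iota !add0n !ltnS.
rewrite -{a}ea -{b}eb => hi' hy' /andP[h1 h2].
have T0 := depth_gt0 i t0 tJ; have T0' := depth_gt0 i' t0 tJ.
have cr1 : cross t J i y i' y' < D.
  rewrite hD ltNge; apply/negP => /(hfar _ _ _ _ hi hi' hy'); lra.
have cr0 : 0 <= cross t J i y i' y'.
  rewrite leNgt -oppr_gt0; apply/negP.
  have -> : - cross t J i y i' y' = cross t J i' y' i y by rewrite /cross opprB.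
  by rewrite -angle_lt_cross // ltNge h1.
pose k := y'%:Z - y%:Z; pose m := i'%:Z - i%:Z.
have ek : y'%:Z = y%:Z + k by rewrite /k addrC subrK.
have em : i'%:Z = i%:Z + m by rewrite /m addrC subrK.
rewrite (cross_shift _ _ em ek) in cr0 cr1.
pose z := k%:~R * depth t J i / y%:R.
have ez : k%:~R * depth t J i = z * y%:R by rewrite /z divfK // lt0r_neq0.
rewrite ez -mulrBl in cr0 cr1.
have zm : 0 <= z - m%:~R < 1.
  move: cr0; rewrite pmulr_lge0 // => -> /=.
  by rewrite -(ltr_pM2r yr) mul1r (lt_trans cr1).
have fm : Num.floor z = m by apply: floor_def; rewrite intrD; lra.
have hk : hit t D J k i y.
  rewrite /hit -/z fm -em; apply/andP; split; last by rewrite lez_nat hi'.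
  by rewrite /frac fm.
have z3 : 2 * J%:R + 1 <= 3 * (depth t J i / y%:R).
  rewrite mulrA ler_pdivlMr //.
  apply: (@le_trans _ _ ((2 * J%:R + 1) * J%:R)).
    by rewrite ler_wpM2l // addr_ge0 // mulr_ge0.
  have i0 : 0 <= i%:R :> R by [].
  rewrite /depth; have : 4 * J%:R <= (3 * t - 2) * J%:R * J%:R by rewrite ler_pM2r.
  rewrite expr2; lra.
have mr : m%:~R = i'%:R - i%:R :> R by rewrite /m intrB -!pmulrn.
have ir : i%:R <= 2 * J%:R :> R by rewrite -natrM ler_nat.
have ir' : i'%:R <= 2 * J%:R :> R by rewrite -natrM ler_nat.
have m1r : m%:~R <= 2 * J%:R :> R.
  by rewrite mr lerBlDr (le_trans ir') // lerDl.
have m2r : - (2 * J%:R) <= m%:~R :> R.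
  by rewrite mr lerBrDr -lerBrDl opprK (le_trans ir) // lerDr.
have zE : z = k%:~R * (depth t J i / y%:R) by rewrite /z mulrA.
have w0 : 0 < depth t J i / y%:R by rewrite divr_gt0.
have k3 : -2 <= k <= 2.
  rewrite -!ltzD1; apply/andP; split; rewrite ltNge; apply/negP => hk3.
    have hk' : k <= -3 by move: hk3; move: (k) => kk; clear; lia.
    have : k%:~R <= -3 :> R by rewrite -[-3]/((-3)%:~R) ler_int.
    rewrite -(ler_pM2r w0) -zE => zk; move: zm z3 m2r zk; clear; lra.
  have hk' : 3 <= k by move: hk3; move: (k) => kk; clear; lia.
  have : 3 <= k%:~R :> R by rewrite -[3]/(3%:~R) ler_int.
  rewrite -(ler_pM2r w0) -zE => zk; move: zm z3 m1r zk; clear; lra.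
have k0 : k = 0.
  move: hk hun; rewrite /unhit => hk /and4P[/negP n1 /negP n2 /negP n3 /negP n4].
  have : k = -2 \/ k = -1 \/ k = 0 \/ k = 1 \/ k = 2.
    by move: k3; move: (k) => kk; clear; lia.
  by move=> [e|[e|[e|[e|e]]]] //; rewrite e in hk.
have m0 : m = 0.
  by rewrite -fm zE k0 mul0r floor0.
apply/eqP; congr pair.
  by have := em; rewrite m0 addr0 => -[].
by have := ek; rewrite k0 addr0 => -[].
Unshelve. all: by end_near.
Qed.

(** * Asymptotic number of large gaps *)

(** An arc reduced to one point has length 0, so equidistribution makes exact
coincidences negligible. *)
Lemma exact_ratios_rare (R : realType) (t c eps : R) :
  0 < t -> 0 < c -> 0 < eps ->
  \forall J \near \oo, forall (D : R) (Y0 : nat),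
    D = c * t / 2 * J%:R -> D < Y0%:R ->
    \sum_(Y0 <= y < J.+1) \sum_(0 <= i < (2 * J).+1)
      (frac (2 * (depth t J i / y%:R)) == 0)%:R <= eps * J%:R ^+ 2.
Proof.
move=> t0 c0 e0.
have t4 : 0 < 4 * t by rewrite mulr_gt0.
have k0 : 0 < c * t / 2 by rewrite divr_gt0 // mulr_gt0.
near=> J => D Y0 hD hDY.
have J1 : 2 / t <= J%:R by near: J; apply: nbhs_infty_ger.
have {}J1 : 2 <= t * J%:R by rewrite [t * _]mulrC -ler_pdivrMr.
have hreg : forall (K : nat -> R) (Y0 : nat) (a l A : nat -> R)
      (U phi : nat -> nat -> bool),
    (forall i, (i < (2 * J).+1)%N ->
       t * J%:R ^+ 2 <= `|K i| <= 4 * t * J%:R ^+ 2) ->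
    c * t / 2 * J%:R <= Y0%:R ->
    (forall y, (Y0 <= y < J.+1)%N -> 0 <= l y <= 1) ->
    (forall y y', (Y0 <= y)%N -> (y <= y')%N -> (y' < J.+1)%N ->
       `|a y' - a y| <= 0 * (y'%:R - y%:R) / J%:R /\
       `|l y' - l y| <= 0 * (y'%:R - y%:R) / J%:R) ->
    (forall i y, (i < (2 * J).+1)%N -> (Y0 <= y < J.+1)%N -> phi i y ->
       exists m : int, a y <= K i / y%:R - m%:~R <= a y + l y) ->
    (forall i y (m : int), (i < (2 * J).+1)%N -> (Y0 <= y < J.+1)%N ->
       a y < K i / y%:R - m%:~R < a y + l y -> phi i y) ->
    (forall i y y', (i < (2 * J).+1)%N -> (Y0 <= y)%N -> (y <= y')%N ->
       (y' < J.+1)%N -> U i y -> U i y') ->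
    (forall y, (Y0 <= y < J.+1)%N ->
       `|\sum_(0 <= i < (2 * J).+1) (U i y)%:R - 2 * J%:R * A y| <= 1) ->
    `|\sum_(Y0 <= y < J.+1) \sum_(0 <= i < (2 * J).+1) (U i y && phi i y)%:R
       - \sum_(Y0 <= y < J.+1) 2 * J%:R * A y * l y| <= eps * J%:R ^+ 2.
  by near: J; exact: equidistribution_region.
have := hreg (fun i => 2 * depth t J i) Y0 (fun=> 0) (fun=> 0) (fun=> 1)
  (fun _ _ => true) (fun i y => frac (2 * (depth t J i / y%:R)) == 0).
have -> : \sum_(Y0 <= y < J.+1) 2 * J%:R * 1 * 0 = 0 :> R.
  by rewrite big1 // => y _; rewrite mulr0.
move=> h; rewrite -[leLHS]subr0; apply: (le_trans (ler_norm _)); apply: h.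
- move=> i hi; have /andP[h1 h2] := depth_bounds t0 J1 hi.
  have q0 : 0 <= t * J%:R ^+ 2 by rewrite mulr_ge0 ?exprn_ge0 // ltW.
  by rewrite ger0_norm; lra.
- by rewrite -hD ltW.
- by move=> y _; rewrite lexx ler01.
- by move=> y y' _ _ _; rewrite subrr normr0 !mul0r.
- move=> i y _ _ /eqP hf; exists (Num.floor (2 * (depth t J i / y%:R))).
  by rewrite -mulrA addr0; move: hf; rewrite /frac => ->; rewrite lexx.
- by move=> i y m _ _; rewrite addr0 => /andP[h1 /(lt_trans h1)]; rewrite ltxx.
- by [].
- move=> y _; rewrite sumr_const_nat subn0 -[(2 * J).+1]addn1 natrD natrM mulr1.
  by rewrite addrAC subrr add0r normr1.
Unshelve. all: by end_near.
Qed.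

Lemma sum_from (R : realType) (Y0 n : nat) (F : nat -> R) :
  \sum_(0 <= y < n) (Y0 <= y)%N%:R * F y = \sum_(Y0 <= y < n) F y.
Proof.
case: (leqP Y0 n) => h.
  rewrite (@big_cat_nat _ _ _ Y0) //= [X in X + _]big_nat big1 ?add0r.
    by apply: eq_big_nat => y /andP[-> _]; rewrite mul1r.
  by move=> y /andP[_ hy]; rewrite leqNgt hy mul0r.
rewrite [RHS]big_geq ?(ltnW h) // big_nat big1 // => y /andP[_ hy].
by rewrite leqNgt (ltn_trans hy h) mul0r.
Qed.

(** Outside the first column, row 0 and the last two rows, the uncrowded points
are unhit or tied. *)
Lemma gaps_ge_upper (R : realType) (t c1 c eps : R) :
  2 / 3 < t -> 0 < c1 -> c1 < c -> 0 < eps ->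
  \forall J \near \oo,
    (gaps_ge (c * mean_gap t J) (sorted_angles t J))%:R
      <= 2 * J%:R ^+ 2 * gap_tail t c1 + eps * J%:R ^+ 2.
Proof.
move=> t23 c10 c1c e0; have t0 : 0 < t by lra.
have e4 : 0 < eps / 4 by lra.
near=> J.
have J1 : 1 <= J%:R :> R by near: J; apply: nbhs_infty_ger.
have Je : 48 / eps <= J%:R by near: J; apply: nbhs_infty_ger.
have Jt : 2 / t <= J%:R by near: J; apply: nbhs_infty_ger.
have {}Jt : 2 <= t * J%:R by rewrite [t * _]mulrC -ler_pdivrMr.
have {}Je : 48 <= eps * J%:R by rewrite [eps * _]mulrC -ler_pdivrMr.
have tJ : 1 < t * J%:R by lra.
pose D := c1 * t / 2 * J%:R; pose Y0 := (Num.trunc D).+1.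
have hD : D = c1 * t / 2 * J%:R by [].
have hDY : D < Y0%:R := truncnS_gt D.
have D0 : 0 <= D by rewrite hD !mulr_ge0 // ltW.
have hYD : Y0%:R <= D + 1.
  by rewrite /Y0 -natr1 lerD2r; have /andP[] := truncn_itv D0.
clearbody D Y0.
have hmain : `|\sum_(Y0 <= y < J.+1) \sum_(0 <= i < (2 * J).+1) (unhit t D J i y)%:R
      - 2 * J%:R ^+ 2 * gap_tail t c1| <= eps / 4 * J%:R ^+ 2.
  move: D Y0 hD hDY hYD {D0}; near: J; exact: unhit_count_asymptotics.
have hrare : \sum_(Y0 <= y < J.+1) \sum_(0 <= i < (2 * J).+1)
      (frac (2 * (depth t J i / y%:R)) == 0)%:R <= eps / 4 * J%:R ^+ 2.
  move: D Y0 hD hDY {D0 hYD hmain}; near: J; exact: exact_ratios_rare.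
have hpt : forall i y : nat,
    (i <= 2 * J)%N -> (y <= J)%N ->
    ~~ crowded (c * mean_gap t J) (sorted_angles t J) (angle t J i y) ->
    (0 < i)%N -> (0 < y)%N -> (y + 2 <= J)%N ->
    (Y0 <= y)%N && (unhit t D J i y ||
       (frac (2 * (depth t J i / y%:R)) == 0)).
  move=> i y; move: D Y0 i y hD hDY hYD {D0 hmain hrare}; near: J.
  exact: uncrowded_unhit.
apply: (@le_trans _ _ (\sum_(0 <= y < J.+1) \sum_(0 <= i < (2 * J).+1)
   (~~ crowded (c * mean_gap t J) (sorted_angles t J) (angle t J i y))%:R)).
  rewrite -(count_angles (fun v => ~~ crowded _ _ v)) // -count_sorted_angles ler_nat.
  exact: gaps_le_uncrowded (sorted_sorted_angles t J).
apply: (@le_trans _ _ (\sum_(0 <= y < J.+1) (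
   (2 * J).+1%:R * ((y == 0%N)%:R + (J < y + 2)%N%:R) + 1 +
   (Y0 <= y)%N%:R * (\sum_(0 <= i < (2 * J).+1) (unhit t D J i y)%:R +
      \sum_(0 <= i < (2 * J).+1) (frac (2 * (depth t J i / y%:R)) == 0)%:R)))).
  rewrite [leLHS]big_nat [leRHS]big_nat; apply: ler_sum => y /andP[_ hy].
  apply: (@le_trans _ _ (\sum_(0 <= i < (2 * J).+1) (
     ((y == 0%N)%:R + (J < y + 2)%N%:R) + (i == 0%N)%:R +
     (Y0 <= y)%N%:R * ((unhit t D J i y)%:R +
        (frac (2 * (depth t J i / y%:R)) == 0)%:R)))).
    rewrite [leLHS]big_nat [leRHS]big_nat; apply: ler_sum => i /andP[_ hi].
    have p (b : bool) : 0 <= b%:R :> R by [].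
    have pX : 0 <= (Y0 <= y)%N%:R * ((unhit t D J i y)%:R +
        (frac (2 * (depth t J i / y%:R)) == 0)%:R) :> R.
      by rewrite mulr_ge0 // addr_ge0.
    have pY := p (J < y + 2)%N; have pi := p (i == 0%N); have py := p (y == 0%N).
    case: (boolP (crowded _ _ _)) => [_|hcr] /=.
      by rewrite !addr_ge0.
    case: (boolP (y == 0%N)) => y0.
      by rewrite -!addrA lerDl !addr_ge0.
    case: (boolP (i == 0%N)) => i0.
      by rewrite addrAC lerDr addr_ge0 // addr_ge0.
    case: (ltnP J (y + 2)) => yJ.
      by rewrite -!addrA addrCA lerDl !addr_ge0.
    rewrite -lt0n in y0; rewrite -lt0n in i0.
    have /andP[-> hu] := hpt i y hi hy hcr i0 y0 yJ.
    rewrite mul1r !add0r; case/orP: hu => ->; first by rewrite lerDl.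
    by rewrite lerDr.
  move: (_ + (J < y + 2)%N%:R) => A.
  rewrite !big_split /= -mulr_sumr big_split /= sumr_const_nat subn0.
  rewrite [leRHS]addrAC -[leRHS]addrA mulr_natl [leLHS]addrAC -[leLHS]addrA.
  rewrite !lerD2l.
  by rewrite big_nat_recl //= big1 ?addr0.
have h1 : \sum_(0 <= y < J.+1) ((y == 0%N)%:R + (J < y + 2)%N%:R) <= 3 :> R.
  rewrite big_split /=.
  have a1 : \sum_(0 <= y < J.+1) (y == 0%N)%:R <= 0 + 1 :> R.
    apply: (@count_diameter _ _ _ _ (fun y => y == 0%N)) => // y y' _ _ _.
    by move=> /eqP -> /eqP ->; rewrite subrr.
  have a2 : \sum_(0 <= y < J.+1) (J < y + 2)%N%:R <= 1 + 1 :> R.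
    apply: (@count_diameter _ _ _ _ (fun y => (J < y + 2)%N)) => // y y' _ _.
    by move=> k1 k2 _; rewrite lerBlDr nat1r ler_nat; move: k1 k2; clear; lia.
  lra.
rewrite big_split /= [X in X + _]big_split /= -mulr_sumr sumr_const_nat subn0.
move: h1; move: (\sum_(_ <= _ < _) (_ + _)) => S1 h1.
rewrite sum_from big_split /=; move: h1 hmain hrare.
move: (\sum_(Y0 <= _ < _) _) => S2; move: (\sum_(Y0 <= _ < _) _) => S3.
rewrite ler_norml => h1 h2 h3.
have h4 : (2 * J).+1%:R * S1 <= 9 * J%:R.
  have : (2 * J).+1%:R <= 3 * J%:R :> R.
    rewrite -[(2 * J).+1]addn1 natrD natrM; lra.
  nra.
have h5 : 12 * J%:R <= eps / 4 * J%:R ^+ 2.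
  rewrite expr2; have : 48 * J%:R <= eps * J%:R * J%:R by rewrite ler_wpM2r.
  lra.
have h6 : J.+1%:R <= 2 * J%:R :> R by rewrite -natr1; lra.
lra.
Unshelve. all: by end_near.
Qed.

Lemma gaps_ge_lower (R : realType) (t c c2 eps : R) :
  2 / 3 < t -> 0 < c -> c < c2 -> 0 < eps ->
  \forall J \near \oo,
    2 * J%:R ^+ 2 * gap_tail t c2 - eps * J%:R ^+ 2 <=
    (gaps_ge (c * mean_gap t J) (sorted_angles t J))%:R.
Proof.
move=> t23 c0 cc2 e0; have t0 : 0 < t by lra.
have c20 : 0 < c2 by exact: lt_trans cc2.
have e4 : 0 < eps / 4 by lra.
near=> J.
have J1 : 1 <= J%:R :> R by near: J; apply: nbhs_infty_ger.
have Je : 4 / eps <= J%:R by near: J; apply: nbhs_infty_ger.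
have Jt : 2 / t <= J%:R by near: J; apply: nbhs_infty_ger.
have {}Jt : 2 <= t * J%:R by rewrite [t * _]mulrC -ler_pdivrMr.
have {}Je : 4 <= eps * J%:R by rewrite [eps * _]mulrC -ler_pdivrMr.
have tJ : 1 < t * J%:R by lra.
pose D := c2 * t / 2 * J%:R; pose Y0 := (Num.trunc D).+1.
have hD : D = c2 * t / 2 * J%:R by [].
have hDY : D < Y0%:R := truncnS_gt D.
have D0 : 0 <= D by rewrite hD !mulr_ge0 // ltW.
have hYD : Y0%:R <= D + 1.
  by rewrite /Y0 -natr1 lerD2r; have /andP[] := truncn_itv D0.
clearbody D Y0.
have hmain : `|\sum_(Y0 <= y < J.+1) \sum_(0 <= i < (2 * J).+1) (unhit t D J i y)%:R
      - 2 * J%:R ^+ 2 * gap_tail t c2| <= eps / 4 * J%:R ^+ 2.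
  move: D Y0 hD hDY hYD {D0}; near: J; exact: unhit_count_asymptotics.
have hpt : forall i y : nat, (i <= 2 * J)%N -> (Y0 <= y <= J)%N ->
    unhit t D J i y ->
    (crowd (c * mean_gap t J) (sorted_angles t J) (angle t J i y) <= 1)%N.
  move=> i y; move: D Y0 i y hD hDY {D0 hYD hmain}; near: J.
  exact: unhit_lone.
have m0 : 0 < c * mean_gap t J by rewrite mulr_gt0 // mean_gap_gt0.
have h1 : \sum_(Y0 <= y < J.+1) \sum_(0 <= i < (2 * J).+1) (unhit t D J i y)%:R
   <= (gaps_ge (c * mean_gap t J) (sorted_angles t J))%:R + 1 :> R.
  rewrite -(natrD R _ 1); apply: (@le_trans _ _
    (count (fun v => (crowd (c * mean_gap t J) (sorted_angles t J) v <= 1)%N)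
      (sorted_angles t J))%:R); last first.
    by rewrite ler_nat; exact: lone_le_gaps (sorted_sorted_angles t J).
  rewrite count_sorted_angles count_angles // -sum_from.
  rewrite [leLHS]big_nat [leRHS]big_nat; apply: ler_sum => y /andP[_ hy].
  case: (leqP Y0 y) => hY; last first.
    by rewrite mul0r; apply: sumr_ge0.
  rewrite mul1r [leLHS]big_nat [leRHS]big_nat; apply: ler_sum => i /andP[_ hi].
  case: (boolP (unhit _ _ _ _ _)) => //= hun.
  by rewrite hpt // hY.
have h2 : 1 <= eps / 4 * J%:R ^+ 2.
  rewrite expr2; have : 4 * 1 <= eps * J%:R * J%:R by rewrite ler_pM.
  lra.
have h3 : 0 <= eps * J%:R ^+ 2 by lra.
move: hmain h1; move: (\sum_(Y0 <= _ < _) _) => S.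
rewrite ler_norml => h4 h5; lra.
Unshelve. all: by end_near.
Qed.

(** * Limit of the gap frequencies *)

Lemma continuous_log_ramp (R : realType) (a x : R) (f : R -> R) : 0 < a ->
  {for x, continuous f} -> {for x, continuous (fun y => log_ramp a (f y))}.
Proof.
move=> a0 hf; rewrite /log_ramp.
have hm : {for x, continuous (fun y => Num.max a (f y))}.
  by apply: (@continuous_max R R (fun=> a) f) => //; exact: cst_continuous.
have m0 : 0 < Num.max a (f x) by rewrite lt_max a0.
apply: continuousD.
  by apply: continuous_comp; [exact: hm|exact: continuous_ln].
apply: continuousM; first exact: cst_continuous.
by apply: continuousV => //; rewrite lt0r_neq0.
Qed.

Lemma continuous_bump (R : realType) (x : R) (b w : R -> R) : 2 <= b x ->
  {for x, continuous b} -> {for x, continuous w} ->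
  {for x, continuous (fun y => bump (b y) (w y))}.
Proof.
move=> b2 hb hw; rewrite /bump.
have hm : {for x, continuous (fun y => Num.min (b y) (Num.max 2 (w y)))}.
  apply: (@continuous_min R R b (fun y => Num.max 2 (w y))) => //.
  by apply: (@continuous_max R R (fun=> 2) w) => //; exact: cst_continuous.
have m0 : 0 < Num.min (b x) (Num.max 2 (w x)).
  by rewrite lt_min (lt_le_trans _ b2) //= lt_max ltr0n.
apply: continuousD; first apply: continuousB => //.
  apply: continuousM.
    by apply: continuousD => //; exact: cst_continuous.
  by apply: continuous_comp; [exact: hm|exact: continuous_ln].
apply: continuousM.
  by apply: continuousM => //; exact: cst_continuous.
by apply: continuousV => //; rewrite lt0r_neq0.
Qed.

Lemma continuous_gap_potential (R : realType) (x : R) (w : R -> R) :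
  {for x, continuous w} ->
  {for x, continuous (fun c => gap_potential c (w c))}.
Proof.
move=> hw; rewrite /gap_potential.
have hid : {for x, continuous (fun c : R => c)} by exact: cvg_id.
have h2 (a : R) : {for x, continuous (fun _ : R => a)} by exact: cst_continuous.
apply: continuousD; first apply: continuousB; first apply: continuousB => //.
- by apply: continuousM; [exact: continuousM|exact: continuous_log_ramp].
- by apply: continuousM => //; exact: continuous_log_ramp.
apply: continuousM => //; apply: continuous_bump => //.
  by rewrite -[leLHS]mulr1 ler_pM2l // le_max lexx.
apply: continuousM => //.
by apply: (@continuous_max R R (fun=> 1) id).
Qed.

Lemma continuous_gap_tail (R : realType) (t x : R) :
  {for x, continuous (gap_tail t)}.
Proof.
rewrite /gap_tail; apply: continuousM; first exact: cst_continuous.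
have hid : {for x, continuous (fun c : R => c)} by exact: cvg_id.
apply: continuousB; apply: continuous_gap_potential => //.
by apply: (@continuous_max R R id (fun=> 2 / t)) => //; exact: cst_continuous.
Qed.

(** gaps_ge_upper and gaps_ge_lower compare with gap_tail at points slightly off
c; continuity of gap_tail closes the gap. *)
Lemma gaps_ge_asymptotics (R : realType) (t c eps : R) :
  2 / 3 < t -> 0 < c -> 0 < eps ->
  \forall J \near \oo,
    `|(gaps_ge (c * mean_gap t J) (sorted_angles t J))%:R
       - 2 * J%:R ^+ 2 * gap_tail t c| <= eps * J%:R ^+ 2.
Proof.
move=> t23 c0 e0; have e4 : 0 < eps / 4 by rewrite divr_gt0.
have := @continuous_gap_tail R t c => /cvgrPdist_le /(_ _ e4).
move=> /nbhs_ballP[d /= d0 hd].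
pose c1 := Num.max (c / 2) (c - d / 2); pose c2 := c + d / 2.
have hc1 : 0 < c1 < c.
  by rewrite lt_max divr_gt0 //= gt_max gtrDl oppr_lt0 divr_gt0 // andbT; lra.
have hc2 : c < c2 by rewrite ltrDl divr_gt0.
have [c10 c1c] := andP hc1.
have b1 : `|gap_tail t c - gap_tail t c1| <= eps / 4.
  apply: hd; rewrite /ball /= ger0_norm ?subr_ge0 ?ltW //.
  have : c - d / 2 <= c1 by rewrite le_max lexx orbT.
  lra.
have b2 : `|gap_tail t c - gap_tail t c2| <= eps / 4.
  apply: hd; rewrite /ball /= distrC ger0_norm ?subr_ge0 ?ltW // /c2; lra.
near=> J.
have J2 : 0 <= J%:R ^+ 2 :> R by rewrite exprn_ge0.
have hu : (gaps_ge (c * mean_gap t J) (sorted_angles t J))%:R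
      <= 2 * J%:R ^+ 2 * gap_tail t c1 + eps / 4 * J%:R ^+ 2.
  by near: J; exact: gaps_ge_upper.
have hl : 2 * J%:R ^+ 2 * gap_tail t c2 - eps / 4 * J%:R ^+ 2 <=
    (gaps_ge (c * mean_gap t J) (sorted_angles t J))%:R.
  by near: J; exact: gaps_ge_lower.
move: hu hl b1 b2 J2; move: (gaps_ge _ _)%:R (J%:R ^+ 2) => g q.
move: (gap_tail t c) (gap_tail t c1) (gap_tail t c2) => x0 x1 x2; clear.
rewrite !ler_norml => h1 h2 /andP[h3 h4] /andP[h5 h6] q0.
have k1 : q * x1 <= q * (x0 + eps / 4) by rewrite ler_wpM2l //; lra.
have k2 : q * (x0 - eps / 4) <= q * x2 by rewrite ler_wpM2l //; lra.
lra.
Unshelve. all: by end_near.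
Qed.

Lemma gap_freq_cvg (R : realType) (t lam del : R) :
  2 / 3 < t -> 0 < del -> del < lam ->
  gap_freq t lam del @ \oo --> gap_tail t (lam - del) - gap_tail t (lam + del).
Proof.
move=> t23 d0 dl; have t0 : 0 < t by lra.
apply/cvgrPdist_le => eps e0.
have l1 : 0 < lam - del by rewrite subr_gt0.
have l2 : 0 < lam + del by lra.
near=> J.
have J1 : 1 <= J%:R :> R by near: J; apply: nbhs_infty_ger.
have Jt : 2 / t <= J%:R by near: J; apply: nbhs_infty_ger.
have tJ : 1 < t * J%:R.
  by move: Jt; rewrite ler_pdivrMr // => ?; lra.
have h1 : `|(gaps_ge ((lam - del) * mean_gap t J) (sorted_angles t J))%:R
       - 2 * J%:R ^+ 2 * gap_tail t (lam - del)| <= eps * J%:R ^+ 2.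
  by near: J; exact: gaps_ge_asymptotics.
have h2 : `|(gaps_ge ((lam + del) * mean_gap t J) (sorted_angles t J))%:R
       - 2 * J%:R ^+ 2 * gap_tail t (lam + del)| <= eps * J%:R ^+ 2.
  by near: J; exact: gaps_ge_asymptotics.
rewrite /gap_freq gap_countE ?(ltW d0) ?mean_gap_gt0 //.
have q0 : 0 < 2 * J%:R ^+ 2 :> R by rewrite mulr_gt0 // exprn_gt0 // (lt_le_trans _ J1).
move: h1 h2 q0; move: (gaps_ge ((lam - del) * _) _)%:R => g1.
move: (gaps_ge ((lam + del) * _) _)%:R => g2.
move: (gap_tail t (lam - del)) (gap_tail t (lam + del)) (J%:R ^+ 2).
move=> x1 x2 q h1 h2 q0.
have -> : x1 - x2 - (g1 - g2) / (2 * q) =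
   - ((g1 - 2 * q * x1) - (g2 - 2 * q * x2)) / (2 * q).
  by field; rewrite lt0r_neq0 //; lra.
rewrite normrM normfV (gtr0_norm q0) ler_pdivrMr // normrN.
apply: le_trans (ler_normB _ _) _; lra.
Unshelve. all: by end_near.
Qed.

(** * Branches of the tail and their derivatives *)

(** The common shape of all branches of gap_tail t. *)
Definition log_affine (R : realType) (k0 k1 k2 k3 c : R) : R :=
  k0 + k1 * c + k2 * (c * ln c) + k3 * ln c.

Lemma log_affine_derive (R : realType) (k0 k1 k2 k3 x : R) : 0 < x ->
  is_derive x 1 (log_affine k0 k1 k2 k3) (k1 + k2 * (ln x + 1) + k3 / x).
Proof.
move=> x0; have hl := is_derive1_ln x0.
rewrite /log_affine; apply: is_derive_eq.
by rewrite -![_ *: _]/(_ * _); field; rewrite lt0r_neq0.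
Qed.

Lemma derive_quotient_near (R : realType) (f : R -> R) (x d eps : R) :
  is_derive x 1 f d -> 0 < eps ->
  exists2 r, 0 < r &
    forall h, `|h| < r -> h != 0 -> `|d - (f (h + x) - f x) / h| <= eps.
Proof.
move=> [hd <-] e0; have := hd => /cvgrPdist_le /(_ _ e0).
move=> /nbhs_ballP[r /= r0 hr]; exists r => // h hh h0.
have := hr h; rewrite /ball /= sub0r normrN => /(_ hh h0).
by rewrite -[h *: 1]/(h * 1) mulr1 -[_ *: _]/(_ * _) mulrC.
Qed.

(** The density is minus the limit of the symmetric difference quotient of
gap_tail t at lam; that quotient is the mean of the left and the right one, which
converge to the derivatives of the two branches. *)
Lemma gap_density_of_pieces (R : realType) (t lam a1 b1 a2 b2 d1 d2 : R)
    (f1 f2 : R -> R) :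
  2 / 3 < t -> 0 < lam ->
  a1 < lam -> lam <= b1 -> a2 <= lam -> lam < b2 ->
  (forall c, 0 < c -> a1 <= c -> c <= b1 -> gap_tail t c = f1 c) ->
  (forall c, 0 < c -> a2 <= c -> c <= b2 -> gap_tail t c = f2 c) ->
  is_derive lam 1 f1 d1 -> is_derive lam 1 f2 d2 ->
  is_gap_density t lam (- (d1 + d2) / 2).
Proof.
move=> t23 lam0 a1l lb1 a2l lb2 e1 e2 D1 D2; split.
  near=> del; apply/cvg_ex; eexists; apply: gap_freq_cvg => //.
apply/cvgrPdist_le => eps e0.
have [r1 r10 h1] := derive_quotient_near D1 e0.
have [r2 r20 h2] := derive_quotient_near D2 e0.
near=> del.
have del0 : 0 < del by [].
have dl : del < lam by near: del; exact: nbhs_right_lt.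
have hlim : lim (gap_freq t lam del @ \oo) =
    gap_tail t (lam - del) - gap_tail t (lam + del).
  by apply: cvg_lim => //; exact: gap_freq_cvg.
have dr1 : del < r1 by near: del; exact: nbhs_right_lt.
have dr2 : del < r2 by near: del; exact: nbhs_right_lt.
have da1 : del < lam - a1 by near: del; apply: nbhs_right_lt; rewrite subr_gt0.
have db2 : del < b2 - lam by near: del; apply: nbhs_right_lt; rewrite subr_gt0.
rewrite hlim (e1 (lam - del)); [|lra|lra|lra].
rewrite (e2 (lam + del)); [|lra|lra|lra].
have elam : f1 lam = f2 lam by rewrite -e1 // ?(ltW a1l) // -e2 // ltW.
have q1 := h1 (- del); rewrite normrN gtr0_norm // in q1.
have {}q1 := q1 dr1 _; rewrite oppr_eq0 in q1; have {}q1 := q1 (lt0r_neq0 del0).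
have q2 := h2 del; rewrite gtr0_norm // in q2.
have {}q2 := q2 dr2 (lt0r_neq0 del0).
rewrite [- del + lam]addrC in q1; rewrite [del + lam]addrC -elam in q2.
have -> : - (d1 + d2) / 2 - (2 * del)^-1 * (f1 (lam - del) - f2 (lam + del)) =
   - ((d1 - (f1 (lam - del) - f1 lam) / - del) +
      (d2 - (f2 (lam + del) - f1 lam) / del)) / 2.
  by field; rewrite lt0r_neq0.
rewrite normrM normrN normfV (gtr0_norm (_ : 0 < 2)) // ler_pdivrMr //.
apply: le_trans (ler_normD _ _) _; lra.
Unshelve. all: by end_near.
Qed.

Lemma bump_flat (R : realType) (b u : R) : u <= 2 -> bump b u = bump b 2.
Proof. by move=> u2; rewrite /bump (max_l u2) maxxx. Qed.

Lemma gap_tail_beyond (R : realType) (t c : R) : 2 / t <= c ->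
  gap_tail t c = log_affine 0 0 0 0 c.
Proof.
by move=> h; rewrite /gap_tail max_l // subrr /log_affine; ring.
Qed.

(** In the names of the branches, single, double and triple refer to the maximal
number of rows that overlap in a direction: t >= 2, 1 <= t <= 2 and
2/3 < t <= 1. *)
Lemma gap_tail_single (R : realType) (t c : R) : 2 <= t -> 0 < c -> c <= 2 / t ->
  gap_tail t c = log_affine 1 (- (t / 2)) 0 0 c.
Proof.
move=> t2 c0 cW; have t0 : 0 < t by lra.
have W1 : 2 / t <= 1 by rewrite ler_pdivrMr // mul1r.
have c1 : c <= 1 by exact: le_trans W1.
rewrite /gap_tail /gap_potential (max_r cW) (@bump_flat _ _ c) ?(@bump_flat _ _ (2 / t)) //; try lra.
rewrite /log_ramp /log_affine.
rewrite !(@max_l _ _ 1) // !(@max_l _ _ 2) //; try lra.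
by field; rewrite lt0r_neq0.
Qed.

Lemma gap_tail_double_low (R : realType) (t c : R) :
  1 <= t <= 2 -> 0 < c -> c <= 1 ->
  gap_tail t c =
    log_affine 1 (- (t / 2) - t * (ln (2 / t) + t / 2 - 1)) 0 0 c.
Proof.
move=> /andP[t1 t2] c0 c1; have t0 : 0 < t by lra.
have W1 : 1 <= 2 / t by rewrite ler_pdivlMr // mul1r.
have W2 : 2 / t <= 2 by rewrite ler_pdivrMr //; lra.
rewrite /gap_tail /gap_potential (max_r (le_trans c1 W1)).
rewrite (@bump_flat _ _ c) ?(@bump_flat _ _ (2 / t)) //; try lra.
rewrite /log_ramp /log_affine.
rewrite (@max_r _ _ 1 (2 / t)) // !(@max_l _ _ 1 c) // !(@max_l _ _ 2) //; try lra.
by rewrite ln1; field; rewrite lt0r_neq0.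
Qed.

Lemma gap_tail_double_high (R : realType) (t c : R) :
  1 <= t <= 2 -> 1 <= c -> c <= 2 / t ->
  gap_tail t c =
    log_affine (1 + t) (- (t / 2) - t * (ln (2 / t) + t / 2)) t 0 c.
Proof.
move=> /andP[t1 t2] c1 cW; have t0 : 0 < t by lra.
have W1 : 1 <= 2 / t by rewrite ler_pdivlMr // mul1r.
have W2 : 2 / t <= 2 by rewrite ler_pdivrMr //; lra.
rewrite /gap_tail /gap_potential (max_r cW) (@bump_flat _ _ c) ?(@bump_flat _ _ (2 / t)) //; try lra.
rewrite /log_ramp /log_affine.
rewrite (@max_r _ _ 1 (2 / t)) // !(@max_r _ _ 1 c) // !(@max_l _ _ 2) //; try lra.
field; rewrite !lt0r_neq0 //; lra.
Qed.

Lemma gap_tail_triple_low (R : realType) (t c : R) :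
  0 < t <= 1 -> 0 < c -> c <= 1 ->
  gap_tail t c =
    log_affine 1 (- (t / 2) - t * (ln (2 / t) + t / 2 - 1)
                  - t / 2 * (ln (2 / t) + t - ln 2 - 1)) 0 0 c.
Proof.
move=> /andP[t0 t1] c0 c1.
have W2 : 2 <= 2 / t by rewrite ler_pdivlMr //; lra.
have W1 : 1 <= 2 / t by lra.
rewrite /gap_tail /gap_potential /log_ramp /bump /log_affine (max_r (le_trans c1 W1)).
rewrite (@max_r _ _ 1 (2 / t)) // !(@max_l _ _ 1 c) // (@max_l _ _ 2 c); last by lra.
rewrite (@max_r _ _ 2 (2 / t)) // mulr1 (@min_l _ _ 2 (2 / t)) // minxx.
by rewrite ln1; field; rewrite lt0r_neq0.
Qed.

(** The bump is integrated over its whole support [2, 2c]. *)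
Lemma gap_tail_triple_mid (R : realType) (t c : R) :
  2 / 3 < t <= 1 -> 1 <= c -> c <= 1 / t ->
  gap_tail t c =
    log_affine (1 + 5 * t)
      (- (t / 2) - t * (ln (2 / t) + t / 2)
       - t / 2 * (ln (2 / t) + t - ln 2 - 1) - 4 * t) (3 * t) (2 * t) c.
Proof.
move=> /andP[t23 t1] c1 cW; have t0 : 0 < t by lra.
have W2 : 2 <= 2 / t by rewrite ler_pdivlMr //; lra.
have c2 : 2 * c <= 2 / t by move: cW; rewrite !ler_pdivlMr //; lra.
have cu : c <= 2.
  apply: (le_trans cW); rewrite ler_pdivrMr //; lra.
rewrite /gap_tail /gap_potential /log_ramp /bump /log_affine (@max_r _ _ c); last by lra.
rewrite (@max_r _ _ 1 (2 / t)); last by lra.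
rewrite (@max_r _ _ 1 c) // (@max_l _ _ 2 c) // (@max_r _ _ 2 (2 / t)) //.
rewrite (@min_l _ _ (2 * c) (2 / t)) // (@min_r _ _ (2 * c) 2); last by lra.
rewrite (lnM (_ : 2 \is Num.pos) (_ : c \is Num.pos)) ?posrE //; last by lra.
field; rewrite !lt0r_neq0 //; lra.
Qed.

(** The support [2, 2c] of the bump is cut at 2 / t. *)
Lemma gap_tail_triple_high (R : realType) (t c : R) :
  2 / 3 < t <= 1 -> 1 <= c -> 1 / t <= c -> c <= 2 ->
  gap_tail t c =
    log_affine (3 * t - 1 + 2 * t * (ln (2 / t) - ln 2))
      (- (t / 2) - t * (ln (2 / t) + t / 2)
       - t / 2 * (ln (2 / t) + t - ln 2 - 1)
       + 2 * t * (ln (2 / t) - ln 2) + 2 * t ^+ 2 - 2 * t) t 0 c.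
Proof.
move=> /andP[t23 t1] c1 cW cu; have t0 : 0 < t by lra.
have W2 : 2 <= 2 / t by rewrite ler_pdivlMr //; lra.
have c2 : 2 / t <= 2 * c by move: cW; rewrite !ler_pdivrMr //; lra.
rewrite /gap_tail /gap_potential /log_ramp /bump /log_affine (@max_r _ _ c); last by lra.
rewrite (@max_r _ _ 1 (2 / t)); last by lra.
rewrite (@max_r _ _ 1 c) // (@max_l _ _ 2 c) // (@max_r _ _ 2 (2 / t)) //.
rewrite (@min_r _ _ (2 * c) (2 / t)) // (@min_r _ _ (2 * c) 2); last by lra.
field; rewrite !lt0r_neq0 //; lra.
Qed.

(** The support of the bump is cut at 2 / t and at c. *)
Lemma gap_tail_triple_top (R : realType) (t c : R) :
  2 / 3 < t <= 1 -> 2 <= c -> c <= 2 / t ->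
  gap_tail t c =
    log_affine (- 1 - 2 * t + 2 * t * ln (2 / t))
      (- (t / 2) - t * (ln (2 / t) + t / 2)
       - t / 2 * (ln (2 / t) + t)
       + 2 * t * ln (2 / t) + 2 * t ^+ 2 + t) (- (t / 2)) (- (2 * t)) c.
Proof.
move=> /andP[t23 t1] cu cW; have t0 : 0 < t by lra.
have W2 : 2 <= 2 / t by rewrite ler_pdivlMr //; lra.
have c2 : 2 / t <= 2 * c by rewrite ler_pdivrMr //; nra.
rewrite /gap_tail /gap_potential /log_ramp /bump /log_affine (@max_r _ _ c); last by lra.
rewrite (@max_r _ _ 1 (2 / t)); last by lra.
rewrite (@max_r _ _ 1 c); last by lra.
rewrite (@max_r _ _ 2 c) // (@max_r _ _ 2 (2 / t)) //.
rewrite (@min_r _ _ (2 * c) (2 / t)) // (@min_r _ _ (2 * c) c); last by lra.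
field; rewrite !lt0r_neq0 //; lra.
Qed.

(** * The density in the three ranges of the parameter *)

(** d is the derivative at lam of a branch that represents gap_tail t on an
interval extending to the left of lam. *)
Definition left_slope (R : realType) (t lam d : R) : Prop :=
  exists a b k0 k1 k2 k3,
    [/\ a < lam <= b,
        forall c, 0 < c -> a <= c -> c <= b ->
          gap_tail t c = log_affine k0 k1 k2 k3 c
      & d = k1 + k2 * (ln lam + 1) + k3 / lam].

Definition right_slope (R : realType) (t lam d : R) : Prop :=
  exists a b k0 k1 k2 k3,
    [/\ a <= lam < b,
        forall c, 0 < c -> a <= c -> c <= b ->
          gap_tail t c = log_affine k0 k1 k2 k3 c
      & d = k1 + k2 * (ln lam + 1) + k3 / lam].

Lemma gap_density_of_slopes (R : realType) (t lam d1 d2 : R) :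
  2 / 3 < t -> 0 < lam -> left_slope t lam d1 -> right_slope t lam d2 ->
  is_gap_density t lam (- (d1 + d2) / 2).
Proof.
move=> t23 lam0 [a1 [b1 [k0 [k1 [k2 [k3 [/andP[h1 h2] e1 ->]]]]]]].
move=> [a2 [b2 [l0 [l1 [l2 [l3 [/andP[h3 h4] e2 ->]]]]]]].
exact: (gap_density_of_pieces t23 lam0 h1 h2 h3 h4 e1 e2
  (log_affine_derive _ _ _ _ lam0) (log_affine_derive _ _ _ _ lam0)).
Qed.

Lemma beyond_left (R : realType) (t lam : R) : 2 / t < lam -> left_slope t lam 0.
Proof.
move=> h; exists (2 / t), lam, 0, 0, 0, 0; split; first by rewrite h lexx.
  by move=> c _ hc _; exact: gap_tail_beyond.
by rewrite !mul0r !addr0.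
Qed.

Lemma beyond_right (R : realType) (t lam : R) : 2 / t <= lam -> right_slope t lam 0.
Proof.
move=> h; exists (2 / t), (lam + 1), 0, 0, 0, 0; split.
- by rewrite h ltrDl ltr01.
- by move=> c _ hc _; exact: gap_tail_beyond.
by rewrite !mul0r !addr0.
Qed.

Lemma single_left (R : realType) (t lam : R) : 2 < t -> 0 < lam ->
  left_slope t lam (- (if lam <= 2 / t then t / 2 else 0)).
Proof.
move=> t2 l0; case: ifPn => [h|]; last first.
  by rewrite -ltNge oppr0; exact: beyond_left.
exists 0, (2 / t), 1, (- (t / 2)), 0, 0; split; first by rewrite l0.
  by move=> c c0 _ hc; apply: gap_tail_single => //; exact: ltW.
by rewrite !mul0r !addr0.
Qed.

Lemma single_right (R : realType) (t lam : R) : 2 < t -> 0 < lam ->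
  right_slope t lam (- (if lam < 2 / t then t / 2 else 0)).
Proof.
move=> t2 l0; case: ifPn => [h|]; last first.
  by rewrite -leNgt oppr0; exact: beyond_right.
exists 0, (2 / t), 1, (- (t / 2)), 0, 0; split; first by rewrite (ltW l0).
  by move=> c c0 _ hc; apply: gap_tail_single => //; exact: ltW.
by rewrite !mul0r !addr0.
Qed.

Definition double_low (R : realType) (t : R) : R :=
  t ^+ 2 / 2 - t / 2 - t * ln (t / 2).

Definition double_high (R : realType) (t lam : R) : R :=
  t ^+ 2 / 2 - t / 2 - t * ln (lam * t / 2).

Lemma double_left (R : realType) (t lam : R) : 1 < t <= 2 -> 0 < lam ->
  left_slope t lam
    (- (if lam < 1 then double_low t
        else if lam <= 2 / t then double_high t lam else 0)).
Proof.
move=> /andP[t1 t2] l0; have t0 : 0 < t by lra.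
have hn (x y : R) : 0 < x -> 0 < y -> ln (x / y) = ln x - ln y.
  by move=> x0 y0; rewrite ln_div ?posrE.
have hM : ln (lam * t / 2) = ln lam + ln t - ln 2.
  by rewrite hn ?mulr_gt0 // lnM ?posrE.
have low : lam <= 1 -> left_slope t lam (- double_low t).
  move=> l1; exists 0, 1; do 4 eexists; split; first by rewrite l0.
    by move=> c c0 _ hc; apply: gap_tail_double_low => //; rewrite (ltW t1).
  by rewrite /double_low !hn //; field; rewrite ?lt0r_neq0.
case: ltP => l1; first exact/low/ltW.
case: leP => lW; last by rewrite oppr0; exact: beyond_left.
move: l1; rewrite le_eqVlt => /orP[/eqP e|l1].
  have -> : double_high t lam = double_low t.
    by rewrite /double_high /double_low -e mul1r.
  by apply: low; rewrite -e.
exists 1, (2 / t); do 4 eexists; split; first by rewrite l1.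
  by move=> c c0 c1 hc; apply: gap_tail_double_high => //; rewrite (ltW t1).
by rewrite /double_high hM !hn //; field; rewrite ?lt0r_neq0.
Qed.

Lemma double_right (R : realType) (t lam : R) : 1 < t <= 2 -> 0 < lam ->
  right_slope t lam
    (- (if lam < 1 then double_low t
        else if lam < 2 / t then double_high t lam else 0)).
Proof.
move=> /andP[t1 t2] l0; have t0 : 0 < t by lra.
have hn (x y : R) : 0 < x -> 0 < y -> ln (x / y) = ln x - ln y.
  by move=> x0 y0; rewrite ln_div ?posrE.
have hM : ln (lam * t / 2) = ln lam + ln t - ln 2.
  by rewrite hn ?mulr_gt0 // lnM ?posrE.
case: ltP => l1.
  exists 0, 1; do 4 eexists; split; first by rewrite (ltW l0).
    by move=> c c0 _ hc; apply: gap_tail_double_low => //; rewrite (ltW t1).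
  by rewrite /double_low !hn //; field; rewrite ?lt0r_neq0.
case: ltP => lW; last by rewrite oppr0; exact: beyond_right.
exists 1, (2 / t); do 4 eexists; split; first by rewrite l1.
  by move=> c c0 c1 hc; apply: gap_tail_double_high => //; rewrite (ltW t1).
by rewrite /double_high hM !hn //; field; rewrite ?lt0r_neq0.
Qed.

Definition triple_density (R : realType) (t lam : R) : R :=
  if lam < 1 then
    t ^+ 2 - t - 3 / 2 * t * ln t + t * ln 2
  else if lam < 1 / t then
    t ^+ 2 + t - 2 * t / lam - 3 * t * ln lam - 3 * t / 2 * ln t
    + t * ln 2
  else if lam <= 2 then
    - t ^+ 2 + t - t * ln (lam / 2) + t / 2 * ln t
  else if lam <= 2 / t then
    - t ^+ 2 + 2 * t / lam + t / 2 * ln (lam * t / 2)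
  else 0.

Lemma triple_left (R : realType) (t lam : R) : 2 / 3 < t <= 1 -> 0 < lam ->
  left_slope t lam (- triple_density t lam).
Proof.
move=> /andP[t23 t1] l0; have t0 : 0 < t by lra.
have hn (x y : R) : 0 < x -> 0 < y -> ln (x / y) = ln x - ln y.
  by move=> x0 y0; rewrite ln_div ?posrE.
have hM : ln (lam * t / 2) = ln lam + ln t - ln 2.
  by rewrite hn ?mulr_gt0 // lnM ?posrE.
have t11 : 1 <= 1 / t by rewrite ler_pdivlMr // mul1r.
have t12 : 1 / t < 2 by rewrite ltr_pdivrMr //; lra.
rewrite /triple_density.
case: (lerP lam 1) => l1.
  exists 0, 1; do 4 eexists; split; first by rewrite l0.
    by move=> c c0 _ hc; apply: gap_tail_triple_low => //; rewrite t0.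
  move: l1; rewrite le_eqVlt => /orP[/eqP ->|->]; last first.
    by rewrite !hn //; field; rewrite ?lt0r_neq0.
  rewrite ltxx ln1; case: ltP => h1; first by rewrite !hn //; field; rewrite ?lt0r_neq0.
  have {}h1 : t = 1.
    by apply/eqP; rewrite eq_le t1 /=; move: h1; rewrite ler_pdivrMr // mul1r.
  have lt1 : ln t = 0 by rewrite h1 ln1.
  by rewrite ler1n /= !hn // lt1 ln1 h1; field; rewrite ?lt0r_neq0.
rewrite ltNge (ltW l1) /=.
case: (lerP lam (1 / t)) => lt.
  exists 1, (1 / t); do 4 eexists; split; first by rewrite l1.
    by move=> c c0 c1 hc; apply: gap_tail_triple_mid => //; rewrite t23.
  case: ltP => h1; first by rewrite !hn //; field; rewrite ?lt0r_neq0.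
  have -> : lam = 1 / t by apply/eqP; rewrite eq_le lt.
  by rewrite (ltW t12) !hn ?divr_gt0 // ln1; field; rewrite ?lt0r_neq0.
rewrite ltNge (ltW lt) /=.
case: leP => l2.
  exists (1 / t), 2; do 4 eexists; split; first by rewrite lt.
    move=> c c0 c1 hc; apply: gap_tail_triple_high => //; first by rewrite t23.
    exact: le_trans c1.
  by rewrite !hn //; field; rewrite ?lt0r_neq0.
case: leP => lW; last by rewrite oppr0; exact: beyond_left.
exists 2, (2 / t); do 4 eexists; split; first by rewrite l2.
  by move=> c c0 c1 hc; apply: gap_tail_triple_top => //; rewrite t23.
by rewrite hM !hn //; field; rewrite ?lt0r_neq0.
Qed.

Lemma triple_right (R : realType) (t lam : R) : 2 / 3 < t <= 1 -> 0 < lam ->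
  right_slope t lam (- triple_density t lam).
Proof.
move=> /andP[t23 t1] l0; have t0 : 0 < t by lra.
have hn (x y : R) : 0 < x -> 0 < y -> ln (x / y) = ln x - ln y.
  by move=> x0 y0; rewrite ln_div ?posrE.
have hM : ln (lam * t / 2) = ln lam + ln t - ln 2.
  by rewrite hn ?mulr_gt0 // lnM ?posrE.
have t11 : 1 <= 1 / t by rewrite ler_pdivlMr // mul1r.
have t12 : 1 / t < 2 by rewrite ltr_pdivrMr //; lra.
have t22 : 2 <= 2 / t by rewrite ler_pdivlMr //; lra.
rewrite /triple_density; case: ltP => l1.
  exists 0, 1; do 4 eexists; split; first by rewrite (ltW l0).
    by move=> c c0 _ hc; apply: gap_tail_triple_low => //; rewrite t0.
  by rewrite !hn //; field; rewrite ?lt0r_neq0.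
case: ltP => lt.
  exists 1, (1 / t); do 4 eexists; split; first by rewrite l1.
    by move=> c c0 c1 hc; apply: gap_tail_triple_mid => //; rewrite t23.
  by rewrite !hn //; field; rewrite ?lt0r_neq0.
case: (ltrP lam 2) => l2.
  exists (1 / t), 2; do 4 eexists; split; first by rewrite lt.
    move=> c c0 c1 hc; apply: gap_tail_triple_high => //; first by rewrite t23.
    exact: le_trans c1.
  by rewrite (ltW l2) !hn //; field; rewrite ?lt0r_neq0.
case: (ltrP lam (2 / t)) => lW.
  exists 2, (2 / t); do 4 eexists; split; first by rewrite l2.
    by move=> c c0 c1 hc; apply: gap_tail_triple_top => //; rewrite t23.
  case: leP => l3; last by rewrite (ltW lW) hM !hn //; field; rewrite ?lt0r_neq0.
  have -> : lam = 2 by apply/eqP; rewrite eq_le l3.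
  by rewrite !hn //; field; rewrite ?lt0r_neq0.
have -> : - (if lam <= 2 then - t ^+ 2 + t - t * ln (lam / 2) + t / 2 * ln t
   else if lam <= 2 / t then - t ^+ 2 + 2 * t / lam + t / 2 * ln (lam * t / 2)
   else 0) = 0; last exact: beyond_right.
case: leP => l3.
  have e1 : t = 1.
    apply/eqP; rewrite eq_le t1 /=.
    have : 2 / t <= 2 by exact: le_trans l3.
    by rewrite ler_pdivrMr //; lra.
  have -> : lam = 2 by apply/eqP; rewrite eq_le l3.
  have lt1 : ln t = 0 by rewrite e1 ln1.
  have l22 : ln (2 / 2) = 0 :> R by rewrite divff // ln1.
  by rewrite lt1 l22 e1; ring.
case: leP => l4; last by rewrite oppr0.
have -> : lam = 2 / t by apply/eqP; rewrite eq_le l4.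
have l22 : ln (2 / 2) = 0 :> R by rewrite divff // ln1.
by rewrite divfK ?lt0r_neq0 // l22; field; rewrite ?lt0r_neq0.
Qed.

Unset Implicit Arguments.

Theorem mainTheorem6 (R : realType) (t lam : R)
    (ht : 2 / 3 < t) (hlam : 0 < lam) :
  [/\ 2 < t ->
      is_gap_density t lam
        (if lam < 2 / t then t / 2
         else if lam == 2 / t then t / 4
         else 0),
      1 < t <= 2 ->
      is_gap_density t lam
        (if lam < 1 then t ^+ 2 / 2 - t / 2 - t * ln (t / 2)
         else if lam < 2 / t then
           t ^+ 2 / 2 - t / 2 - t * ln (lam * t / 2)
         else if lam == 2 / t then t ^+ 2 / 4 - t / 4
         else 0)
    & t <= 1 ->
      is_gap_density t lam
        (if lam < 1 then
           t ^+ 2 - t - 3 / 2 * t * ln t + t * ln 2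
         else if lam < 1 / t then
           t ^+ 2 + t - 2 * t / lam - 3 * t * ln lam - 3 * t / 2 * ln t
           + t * ln 2
         else if lam <= 2 then
           - t ^+ 2 + t - t * ln (lam / 2) + t / 2 * ln t
         else if lam <= 2 / t then
           - t ^+ 2 + 2 * t / lam + t / 2 * ln (lam * t / 2)
         else 0)].
Proof.
have t0 : 0 < t by lra.
split=> [t2|t12|t1].
- have := gap_density_of_slopes ht hlam (single_left t2 hlam) (single_right t2 hlam).
  congr is_gap_density.
  by case: (ltgtP lam (2 / t)) => _; field.
- have := gap_density_of_slopes ht hlam (double_left t12 hlam) (double_right t12 hlam).
  congr is_gap_density; rewrite -/(double_low t) -/(double_high t lam).
  case: ltP => l1; first by field.
  case: (ltgtP lam (2 / t)) => lW; try by field.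
  have l22 : ln (2 / 2) = 0 :> R by rewrite divff // ln1.
  by rewrite /double_high lW divfK ?lt0r_neq0 // l22; field; rewrite ?lt0r_neq0.
- have t1' : 2 / 3 < t <= 1 by rewrite ht.
  have := gap_density_of_slopes ht hlam (triple_left t1' hlam) (triple_right t1' hlam).
  by congr is_gap_density; rewrite -/(triple_density t lam); field.
Qed.
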